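(* For every $\alpha,\alpha'\in[0,1]$ with $\alpha\ne\alpha'$, we have $$\lim_{n\to\infty}\mathrm{TV}\left(\alpha\text{-}\mathrm{CUA}(n),\ \alpha'\text{-}\mathrm{CUA}(n)\right)=1 .$$
   Context: Correlated uniform attachment (UA) trees with parameter $\alpha\in[0,1]$: two trees $(T_n^1,T_n^2)_{n\ge 0}$ are grown together, both starting from a single node labeled $0$. At each step $n\ge1$, independently of the past: with probability $\alpha$ (''aligned choice'') a single $i\in\{0,\dots,n-1\}$ is chosen uniformly at random and the new node $n$ is connected to node $i$ in both trees; with probability $1-\alpha$ (''independent choice'') $i_1,i_2\in\{0,\dots,n-1\}$ are chosen independently and uniformly, and the new node $n$ is connected to $i_1$ in the first tree and to $i_2$ in the second tree. $\alpha\text{-}\mathrm{CUA}(n)$ is the law of the resulting pair of unlabeled trees (each tree is taken up to isomorphism, with the node labels forgotten). For probability measures $P,Q$ on a discrete set $\mathcal X$, $\mathrm{TV}(P,Q)=\sup_{A\subseteq\mathcal X}|P(A)-Q(A)|$. *)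

(* Defs.v *)
From HB Require Import structures.
From mathcomp Require Import all_boot all_order all_algebra all_fingroup.
From mathcomp Require Import all_classical all_reals all_analysis.

Set Implicit Arguments.
Unset Strict Implicit.
Unset Printing Implicit Defensive.

Import Order.TTheory GRing.Theory Num.Theory.
Import numFieldNormedType.Exports.

Local Open Scope ring_scope.

(* A graph on the vertices 0, .., n is given by its edge set, an edge being   *)
(* an unordered pair of vertices.  Only trees get positive mass below.        *)
Notation graph n := {set {set 'I_n.+1}}.

Definition relabel n (s : {perm 'I_n.+1}) (E : graph n) : graph n :=
  [set s @: (e : {set 'I_n.+1}) | e in E].

Definition isomorphic n : rel (graph n) :=
  fun E F => [exists s : {perm 'I_n.+1}, F == relabel s E].

Lemma isomorphic_equiv n : equiv_class_of (@isomorphic n).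
Proof.
have comp (s t : {perm 'I_n.+1}) (E : graph n) :
    relabel t (relabel s E) = relabel (s * t)%g E.
  rewrite /relabel -imset_comp; apply: eq_imset => e /=.
  by rewrite -imset_comp; apply: eq_imset => x /=; rewrite permM.
have one (E : graph n) : relabel 1%g E = E.
  rewrite /relabel -[RHS]imset_id; apply: eq_imset => e.
  by rewrite -[RHS]imset_id; apply: eq_imset => x; rewrite perm1.
have sym (E F : graph n) : isomorphic E F -> isomorphic F E.
  case/existsP => s /eqP ->; apply/existsP; exists s^-1%g.
  by rewrite comp mulgV one.
split.
- by move=> E; apply/existsP; exists 1%g; rewrite one.
- by move=> E F; apply/idP/idP; apply: sym.
- move=> F E G /existsP[s /eqP ->] /existsP[t /eqP ->].
  by apply/existsP; exists (s * t)%g; rewrite comp.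
Qed.

Canonical isomorphic_equivRel n := EquivRelPack (isomorphic_equiv n).

Definition unlabeled n := {eq_quot (@isomorphic n)}%qT.
HB.instance Definition _ n := EqQuotient.on (unlabeled n).
HB.instance Definition _ n := Countable.on (unlabeled n).

Lemma unlabeled_enumP n :
  Finite.axiom (undup [seq \pi_(unlabeled n)%qT E | E : graph n]).
Proof.
move=> x; rewrite count_uniq_mem ?undup_uniq // mem_undup.
by rewrite -[x]reprK map_f // mem_enum.
Qed.

HB.instance Definition _ n :=
  fintype.isFinite.Build (unlabeled n) (@unlabeled_enumP n).

(* Step k, for k < n, attaches the new vertex k+1 to some vertex of           *)
(* {0, .., k}, which is a subset of 'I_n.  A history of the growth of a pair  *)
(* of trees thus records, for each k, the neighbours of k+1 in the two trees; *)
(* the histories with a neighbour of k+1 larger than k get weight 0 below.    *)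
Notation history n := {ffun 'I_n -> 'I_n * 'I_n}.

(* The edges are {k+1, f k}, for k < n. *)
Definition grow n (f : 'I_n -> 'I_n) : graph n :=
  [set [set lift ord0 k; widen_ord (leqnSn n) (f k)] | k : 'I_n].

Definition grow_pair n (h : history n) : unlabeled n * unlabeled n :=
  (\pi_(unlabeled n) (grow (fun k => (h k).1)),
   \pi_(unlabeled n) (grow (fun k => (h k).2)))%qT.

Section CUA.
Variable R : realType.

Definition uniform n (k i : 'I_n) : R :=
  if (i <= k)%N then k.+1%:R^-1 else 0.

Definition step (alpha : R) n (k : 'I_n) (c : 'I_n * 'I_n) : R :=
  alpha * (if c.1 == c.2 then uniform k c.1 else 0)
  + (1 - alpha) * (uniform k c.1 * uniform k c.2).

Definition history_law (alpha : R) n (h : history n) : R :=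
  \prod_(k < n) step alpha k (h k).

(* The mass function of the pair (T_n^1, T_n^2) of unlabeled trees. *)
Definition CUA (alpha : R) n (t : unlabeled n * unlabeled n) : R :=
  \sum_(h : history n | grow_pair h == t) history_law alpha h.

(* P and Q are the mass functions of probability measures on X. *)
Definition TV (X : finType) (P Q : X -> R) : R :=
  sup (range (fun A : {set X} => `|\sum_(x in A) P x - \sum_(x in A) Q x|)).

Lemma sum_uniform n (k : 'I_n) : \sum_i uniform k i = 1.
Proof.
rewrite /uniform -big_mkcond /= sumr_const.
have -> : #|[pred i : 'I_n | (i <= k)%N]| = k.+1.
  rewrite -[RHS]card_ord -(card_imset (mem 'I_k.+1) (f := widen_ord (ltn_ord k))).
    apply: eq_card => i; rewrite !inE; apply/idP/imsetP => [ik|[j _ ->]].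
      by exists (Ordinal (ik : (i < k.+1)%N)) => //; apply: val_inj.
    by rewrite /= -ltnS ltn_ord.
  by move=> i j /(congr1 val) /= /val_inj.
by rewrite -(mulr_natr k.+1%:R^-1) mulVf // pnatr_eq0.
Qed.

Lemma CUA_ge0 (alpha : R) n (t : unlabeled n * unlabeled n) : 0 <= alpha <= 1 -> 0 <= CUA alpha t.
Proof.
move=> /andP[a0 a1]; have u0 (k i : 'I_n) : 0 <= uniform k i.
  by rewrite /uniform; case: ifP; rewrite // invr_ge0 ler0n.
apply: sumr_ge0 => h _; apply: prodr_ge0 => k _.
apply: addr_ge0; first by apply: mulr_ge0 => //; case: ifP.
by rewrite !mulr_ge0 // subr_ge0.
Qed.

Lemma sum_CUA (alpha : R) n : \sum_(t : unlabeled n * unlabeled n) CUA alpha t = 1.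
Proof.
have -> : \sum_(t : unlabeled n * unlabeled n) CUA alpha t = \sum_(h : history n) history_law alpha h.
  by rewrite (partition_big (@grow_pair n) predT).
rewrite -(bigA_distr_bigA (fun k c => @step alpha n k c)) big1 // => k _.
rewrite big_split /= -!mulr_sumr.
rewrite -(pair_bigA _ (fun i j => if i == j then uniform k i else 0)) /=.
rewrite -(pair_bigA _ (fun i j => uniform k i * uniform k j)) /=.
rewrite -big_distrlr /= sum_uniform mulr1.
rewrite (eq_bigr (uniform k)) ?sum_uniform ?mulr1 ?subrKC // => i _.
by rewrite -big_mkcond /= (big_pred1 i) // => j; rewrite eq_sym.
Qed.

End CUA.

(* Main.v *)
Require Import Defs.
From mathcomp Require Import all_boot all_order all_algebra all_fingroup.
From mathcomp Require Import all_classical all_reals all_analysis.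
From mathcomp Require Import ring lra zify.

Set Implicit Arguments.
Unset Strict Implicit.
Unset Printing Implicit Defensive.

Import Order.TTheory GRing.Theory Num.Theory.
Import numFieldNormedType.Exports.

Local Open Scope ring_scope.

(* Let s_v be the size of the subtree of a node v and let g_l(s) = prod_(1 <= r < s) (1 + l / r).
   The centered sum X_l of the g_l(s_v) satisfies X_l(n+1) = (1 + l/m) X_l(n) + xi, where m = n+1
   is the number of nodes and xi is a martingale increment of bounded variance, so for l < 1/2
   its variance is of order m / (1 - 2l).  As l tends to the critical value 1/2 all logarithmic
   scales contribute to X_l, and the X_l become asymptotically uncorrelated along a sequence
   l_j = (1 - 2^-(j+1)) / 2.  The test statistic is
     S = (1/m) sum_(j < J) (1 - 2 l_j) X_(l_j)(T^1) X_(l_j)(T^2).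
   - Mean.  E_alpha [G(T^1) G(T^2)] is a noise operator form: it is nondecreasing in alpha and at
     least (E G)^2.  This bounds the growth of E_alpha [X_l(T^1) X_l(T^2)] in alpha from below by
     the variance, over the nodes u, of the expectation of the noise term at u, and yields a
     difference of means of order J |alpha - alpha'|.
   - Variance.  The conditional covariances of the increments concentrate (Efron--Stein, after
     truncation to small subtrees), so that the fourth moments of the X_l obey Isserlis' formula
     up to o(m^2), and S has variance O(J).
   Chebyshev's inequality separates the two laws when n, and then J, is large.  Up to o(sqrt m),
   X_l depends only on the unlabeled unrooted tree: it can be read off from the component sizes
   left by the removal of an edge. *)

(** The weights are forced by linearity: a node attached below [i] raises the subtree sizes of the
    ancestors of [i] by one, and g_l(s+1) - g_l(s) = l g_l(s)/s. So the total grows by 1 plus [l]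
    times the sum of g_l(s_v)/s_v over these ancestors, and this ancestor sum, averaged over all
    nodes, is the total divided by m. For one exponent the gap of the means and the bound on the
    standard deviation have the same order, so Chebyshev alone leaves a fixed error. With eps = 1 -
    2 l, the covariance bound of order m/(eps_i + eps_j) makes the normalized covariances summable
    for geometric eps, and [J] exponents average the error out. The obstacle is that an early choice
    can move a large part of the tree, which rules out bounded differences for full ancestor sums,
    and that the root is not observable. Both concern large subtrees only, and a comparison with a
    larger exponent controls these, as the ancestor sums have bounded fourth moments for all
    exponents below 1. Truncation uses the exponent 3/4; forgetting the root needs one in (l + 1/2,
    1), nonempty exactly when l < 1/2. *)

(** * Iterated expectations over growth histories *)

Section Expectation.
Variables (R : realType) (T : Type).
Implicit Types (n m : nat) (h q r : seq T) (c : T).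

(** Shared interface for one tree ([avg]) and for the coupled pair ([avg2]). The argument [m] is the
    number of nodes available as neighbours; an average over no node cannot be normalized, hence
    [m.+1] in the last two axioms. *)
Record is_expectation (dom : nat -> T -> Prop) (K : nat -> (T -> R) -> R) : Prop :=
  IsExpectation {
  expD : forall m f g, K m (fun c => f c + g c) = K m f + K m g;
  expZ : forall m a f, K m (fun c => a * f c) = a * K m f;
  exp1 : forall m, K m.+1 (fun=> 1) = 1;
  exp_le : forall m f g, (forall c, dom m.+1 c -> f c <= g c) -> K m.+1 f <= K m.+1 g }.

Fixpoint valid (dom : nat -> T -> Prop) h : Prop :=
  if h is c :: h' then dom (size h) c /\ valid dom h' else True.

(** The newest choice is the head of a history. A history of length [n'] describes [n'.+1] nodes, so
    the next choice is averaged by [K n'.+1]. *)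
Fixpoint expect (K : nat -> (T -> R) -> R) n (f : seq T -> R) : R :=
  if n is n'.+1 then expect K n' (fun h => K n (fun c => f (c :: h))) else f [::].

Variables (dom : nat -> T -> Prop) (K : nat -> (T -> R) -> R).
Hypothesis KP : is_expectation dom K.

Lemma exp_cst m a : K m.+1 (fun=> a) = a.
Proof.
have -> : (fun=> a) = (fun _ : T => a * 1) by rewrite mulr1.
by rewrite (expZ KP) (exp1 KP) mulr1.
Qed.

Lemma expB m f g : K m (fun c => f c - g c) = K m f - K m g.
Proof.
rewrite -mulN1r -(expZ KP) -(expD KP).
by congr (K m _); apply/funext => c; rewrite mulN1r.
Qed.

Lemma exp_eq m f g : (forall c, dom m.+1 c -> f c = g c) -> K m.+1 f = K m.+1 g.
Proof.
by move=> fg; apply/eqP; rewrite eq_le !(exp_le KP) // => c /fg ->.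
Qed.

Lemma exp_norm_le m f B : (forall c, dom m.+1 c -> `|f c| <= B) -> `|K m.+1 f| <= B.
Proof.
move=> fB; rewrite ler_norml; apply/andP; split.
  by rewrite -(exp_cst m (- B)); apply: (exp_le KP) => c /fB; rewrite ler_norml => /andP[].
by rewrite -[leRHS](exp_cst m); apply: (exp_le KP) => c /fB; rewrite ler_norml => /andP[].
Qed.

Lemma exp_norm m f : `|K m.+1 f| <= K m.+1 (fun c => `|f c|).
Proof.
rewrite ler_norml; apply/andP; split; last by apply: (exp_le KP) => c _; exact: ler_norm.
rewrite -mulN1r -(expZ KP); apply: (exp_le KP) => c _.
by rewrite mulN1r lerNl -normrN ler_norm.
Qed.

Lemma expect_le n (f g : seq T -> R) :
  (forall h, size h = n -> valid dom h -> f h <= g h) -> expect K n f <= expect K n g.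
Proof.
elim: n f g => [|n IH] f g fg; first exact: fg.
apply: IH => h hn hv; apply: (exp_le KP) => c dc.
by apply: fg => /=; rewrite hn.
Qed.

Lemma expect_eq n (f g : seq T -> R) :
  (forall h, size h = n -> valid dom h -> f h = g h) -> expect K n f = expect K n g.
Proof.
by move=> fg; apply/eqP; rewrite eq_le !expect_le // => h hn hv; rewrite fg.
Qed.

Lemma expectD n (f g : seq T -> R) :
  expect K n (fun h => f h + g h) = expect K n f + expect K n g.
Proof.
elim: n f g => [//|n IH] f g /=; rewrite -IH; congr expect.
by apply/funext => h; rewrite -(expD KP).
Qed.

Lemma expectZ n a (f : seq T -> R) : expect K n (fun h => a * f h) = a * expect K n f.
Proof.
elim: n f => [//|n IH] f /=; rewrite -IH; congr expect.
by apply/funext => h; rewrite -(expZ KP).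
Qed.

Lemma expectZr n a (f : seq T -> R) : expect K n (fun h => f h * a) = expect K n f * a.
Proof.
by rewrite mulrC -expectZ; apply: expect_eq => h _ _; rewrite mulrC.
Qed.

Lemma expect_cst n a : expect K n (fun=> a) = a.
Proof.
elim: n => [//|n IH] /=; rewrite -[RHS]IH; congr expect.
by apply/funext => h; rewrite exp_cst.
Qed.

Lemma expectN n (f : seq T -> R) : expect K n (fun h => - f h) = - expect K n f.
Proof.
by rewrite -mulN1r -expectZ; apply: expect_eq => h _ _; rewrite mulN1r.
Qed.

Lemma expectB n (f g : seq T -> R) :
  expect K n (fun h => f h - g h) = expect K n f - expect K n g.
Proof. by rewrite expectD expectN. Qed.

Lemma expect_sum n I (s : seq I) (P : pred I) (F : I -> seq T -> R) :
  expect K n (fun h => \sum_(i <- s | P i) F i h) = \sum_(i <- s | P i) expect K n (F i).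
Proof.
elim: s => [|i s IH].
  by rewrite big_nil -[RHS](expect_cst n); congr expect; apply/funext => h; rewrite big_nil.
rewrite big_cons -IH; case: ifP => Pi; rewrite -?expectD; congr expect;
  by apply/funext => h; rewrite big_cons Pi.
Qed.

Lemma expect_ge0 n (f : seq T -> R) :
  (forall h, size h = n -> valid dom h -> 0 <= f h) -> 0 <= expect K n f.
Proof. by move=> f0; rewrite -(expect_cst n 0); apply: expect_le. Qed.

Lemma expect_norm n (f : seq T -> R) : `|expect K n f| <= expect K n (fun h => `|f h|).
Proof.
rewrite ler_norml -expectN; apply/andP; split; apply: expect_le => h _ _.
  by rewrite lerNl -normrN ler_norm.
exact: ler_norm.
Qed.

(* The discriminant argument for the nonnegative quadratic form [t |-> E (t f - g)^2]. *)
Lemma expect_CS n (f g : seq T -> R) :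
  expect K n (fun h => f h * g h) ^+ 2 <=
  expect K n (fun h => f h ^+ 2) * expect K n (fun h => g h ^+ 2).
Proof.
set a := expect K n (fun h => f h ^+ 2); set c := expect K n (fun h => g h ^+ 2).
set b := expect _ _ _.
have q t s : 0 <= t ^+ 2 * a - 2 * (t * s) * b + s ^+ 2 * c.
  rewrite /a /b /c -!expectZ -expectB -expectD; apply: expect_ge0 => h _ _.
  have -> : t ^+ 2 * f h ^+ 2 - 2 * (t * s) * (f h * g h) + s ^+ 2 * g h ^+ 2
    = (t * f h - s * g h) ^+ 2 by ring.
  exact: sqr_ge0.
have a0 : 0 <= a by apply: expect_ge0 => h _ _; exact: sqr_ge0.
have c0 : 0 <= c by apply: expect_ge0 => h _ _; exact: sqr_ge0.
have [a_gt0|] := ltP 0 a.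
  have := q b a.
  have -> : b ^+ 2 * a - 2 * (b * a) * b + a ^+ 2 * c = a * (a * c - b ^+ 2) by ring.
  by rewrite pmulr_rge0 // subr_ge0.
move=> a_le0; have aE : a = 0 by apply/eqP; rewrite eq_le a_le0 a0.
rewrite aE mul0r; have [->|b0] := eqVneq b 0; first by rewrite expr0n.
have := q ((c + 1) / (2 * b)) 1; rewrite aE.
have -> : ((c + 1) / (2 * b)) ^+ 2 * 0 - 2 * ((c + 1) / (2 * b) * 1) * b + 1 ^+ 2 * c = - 1.
  by field.
lra.
Qed.

(** Efron--Stein by induction: conditioning on all but the newest choice splits the variance
    orthogonally into a conditional variance, at most [B ^+ 2], and the variance of the conditional
    mean [F], which inherits the bounded differences. *)
Lemma expect_var_bounded_diff n (B : R) (f : seq T -> R) :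
  (forall q r c c', size (q ++ c :: r) = n -> valid dom (q ++ c :: r) ->
     valid dom (q ++ c' :: r) -> `|f (q ++ c :: r) - f (q ++ c' :: r)| <= B) ->
  expect K n (fun h => (f h - expect K n f) ^+ 2) <= n%:R * B ^+ 2.
Proof.
elim: n f => [|n IH] f fB; first by rewrite /= subrr expr0n mul0r.
pose F h := K n.+1 (fun c => f (c :: h)).
have FE : expect K n.+1 f = expect K n F by [].
have FB q r c c' : size (q ++ c :: r) = n -> valid dom (q ++ c :: r) ->
     valid dom (q ++ c' :: r) -> `|F (q ++ c :: r) - F (q ++ c' :: r)| <= B.
  move=> sn vc vc'; rewrite /F -expB; apply: exp_norm_le => d dd.
  have sn' : size (q ++ c' :: r) = n by rewrite -sn !size_cat.
  by apply: (fB (d :: q)); rewrite /= ?sn ?sn'.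
have := IH F FB; rewrite FE; set e := expect K n F => IHF.
have -> : n.+1%:R * B ^+ 2 = n%:R * B ^+ 2 + expect K n (fun=> B ^+ 2).
  by rewrite expect_cst -natr1; ring.
apply: le_trans (lerD IHF (lexx _)); rewrite -expectD /=.
apply: expect_le => h hn hv.
have -> : K n.+1 (fun c => (f (c :: h) - e) ^+ 2) =
   K n.+1 (fun c => (f (c :: h) - F h) ^+ 2) + (F h - e) ^+ 2.
  rewrite -(exp_cst n ((F h - e) ^+ 2)) -[RHS]addr0.
  have <- : 2 * (F h - e) * K n.+1 (fun c => f (c :: h) - F h) = 0.
    by rewrite expB exp_cst subrr mulr0.
  by rewrite -(expZ KP) -!(expD KP); apply: exp_eq => c _; ring.
rewrite addrC lerD2l -[leRHS](exp_cst n); apply: (exp_le KP) => c dc.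
rewrite -[leLHS]ger0_norm ?sqr_ge0 // normrX lerXn2r ?nnegrE //.
  by have := fB [::] h c c; rewrite /= hn subrr normr0; apply.
rewrite /F -{1}(exp_cst n (f (c :: h))) -expB; apply: exp_norm_le => d dd.
by apply: (fB [::]); rewrite /= ?hn.
Qed.

End Expectation.

(** * One-step averages and the noise operator *)

Section Average.
Variable R : realType.
Implicit Types (n m i : nat) (p : seq nat) (h : seq (nat * nat)).

Definition avg m (f : nat -> R) : R := (\sum_(i < m) f i) / m%:R.

Definition avg2 (alpha : R) m (f : nat * nat -> R) : R :=
  alpha * avg m (fun i => f (i, i)) + (1 - alpha) * avg m (fun i => avg m (fun j => f (i, j))).

Definition pick (a : bool) (c : nat * nat) : nat := if a then c.2 else c.1.

Definition below m i : Prop := (i < m)%N.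
Definition below2 m (c : nat * nat) : Prop := (c.1 < m)%N /\ (c.2 < m)%N.

Lemma avgP : is_expectation below avg.
Proof.
split=> [m f g|m a f|m|m f g fg]; rewrite /avg.
- by rewrite big_split mulrDl.
- by rewrite -mulr_sumr mulrA.
- by rewrite sumr_const card_ord divff // pnatr_eq0.
- by rewrite ler_pM2r ?invr_gt0 ?ltr0n //; apply: ler_sum => i _; apply: fg; exact: ltn_ord.
Qed.

Lemma avg2P alpha : 0 <= alpha <= 1 -> is_expectation below2 (avg2 alpha).
Proof.
move=> /andP[a0 a1]; split=> [m f g|m a f|m|m f g fg]; rewrite /avg2.
- rewrite (expD avgP); set u := fun i => avg m (fun j => f (i, j) + g (i, j)).
  have -> : u = (fun i => avg m (fun j => f (i, j)) + avg m (fun j => g (i, j))).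
    by apply/funext => i; rewrite /u (expD avgP).
  by rewrite (expD avgP); ring.
- rewrite (expZ avgP); set u := fun i => avg m (fun j => a * f (i, j)).
  have -> : u = (fun i => a * avg m (fun j => f (i, j))).
    by apply/funext => i; rewrite /u (expZ avgP).
  by rewrite (expZ avgP); ring.
- by rewrite !(exp_cst avgP); ring.
- apply: lerD; apply: ler_wpM2l; rewrite ?subr_ge0 //; apply: (exp_le avgP) => i im.
    exact: fg.
  by apply: (exp_le avgP) => j jm; exact: fg.
Qed.

Lemma avg2_pick alpha a m (f : nat -> R) : avg2 alpha m.+1 (fun c => f (pick a c)) = avg m.+1 f.
Proof.
rewrite /avg2; case: a => /=; first by rewrite (exp_cst avgP); ring.
have -> : (fun i => avg m.+1 (fun=> f i)) = f by apply/funext => i; rewrite (exp_cst avgP).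
by ring.
Qed.

(** Each marginal is a plain uniform attachment tree, whatever [alpha]; estimates for a single tree
    are transferred to the pair by this identity. *)
Lemma expect_tree alpha a n (G : seq nat -> R) :
  expect (avg2 alpha) n (fun h => G (map (pick a) h)) = expect avg n G.
Proof.
elim: n G => [//|n IH] G /=; rewrite -IH; congr expect.
by apply/funext => h /=; rewrite -(avg2_pick alpha a).
Qed.

Lemma valid_tree a h : valid below2 h -> valid below (map (pick a) h).
Proof.
by elim: h => [//|c h IH] [] [c1 c2] /IH hv; split; rewrite //= size_map; case: a {IH hv}.
Qed.

Lemma avg_prod alpha m (f g : nat -> R) :
  avg2 alpha m (fun c => f c.1 * g c.2) =
  alpha * avg m (fun i => f i * g i) + (1 - alpha) * (avg m f * avg m g).
Proof.
rewrite /avg2; congr (_ + _ * _).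
have -> : (fun i => avg m (fun j => f i * g j)) = (fun i => avg m g * f i).
  by apply/funext => i; rewrite (expZ avgP) mulrC.
by rewrite (expZ avgP) mulrC.
Qed.

Lemma avg_var m (f g : nat -> R) :
  avg m.+1 (fun i => (f i - avg m.+1 f) * (g i - avg m.+1 g)) =
  avg m.+1 (fun i => f i * g i) - avg m.+1 f * avg m.+1 g.
Proof.
set a := avg _ f; set b := avg _ g.
have -> : (fun i => (f i - a) * (g i - b)) = (fun i => f i * g i - (b * f i + a * g i - a * b)).
  by apply/funext => i; ring.
by rewrite !(expB avgP) (exp_cst avgP) (expD avgP) !(expZ avgP) -/a -/b; ring.
Qed.

Lemma expect_avg (T : Type) (dom : nat -> T -> Prop) (K : nat -> (T -> R) -> R)
    (KP : is_expectation dom K) n m (F : nat -> seq T -> R) :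
  expect K n (fun x => avg m (F ^~ x)) = avg m (fun i => expect K n (F i)).
Proof. by rewrite /avg (expectZr KP) (expect_sum KP). Qed.

(** The quadratic form of the noise operator on the product space of parent choices: each coordinate
    of the second copy is kept with probability [alpha] and resampled otherwise. *)
Definition noise alpha n (G : seq nat -> R) : R :=
  expect (avg2 alpha) n (fun h => G (map (pick false) h) * G (map (pick true) h)).

Lemma noiseS alpha n G : 0 <= alpha <= 1 ->
  noise alpha n.+1 G = alpha * avg n.+1 (fun i => noise alpha n (fun p => G (i :: p))) +
    (1 - alpha) * noise alpha n (fun p => avg n.+1 (fun i => G (i :: p))).
Proof.
move=> a01; have KP := avg2P a01.
rewrite /noise -(expect_avg KP) -!(expectZ KP) -(expectD KP) /=; apply: (expect_eq KP) => h _ _.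
exact: (avg_prod _ _ (fun i => G (i :: map (pick false) h)) (fun i => G (i :: map (pick true) h))).
Qed.

(** Both branches of [noiseS] dominate the squared mean: the aligned one by Jensen over the newest
    choice, the independent one by induction. *)
Lemma noise_ge alpha n G : 0 <= alpha <= 1 -> expect avg n G ^+ 2 <= noise alpha n G.
Proof.
move=> a01; have /andP[a0 a1] := a01; elim: n G => [|n IH] G; first by rewrite /= expr2.
rewrite noiseS //=; set Gb := fun p => avg _ _.
have Gb2 : expect avg n Gb ^+ 2 <= avg n.+1 (fun i => noise alpha n (fun p => G (i :: p))).
  apply: le_trans (_ : _ <= avg n.+1 (fun i => expect avg n (fun p => G (i :: p)) ^+ 2)) _.
    rewrite (expect_avg avgP) -subr_ge0; set f := fun i => expect avg n _.
    rewrite (_ : _ - _ = avg n.+1 (fun i => (f i - avg n.+1 f) * (f i - avg n.+1 f))).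
      rewrite -(exp_cst avgP n 0); apply: (exp_le avgP) => i _; exact: sqr_ge0.
    rewrite avg_var expr2; congr (_ - _).
  by apply: (exp_le avgP) => i _; exact: IH.
have := IH Gb; nra.
Qed.

(** The defect in Jensen's inequality is the average of the form at the centered functions, and
    these values are nonnegative by [noise_ge]. *)
Lemma noise_convex alpha n (G : nat -> seq nat -> R) m : 0 <= alpha <= 1 ->
  noise alpha n (fun p => avg m.+1 (G ^~ p)) <= avg m.+1 (fun i => noise alpha n (G i)).
Proof.
move=> a01; have KP := avg2P a01; rewrite -subr_ge0.
suff -> : avg m.+1 (fun i => noise alpha n (G i)) - noise alpha n (fun p => avg m.+1 (G ^~ p))
   = avg m.+1 (fun i => noise alpha n (fun p => G i p - avg m.+1 (G ^~ p))).
  rewrite -(exp_cst avgP m 0); apply: (exp_le avgP) => i _.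
  by apply: le_trans (noise_ge _ _ a01); exact: sqr_ge0.
rewrite /noise -!(expect_avg KP) -(expectB KP); apply: (expect_eq KP) => h _ _.
by rewrite avg_var.
Qed.

(** Raising [alpha] moves weight in [noiseS] from the independent to the aligned branch, which is
    the larger one by [noise_convex]. *)
Lemma noise_mono alpha beta n G : 0 <= alpha -> alpha <= beta -> beta <= 1 ->
  noise alpha n G <= noise beta n G.
Proof.
move=> a0 ab b1; have a01 : 0 <= alpha <= 1 by rewrite a0 (le_trans ab b1).
have b01 : 0 <= beta <= 1 by rewrite b1 (le_trans a0 ab).
elim: n G => [//|n IH] G; rewrite !noiseS //.
have h1 : avg n.+1 (fun i => noise alpha n (fun p => G (i :: p))) <=
          avg n.+1 (fun i => noise beta n (fun p => G (i :: p))).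
  by apply: (exp_le avgP) => i _; exact: IH.
have h2 := IH (fun p => avg n.+1 (fun i => G (i :: p))).
have h3 := @noise_convex alpha n (fun i p => G (i :: p)) n a01.
nra.
Qed.

End Average.

(** * Ancestors and subtree sizes *)

(* A tree with nodes 0, .., size p is coded by the list p of parents, newest node first. *)
Section Trees.
Implicit Types (p q r : seq nat) (i k u v w : nat).

(** True when [v] lies on the path from [u] to the root, [u] included. The guard [v < u] makes
    ancestors precede descendants even for invalid codes, so that most identities need no validity
    hypothesis. *)
Fixpoint anc p u v : bool :=
  if p is i :: p' then
    if u == size p then (v == u) || ((v < u)%N && anc p' i v) else anc p' u v
  else u == v.

Definition sz p v : nat := (\sum_(u < (size p).+1) anc p u v)%N.

Lemma anc_refl p u : anc p u u.
Proof. by elim: p => [|i p IH] /=; [exact: eqxx|case: ifP => // _; rewrite eqxx]. Qed.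

Lemma anc_le p u v : anc p u v -> (v <= u)%N.
Proof.
elim: p u => [|i p IH] u /=; first by move=> /eqP ->.
by case: ifP => _; [case/orP => [/eqP ->|/andP[/ltnW]]|exact: IH].
Qed.

Lemma anc_old i p u v : (u <= size p)%N -> anc (i :: p) u v = anc p u v.
Proof. by move=> up /=; rewrite ltn_eqF. Qed.

Lemma anc_new i p v : (v <= size p)%N -> anc (i :: p) (size p).+1 v = anc p i v.
Proof. by move=> vp /=; rewrite eqxx ltn_eqF //= ltnS vp. Qed.

Lemma anc_top i p v :
  anc (i :: p) (size p).+1 v = (v == (size p).+1) || ((v < (size p).+1)%N && anc p i v).
Proof. by rewrite /= eqxx. Qed.

Lemma anc_gt p u v : (u < v)%N -> anc p u v = false.
Proof. by move=> uv; apply/negP => /anc_le; rewrite leqNgt uv. Qed.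

Lemma anc_cat q r u v : (u <= size r)%N -> anc (q ++ r) u v = anc r u v.
Proof.
move=> ur; elim: q => [//|i q IH]; rewrite cat_cons anc_old //.
by rewrite size_cat (leq_trans ur) // leq_addl.
Qed.

Lemma anc_chain p u v w : (u <= size p)%N -> valid below p ->
  anc p u v -> anc p u w -> (v <= w)%N -> anc p w v.
Proof.
elim: p u => [|i p IH] u /=.
  by move=> _ _ /eqP -> /eqP ->; rewrite eqxx.
move=> up [ip vp]; case: ifP => [/eqP ->|uN].
  case/orP => [/eqP ->|/andP[vlt aiv]].
    case/orP => [/eqP ->|/andP[wlt _]]; rewrite ?eqxx // leqNgt.
    by rewrite wlt.
  case/orP => [/eqP ->|/andP[wlt aiw]] vw; first by rewrite eqxx vlt aiv orbT.
  by rewrite ltn_eqF //; apply: (IH i).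
move=> auv auw vw.
have ulep : (u <= size p)%N by move: up; rewrite leq_eqVlt uN ltnS.
rewrite ltn_eqF ?(leq_ltn_trans (anc_le auw)) //.
by apply: (IH u).
Qed.

Lemma sz_old i p v : (v <= size p)%N -> sz (i :: p) v = (sz p v + anc p i v)%N.
Proof.
move=> vp; rewrite /sz big_ord_recr [size (i :: p)]/= anc_new //; congr (_ + _)%N.
apply: eq_bigr => u _; rewrite anc_old //.
exact: (ltn_ord u).
Qed.

Lemma sz_new i p : sz (i :: p) (size p).+1 = 1%N.
Proof.
rewrite /sz big_ord_recr /= !eqxx /= big1 // => u _.
by rewrite ltn_eqF ?anc_gt // (ltn_ord u).
Qed.

Lemma sz_root0 : sz [::] 0 = 1%N.
Proof. by rewrite /sz big_ord_recr big_ord0. Qed.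

Lemma sz_gt0 p v : (v <= size p)%N -> (0 < sz p v)%N.
Proof. by move=> vp; rewrite /sz (bigD1 (Ordinal (vp : (v < (size p).+1)%N))) //= anc_refl. Qed.

Lemma sz_le p v : (sz p v <= (size p).+1)%N.
Proof.
rewrite /sz -[leqRHS]muln1 -[X in (X * _)%N]card_ord -sum_nat_const.
by apply: leq_sum => u _; exact: leq_b1.
Qed.

End Trees.

Arguments anc : simpl never.
Arguments sz : simpl never.

(** * The weights, the ancestor sums, and their drift when a node is added *)

Section AncestorSums.
Variable R : realType.
Implicit Types (p q r : seq nat) (i k s u v w : nat) (l t : R) (f g : nat -> R).

Definition asum f p u : R := \sum_(v < (size p).+1) (anc p u v)%:R * f (sz p v).

Lemma sum_anc p v : \sum_(u < (size p).+1) ((anc p u v)%:R : R) = (sz p v)%:R.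
Proof. by rewrite natr_sum. Qed.

Lemma sum_asum f p :
  \sum_(u < (size p).+1) asum f p u = \sum_(v < (size p).+1) (sz p v)%:R * f (sz p v).
Proof. by rewrite exchange_big /=; apply: eq_bigr => v _; rewrite -mulr_suml sum_anc. Qed.

Lemma asum_new f p i : asum f (i :: p) (size p).+1 = f 1%N + asum (fun s => f s.+1) p i.
Proof.
rewrite /asum big_ord_recr /= [LHS]addrC; congr (_ + _).
  by rewrite anc_refl mul1r sz_new.
apply: eq_bigr => v _; have vp : (v <= size p)%N by rewrite -ltnS.
by rewrite /= anc_new // sz_old //; case: anc; rewrite ?mul0r // addn1.
Qed.

Lemma asum_old f p i u : (u <= size p)%N ->
  asum f (i :: p) u = asum f p u -
    \sum_(v < (size p).+1) (anc p i v)%:R * ((anc p u v)%:R * (f (sz p v) - f (sz p v).+1)).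
Proof.
move=> up; rewrite /asum big_ord_recr /= anc_gt // mul0r addr0.
rewrite -sumrB; apply: eq_bigr => v _; have vp : (v <= size p)%N by rewrite -ltnS.
rewrite /= anc_old // sz_old //; case: (anc p i v); case: (anc p u v);
  rewrite ?addn1 ?addn0 /=; ring.
Qed.

Lemma asum_ge0 f p u : (forall s, (0 < s)%N -> 0 <= f s) -> 0 <= asum f p u.
Proof.
move=> f0; apply: sumr_ge0 => v _; rewrite mulr_ge0 ?ler0n // f0 // sz_gt0 //.
by rewrite -ltnS ltn_ord.
Qed.

Lemma asum_le f g p u : (forall s, (0 < s)%N -> f s <= g s) -> asum f p u <= asum g p u.
Proof.
move=> fg; apply: ler_sum => v _; rewrite ler_wpM2l ?ler0n // fg // sz_gt0 //.
by rewrite -ltnS ltn_ord.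
Qed.

Lemma asumZ a f p u : asum (fun s => a * f s) p u = a * asum f p u.
Proof. by rewrite /asum mulr_sumr; apply: eq_bigr => v _; rewrite mulrCA. Qed.

Lemma asumD f g p u : asum (fun s => f s + g s) p u = asum f p u + asum g p u.
Proof. by rewrite /asum -big_split; apply: eq_bigr => v _; rewrite mulrDr. Qed.

(** This is Gamma(s + l) / (Gamma(1 + l) Gamma(s)), of order s^l; hence [phi l s] is of order
    s^(l-1). *)
Definition grate (l : R) (s : nat) : R := \prod_(1 <= r < s) (1 + l / r%:R).
Definition phi (l : R) (s : nat) : R := grate l s / s%:R.
Definition A (l : R) := asum (phi l).
Definition W (l : R) p : R := \sum_(v < (size p).+1) grate l (sz p v).

Lemma grate1 l : grate l 1 = 1.
Proof. by rewrite /grate big_geq. Qed.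

Lemma grateS l s : (0 < s)%N -> grate l s.+1 = grate l s * (1 + l / s%:R).
Proof. by move=> s0; rewrite /grate big_nat_recr. Qed.

Lemma phi1 l : phi l 1 = 1.
Proof. by rewrite /phi grate1 divr1. Qed.

Lemma grate_phi l s : (0 < s)%N -> grate l s = s%:R * phi l s.
Proof. by move=> s0; rewrite /phi mulrC divfK // pnatr_eq0 -lt0n. Qed.

Lemma phiS l s : (0 < s)%N -> phi l s.+1 = phi l s * ((s%:R + l) / s.+1%:R).
Proof.
move=> s0; rewrite /phi grateS //; have s1 : (s%:R : R) != 0 by rewrite pnatr_eq0 -lt0n.
by field; rewrite s1 addrC natr1 pnatr_eq0.
Qed.

Lemma phi_diff l s : (0 < s)%N -> phi l s - phi l s.+1 = (1 - l) * (phi l s / s.+1%:R).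
Proof.
move=> s0; rewrite phiS // -[s.+1%:R]natr1; field.
by rewrite natr1 pnatr_eq0.
Qed.

Lemma grate_ge1 l s : 0 <= l -> (0 < s)%N -> 1 <= grate l s.
Proof.
move=> l0; elim: s => [//|[|s] IH] _; first by rewrite grate1.
rewrite grateS //; apply: le_trans (IH isT) _; rewrite ler_peMr //.
  by apply: le_trans (IH isT).
by rewrite lerDl divr_ge0.
Qed.

Lemma phi_gt0 l s : 0 <= l -> (0 < s)%N -> 0 < phi l s.
Proof.
by move=> l0 s0; rewrite divr_gt0 ?ltr0n // (lt_le_trans ltr01) // grate_ge1.
Qed.

Lemma phi_decr l s : 0 <= l <= 1 -> (0 < s)%N -> phi l s.+1 <= phi l s.
Proof.
move=> /andP[l0 l1] s0; rewrite -subr_ge0 phi_diff //.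
by rewrite mulr_ge0 ?subr_ge0 // divr_ge0 // ltW // phi_gt0.
Qed.

Lemma phi_le1 l s : 0 <= l <= 1 -> (0 < s)%N -> phi l s <= 1.
Proof.
move=> l01; elim: s => [//|[|s] IH] _; first by rewrite phi1.
by apply: le_trans (IH isT); exact: phi_decr.
Qed.

Lemma A_ge0 l p u : 0 <= l -> 0 <= A l p u.
Proof. by move=> l0; apply: asum_ge0 => s s0; rewrite ltW // phi_gt0. Qed.

Lemma sum_A l p : \sum_(u < (size p).+1) A l p u = W l p.
Proof.
rewrite sum_asum; apply: eq_bigr => v _; rewrite -grate_phi // sz_gt0 //.
by rewrite -ltnS ltn_ord.
Qed.

Lemma avg_A l p : avg (size p).+1 (A l p) = W l p / (size p).+1%:R.
Proof. by rewrite /avg sum_A. Qed.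

Lemma WS l p i : W l (i :: p) = W l p + 1 + l * A l p i.
Proof.
rewrite /W big_ord_recr /= sz_new grate1 addrAC; congr (_ + _).
rewrite /A /asum mulr_sumr -big_split; apply: eq_bigr => v _ /=.
have vp : (v <= size p)%N by rewrite -ltnS.
rewrite sz_old //; case: anc; rewrite ?addn0 ?mul0r ?mulr0 ?addr0 //.
by rewrite addn1 grateS ?sz_gt0 // /phi /=; ring.
Qed.

(** What an old node [u] loses when a node is attached below [i]: exactly the common ancestors of
    [u] and [i] have their subtrees enlarged. *)
Definition drop (l : R) p i u : R :=
  \sum_(v < (size p).+1) (anc p i v)%:R * ((anc p u v)%:R * (phi l (sz p v) - phi l (sz p v).+1)).

Lemma A_old l p i u : (u <= size p)%N -> A l (i :: p) u = A l p u - drop l p i u.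
Proof. exact: asum_old. Qed.

Lemma A_new l p i : A l (i :: p) (size p).+1 = 1 + asum (fun s => phi l s.+1) p i.
Proof. by rewrite /A asum_new phi1. Qed.

Lemma sum_drop l p u : \sum_(i < (size p).+1) drop l p i u =
  \sum_(v < (size p).+1) (anc p u v)%:R * ((1 - l) * (phi l (sz p v) * ((sz p v)%:R / (sz p v).+1%:R))).
Proof.
rewrite /drop exchange_big /=; apply: eq_bigr => v _.
rewrite -mulr_suml sum_anc phi_diff ?sz_gt0 -1?ltnS //.
by ring.
Qed.

Lemma drop_ge0 l p i u : 0 <= l <= 1 -> 0 <= drop l p i u.
Proof.
move=> l01; apply: sumr_ge0 => v _; rewrite !mulr_ge0 // subr_ge0 phi_decr //.
by rewrite sz_gt0 // -ltnS.
Qed.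

Lemma drop_le l p i u : 0 <= l <= 1 -> drop l p i u <= A l p u.
Proof.
move=> l01; apply: ler_sum => v _.
have sv : (0 < sz p v)%N by rewrite sz_gt0 // -ltnS.
have /andP[l0 _] := l01.
have := phi_gt0 l0 (ltn0Sn (sz p v)); have := phi_decr l01 sv; have := phi_gt0 l0 sv.
case: (anc p i v); case: (anc p u v) => /=; lra.
Qed.

(** Summed over [i], an ancestor of size s is counted s times and gives (1 - l) phi(s) s/(s + 1),
    where s/(s + 1) is at least 1/2. *)
Lemma sum_drop_ge l p u : 0 <= l <= 1 ->
  (1 - l) / 2 * A l p u <= \sum_(i < (size p).+1) drop l p i u.
Proof.
move=> /andP[l0 l1]; rewrite sum_drop /A /asum mulr_sumr; apply: ler_sum => v _.
have sv : (0 < sz p v)%N by rewrite sz_gt0 // -ltnS.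
have pv := phi_gt0 l0 sv.
rewrite mulrCA ler_wpM2l // -mulrA ler_wpM2l ?subr_ge0 // [leLHS]mulrC ler_wpM2l ?(ltW pv) //.
rewrite ler_pdivlMr ?ltr0n // -[(sz p v).+1%:R]natr1.
have : (1 : R) <= (sz p v)%:R by rewrite ler1n.
lra.
Qed.

Lemma sum_drop_le l p u : 0 <= l <= 1 ->
  \sum_(i < (size p).+1) drop l p i u <= A l p u.
Proof.
move=> /andP[l0 l1]; rewrite sum_drop /A /asum; apply: ler_sum => v _.
have sv : (0 < sz p v)%N by rewrite sz_gt0 // -ltnS.
have pv := phi_gt0 l0 sv.
rewrite ler_wpM2l //; set r := _ / _.
have r0 : 0 <= r by rewrite divr_ge0.
have r1 : r <= 1 by rewrite ler_pdivrMr ?ltr0n // mul1r ler_nat.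
have pr : phi l (sz p v) * r <= phi l (sz p v) by rewrite ler_piMr // ltW.
have : 0 <= l * (phi l (sz p v) * r) by apply: mulr_ge0 l0 (mulr_ge0 (ltW pv) r0).
lra.
Qed.

(** Here 15 = 1 + 4 + 6 + 4 is the sum of the lower binomial coefficients: above 15/t the lower
    terms are at most 15 a^3 <= t a^4, below it the constant suffices. *)
Lemma four_pow (t a : R) : 0 < t <= 1 -> 0 <= a ->
  (1 + a) ^+ 4 <= (1 + t) * a ^+ 4 + (1 + 15 / t) ^+ 4.
Proof.
move=> /andP[t0 t1] a0; have c0 : 0 < 15 / t by rewrite divr_gt0.
have [ac|ac] := leP a (15 / t).
  rewrite ler_wpDl ?mulr_ge0 ?exprn_ge0 //; first by rewrite addr_ge0 // ltW.
  by rewrite lerXn2r ?nnegrE ?addr_ge0 // ?lerD2l // ltW.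
apply: le_trans (_ : (1 + t) * a ^+ 4 <= _); last by rewrite lerDl exprn_ge0 // addr_ge0 // ltW.
have a15 : 15 < a * t by rewrite -ltr_pdivrMr.
have a1 : 1 <= a by nra.
have : a ^+ 3 * 15 <= a ^+ 3 * (a * t) by rewrite ler_wpM2l ?exprn_ge0 // ltW.
have a2 : 1 <= a ^+ 2 by rewrite exprn_ege1.
have a23 : a ^+ 2 <= a ^+ 3 by rewrite [leRHS]exprS ler_peMl ?exprn_ge0.
have a12 : a <= a ^+ 2 by rewrite expr2 ler_peMr.
rewrite [(1 + a) ^+ 4](_ : _ = 1 + 4 * a + 6 * a ^+ 2 + 4 * a ^+ 3 + a ^+ 4); last by ring.
rewrite [(1 + t) * _](_ : _ = a ^+ 4 + a ^+ 3 * (a * t)); last by ring.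
by lra.
Qed.

(** Solves K (1 - t/2) + C = K with C = (1 + 30/t)^4, so that K m reproduces itself under the
    recursion of [moment4_step]. *)
Definition Kmom (t : R) : R := 2 / t * (1 + 30 / t) ^+ 4.

(* The decrease of [A] caused by the growth of the ancestors' subtrees beats the
   increase of [(1 + A)^4] at the new node, whence the linear growth. *)
Lemma moment4_step (t l : R) p : 0 < t <= 1 -> 0 <= l -> t <= (1 - l) / 2 ->
  avg (size p).+1 (fun i => \sum_(u < (size p).+2) A l (i :: p) u ^+ 4) <=
  (1 + (1 - t / 2) / (size p).+1%:R) * (\sum_(u < (size p).+1) A l p u ^+ 4) + (1 + 30 / t) ^+ 4.
Proof.
move=> /andP[t0 t1] l0 tl; set m := (size p).+1.
have l01 : 0 <= l <= 1 by rewrite l0; lra.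
have mp : 0 < (m%:R : R) by rewrite ltr0n.
set Q := \sum_(u < m) _; set C := (1 + 30 / t) ^+ 4.
rewrite /avg ler_pdivrMr //.
have -> : ((1 + (1 - t / 2) / m%:R) * Q + C) * m%:R =
    (m%:R * Q - t * Q) + ((1 + t / 2) * Q + m%:R * C) by field; rewrite gt_eqF.
under eq_bigr do rewrite big_ord_recr /=.
rewrite big_split /=; apply: lerD.
  have -> : m%:R * Q - t * Q = \sum_(u < m) (m%:R * A l p u ^+ 4 - t * A l p u ^+ 4).
    by rewrite sumrB -!mulr_sumr.
  rewrite exchange_big /=; apply: ler_sum => u _.
  have au := A_ge0 p u l0.
  (* With 0 <= d <= a one has (a - d)^4 <= a^3 (a - d), so only the linear sum of the drops is
     needed. *)
  apply: le_trans (_ : \sum_(i < m) (A l p u ^+ 4 - A l p u ^+ 3 * drop l p i u) <= _).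
    apply: ler_sum => i _; rewrite A_old -1?ltnS //.
    have d0 := drop_ge0 p i u l01; have dA := drop_le p i u l01.
    set a := A l p u in au dA *; set d := drop l p i u in d0 dA *.
    have -> : a ^+ 4 - a ^+ 3 * d = a ^+ 3 * (a - d) by ring.
    by rewrite exprSr ler_wpM2r ?subr_ge0 // lerXn2r ?nnegrE ?subr_ge0 // gerBl.
  rewrite sumrB sumr_const card_ord -[_ *+ m]mulr_natl -mulr_sumr; apply: lerB => //.
  apply: le_trans (ler_wpM2l _ (sum_drop_ge p u l01)); last by rewrite exprn_ge0.
  have : 0 <= A l p u ^+ 4 by rewrite exprn_ge0.
  have -> : A l p u ^+ 3 * ((1 - l) / 2 * A l p u) = (1 - l) / 2 * A l p u ^+ 4 by ring.
  by nra.
have -> : (1 + t / 2) * Q + m%:R * C = \sum_(i < m) ((1 + t / 2) * A l p i ^+ 4 + C).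
  by rewrite big_split /= -mulr_sumr sumr_const card_ord -[C *+ m]mulr_natl.
apply: ler_sum => i _; rewrite A_new; set a := asum _ _ _.
have a0 : 0 <= a by apply: asum_ge0 => s s0; rewrite ltW // phi_gt0.
have aA : a <= A l p i by apply: asum_le => s s0; exact: phi_decr.
apply: le_trans (_ : (1 + A l p i) ^+ 4 <= _).
  by rewrite lerXn2r ?lerD2l // nnegrE addr_ge0 // A_ge0.
have th : 0 < t / 2 <= 1 by lra.
apply: le_trans (four_pow th (A_ge0 p i l0)) _.
by rewrite lerD2l /C (_ : 15 / (t / 2) = 30 / t) //; field; rewrite gt_eqF.
Qed.

End AncestorSums.

(** * Moments of the ancestor sums and the exact mean *)

Section Moments.
Variable R : realType.
Implicit Types (p q r : seq nat) (i k s u v w n L : nat) (l t : R) (f g : nat -> R).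

Lemma expect_moment4 t l n : 0 < t <= 1 -> 0 <= l -> t <= (1 - l) / 2 ->
  expect (@avg R) n (fun p => avg n.+1 (fun u => A l p u ^+ 4)) <= Kmom t.
Proof.
move=> t01 l0 tl; have /andP[t0 t1] := t01.
suff Q : expect (@avg R) n (fun p => \sum_(u < (size p).+1) A l p u ^+ 4) <= Kmom t * n.+1%:R.
  rewrite -[leRHS](mulfK (_ : n.+1%:R != 0)) ?pnatr_eq0 //.
  rewrite [X in X <= _](_ : _ = expect (@avg R) n (fun p => \sum_(u < (size p).+1) A l p u ^+ 4)
    / n.+1%:R); first by rewrite ler_pM2r ?invr_gt0 ?ltr0n.
  by rewrite -(expectZr (@avgP R)); apply: (expect_eq (@avgP R)) => p ->.
elim: n => [|n IH] /=.
  rewrite big_ord_recr big_ord0 /= add0r mulr1 /A /asum big_ord_recr big_ord0 /= add0r.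
  rewrite sz_root0 phi1 mulr1 expr1n /Kmom.
  have h1 : 1 <= (1 + 30 / t) ^+ 4 by rewrite exprn_ege1 // lerDl divr_ge0 // ltW.
  have h2 : 1 <= 2 / t by rewrite ler_pdivlMr //; lra.
  nra.
set C := (1 + 30 / t) ^+ 4.
apply: le_trans (_ : expect (@avg R) n (fun p => (1 + (1 - t / 2) / n.+1%:R) *
   (\sum_(u < (size p).+1) A l p u ^+ 4) + C) <= _).
  by apply: (expect_le (@avgP R)) => p pn _; rewrite -{1 2}pn; exact: moment4_step.
rewrite (expectD (@avgP R)) (expectZ (@avgP R)) (expect_cst (@avgP R)).
have c0 : 0 <= 1 + (1 - t / 2) / n.+1%:R by rewrite addr_ge0 // divr_ge0 //; lra.
apply: le_trans (lerD (ler_wpM2l c0 IH) (lexx _)) _.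
rewrite le_eqVlt; apply/orP; left; apply/eqP; rewrite /Kmom -/C -[n.+2%:R]natr1.
by field; rewrite addrC natr1 pnatr_eq0 gt_eqF.
Qed.

Definition mean l n : R := expect (@avg R) n (@W R l).

Lemma meanS l n : mean l n.+1 = (1 + l / n.+1%:R) * mean l n + 1.
Proof.
rewrite /mean /= -(expectZ (@avgP R)) -[X in _ + X](expect_cst (@avgP R) n 1).
rewrite -(expectD (@avgP R)); apply: (expect_eq (@avgP R)) => p pn _.
under eq_fun do rewrite WS.
rewrite -pn (expD (@avgP R)) (expZ (@avgP R)) (exp_cst (@avgP R)) avg_A.
ring.
Qed.

(** With m = n+1, the recursion [meanS] has the particular solution m/(1 - l) and the homogeneous
    solution [grate l m]. *)
Lemma meanE l n : l != 1 -> mean l n = (n.+1%:R - l * grate l n.+1) / (1 - l).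
Proof.
move=> l1; have l1' : 1 - l != 0 by rewrite subr_eq0 eq_sym.
elim: n => [|n IH].
  by rewrite /mean /= /W big_ord_recr big_ord0 /= add0r sz_root0 grate1; field.
rewrite meanS IH (grateS l (ltn0Sn n)) -(natr1 n.+1); field.
by rewrite l1' addrC natr1 pnatr_eq0.
Qed.

Lemma expect_A_old l n u : 0 <= l <= 1 -> (u <= n)%N ->
  n%:R / n.+1%:R * expect (@avg R) n (fun p => A l p u) <=
  expect (@avg R) n.+1 (fun p => A l p u).
Proof.
move=> l01 un; rewrite -(expectZ (@avgP R)) /=; apply: (expect_le (@avgP R)) => p pn _.
have -> : avg n.+1 (fun i => A l (i :: p) u) = avg n.+1 (fun i => A l p u - drop l p i u).
  by apply: (exp_eq (@avgP R)) => i _; rewrite A_old // pn.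
rewrite (expB (@avgP R)) (exp_cst (@avgP R)) /avg.
have := sum_drop_le p u l01; rewrite pn => h.
have n0 : 0 < (n.+1%:R : R) by rewrite ltr0n.
rewrite -subr_ge0; set S := \sum_(i < _) _ in h *.
have -> : A l p u - S / n.+1%:R - n%:R / n.+1%:R * A l p u = (A l p u - S) / n.+1%:R.
  by rewrite -[n.+1%:R]natr1; field; rewrite natr1 gt_eqF.
by rewrite divr_ge0 ?subr_ge0 // ltW.
Qed.

(** Under the new node each subtree of size s is counted s times with s phi(s+1) = g_l(s) (s + l)/(s
    + 1); the last factor is least at s = 1, which gives (1 + l)/2. *)
Lemma expect_A_new l n : 0 <= l <= 1 ->
  1 + (1 + l) / 2 * (mean l n / n.+1%:R) <= expect (@avg R) n.+1 (fun p => A l p n.+1).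
Proof.
move=> /andP[l0 l1]; rewrite /mean -(expectZr (@avgP R)) -(expectZ (@avgP R)).
rewrite -{1}(expect_cst (@avgP R) n 1) -(expectD (@avgP R)) /=.
apply: (expect_le (@avgP R)) => p pn _; rewrite -pn.
rewrite (_ : (fun i => _) = (fun i => 1 + asum (fun s => phi l s.+1) p i)); last first.
  by apply/funext => i; rewrite A_new.
rewrite (expD (@avgP R)) (exp_cst (@avgP R)) lerD2l /avg sum_asum mulrA.
rewrite ler_wpM2r ?invr_ge0 // /W mulr_sumr; apply: ler_sum => v _.
have sv : (0 < sz p v)%N by rewrite sz_gt0 // -ltnS.
rewrite phiS // mulrA -grate_phi // mulrC ler_wpM2l ?(le_trans ler01) ?grate_ge1 //.
rewrite ler_pdivlMr ?ltr0n // -[(sz p v).+1%:R]natr1.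
have : (1 : R) <= (sz p v)%:R by rewrite ler1n.
nra.
Qed.

End Moments.

(** * Few ancestors have small subtrees *)

Section Truncation.
Variable R : realType.
Implicit Types (p q r : seq nat) (i k s u v w n L : nat) (l t : R) (f g : nat -> R).

(** Ancestors form a chain: all those counted are descendants of the topmost one among them, whose
    subtree has at most [L] nodes. *)
Lemma count_small_anc p u L : valid below p -> (u <= size p)%N ->
  (\sum_(v < (size p).+1) (anc p u v && (sz p v <= L)) <= L)%N.
Proof.
move=> vp up; set P := fun v => anc p u v && (sz p v <= L)%N.
have [/existsP[v0 Pv0]|/existsPn noP] := boolP [exists v : 'I_(size p).+1, P v]; last first.
  by rewrite big1 // => v _; rewrite -/(P v) (negbTE (noP v)).
case: (@arg_minnP _ v0 (fun v : 'I_(size p).+1 => P v) val Pv0) => w /andP[auw sw] wmin.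
apply: leq_trans sw; rewrite /sz; apply: leq_sum => v _; rewrite -/(P v).
have [Pv|//] := boolP (P v).
have /andP[auv _] := Pv.
by rewrite (anc_chain up vp auw auv) // wmin.
Qed.

(** Redirecting the edge above one node changes only the subtrees of the ancestors of its old or its
    new parent. *)
Lemma anc_cut q r i i' u v : (size r < v)%N || ~~ (anc r i v || anc r i' v) ->
  anc (q ++ i :: r) u v = anc (q ++ i' :: r) u v.
Proof.
move=> hv; elim: q u => [|j q IH] u /=; last by rewrite /anc -/anc /= !size_cat /= !IH.
rewrite /anc -/anc; case: ifP => // /eqP ->; case/orP: hv => [rv|].
  by rewrite [(v < _)%N]ltnNge rv.
by rewrite negb_or => /andP[/negbTE -> /negbTE ->].
Qed.

End Truncation.

Lemma valid_catr (T : Type) (dom : nat -> T -> Prop) (q r : seq T) :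
  valid dom (q ++ r) -> valid dom r.
Proof. by elim: q => //= c q IH [_ /IH]. Qed.

(** * Effect of a single parent choice on truncated ancestor sums *)

Section BoundedDifference.
Variable R : realType.
Implicit Types (p q r : seq nat) (i k s u v w n L : nat) (l t : R) (f g : nat -> R).

Lemma count_small_moved q r i i' j L : valid below (q ++ j :: r) ->
  (i <= size r)%N -> (i' <= size r)%N ->
  (\sum_(v < (size (q ++ j :: r)).+1)
     [&& (v <= size r)%N, anc r i v || anc r i' v & (sz (q ++ j :: r) v <= L)%N] <= 2 * L)%N.
Proof.
set p := q ++ j :: r => vp ir ir'.
have rp : (size r <= size p)%N by rewrite size_cat /= addnS ltnW // ltnS leq_addl.
have ancE k v : (k <= size r)%N -> anc r k v = anc p k v.
  by move=> kr; rewrite /p -cat_rcons anc_cat.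
rewrite mul2n -addnn.
apply: leq_trans (leq_add (count_small_anc L vp (leq_trans ir rp))
                          (count_small_anc L vp (leq_trans ir' rp))).
rewrite -big_split; apply: leq_sum => v _ /=.
by rewrite !ancE //; case: (v <= _)%N; case: (anc p i v); case: (anc p i' v); case: (_ <= L)%N.
Qed.

(** Only ancestors of [i] or [i'] matter. In each of the two trees at most 2L of them have a small
    subtree, and each such subtree contributes at most L to the sum over [u]: 2 * 2L * L. *)
Lemma asum_bounded_diff f L q r i i' :
  (forall s, (0 < s)%N -> 0 <= f s <= 1) -> (forall s, (L < s)%N -> f s = 0) ->
  valid below (q ++ i :: r) -> valid below (q ++ i' :: r) ->
  \sum_(u < (size (q ++ i :: r)).+1) `|asum f (q ++ i :: r) u - asum f (q ++ i' :: r) u|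
    <= 4 * L%:R ^+ 2.
Proof.
move=> f01 fL vp vp'; have [/= ir _] := valid_catr vp; have [/= ir' _] := valid_catr vp'.
set p := q ++ i :: r in vp *; set p' := q ++ i' :: r in vp' *.
have sE : size p' = size p by rewrite !size_cat.
pose V v := (v <= size r)%N && (anc r i v || anc r i' v).
have ancE u v : ~~ V v -> anc p u v = anc p' u v.
  by rewrite /V negb_and -ltnNge => Vv; exact: anc_cut.
have szE v : ~~ V v -> sz p v = sz p' v.
  by move=> Vv; rewrite /sz sE; apply: eq_bigr => u _; rewrite ancE.
have f0 pp v : (v <= size pp)%N -> 0 <= f (sz pp v).
  by move=> vpp; have /andP[] := f01 _ (sz_gt0 vpp).
apply: le_trans (_ : \sum_(u < (size p).+1) \sum_(v < (size p).+1)
   (V v)%:R * ((anc p u v)%:R * f (sz p v) + (anc p' u v)%:R * f (sz p' v)) <= _).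
  apply: ler_sum => u _; rewrite /asum sE -sumrB.
  apply: le_trans (ler_norm_sum _ _ _) _; apply: ler_sum => v _.
  have vsp : (v <= size p)%N by rewrite -ltnS.
  have vsp' : (v <= size p')%N by rewrite sE.
  have [Vv|Vv] := boolP (V v); last first.
    by rewrite ancE // szE // subrr normr0 mul0r.
  rewrite mul1r; apply: le_trans (ler_normB _ _) _.
  by rewrite !ger0_norm ?mulr_ge0 ?f0.
rewrite exchange_big /=.
have sumE' w : \sum_(u < (size p).+1) ((anc p' u w)%:R : R) = (sz p' w)%:R.
  by rewrite -sE sum_anc.
have bnd pp v : (v <= size pp)%N ->
    (sz pp v)%:R * f (sz pp v) <= L%:R * ((sz pp v <= L)%N)%:R.
  move=> vpp; have [sL|Ls] := leqP; last by rewrite fL // !mulr0.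
  rewrite mulr1; apply: le_trans (_ : (sz pp v)%:R <= _); last by rewrite ler_nat.
  by rewrite ler_piMr //; have /andP[] := f01 _ (sz_gt0 vpp).
apply: le_trans (_ : \sum_(v < (size p).+1) L%:R *
   ((V v && (sz p v <= L))%N%:R + (V v && (sz p' v <= L))%N%:R) <= _).
  apply: ler_sum => v _; rewrite -mulr_sumr big_split /= -!mulr_suml.
  have vsp : (v <= size p)%N by rewrite -ltnS.
  have vsp' : (v <= size p')%N by rewrite sE.
  rewrite sum_anc sumE'.
  case: (V v); rewrite ?mul0r ?mulr0 ?addr0 //= mul1r mulrDr.
  by apply: lerD; exact: bnd.
rewrite -mulr_sumr big_split /=.
have cnt j : valid below (q ++ j :: r) -> size (q ++ j :: r) = size p ->
    \sum_(v < (size p).+1) ((V v && (sz (q ++ j :: r) v <= L))%N%:R : R) <= 2 * L%:R.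
  move=> vj sj; rewrite -natr_sum -natrM ler_nat -sj.
  under eq_bigr do rewrite /V -andbA.
  exact: count_small_moved.
have -> : 4 * L%:R ^+ 2 = L%:R * (2 * L%:R + 2 * L%:R) :> R by ring.
by rewrite ler_wpM2l // lerD ?cnt.
Qed.

End BoundedDifference.

(** * Recursive inequalities with coefficients of order 1/n *)

Section Growth.
Local Open Scope classical_set_scope.
Variable R : realType.
Implicit Types (x y z : nat -> R) (a b c beta eta : R) (n p : nat).

Lemma harmonic_sum_unbounded a : \forall n \near \oo, a <= series (@harmonic R) n.
Proof.
have : series (@harmonic R) n @[n --> \oo] --> +oo.
  apply: nondecreasing_dvgn_lt; last exact: dvg_harmonic.
  by apply: nondecreasing_series => n _ _; exact: harmonic_ge0.
by move/cvgryPge.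
Qed.

(** The positive part w of y - c/beta satisfies w(n+1) <= (1 - beta/(n+1)) w(n), so w(n) (1 + beta
    (H(n) - H(N))) never exceeds w(N), with H the harmonic sums; their divergence forces w to 0. *)
Lemma decay_limsup y beta c eta : 0 < beta -> 0 < eta ->
  (\forall n \near \oo, y n.+1 <= (1 - beta / n.+1%:R) * y n + c / n.+1%:R) ->
  \forall n \near \oo, y n <= c / beta + eta.
Proof.
move=> b0 eta0 [N1 _ hN1].
have [N2 _ hN2] := nbhs_infty_ger beta.
pose N := maxn N1 N2; pose w n := Num.max (y n - c / beta) 0.
pose H n := series (@harmonic R) n.
have w0 n : 0 <= w n by rewrite le_max lexx orbT.
have wS n : (N <= n)%N -> w n.+1 <= (1 - beta / n.+1%:R) * w n.
  rewrite geq_max => /andP[n1 n2].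
  have m0 : 0 < (n.+1%:R : R) by rewrite ltr0n.
  have c1 : 0 <= 1 - beta / n.+1%:R.
    rewrite subr_ge0 ler_pdivrMr // mul1r; apply: (le_trans (hN2 _ n2)).
    by rewrite ler_nat.
  rewrite ge_max mulr_ge0 // andbT.
  apply: le_trans (_ : (1 - beta / n.+1%:R) * (y n - c / beta) <= _); last first.
    by rewrite ler_wpM2l // le_max lexx.
  have := hN1 n n1 => /= h; rewrite lerBlDr; apply: (le_trans h).
  rewrite le_eqVlt; apply/orP; left; apply/eqP; field.
  by rewrite addrC natr1 !gt_eqF.
have Hmono n : (N <= n)%N -> 0 <= H n - H N.
  move=> Nn; rewrite subr_ge0; apply: nondecreasing_series => // k _ _.
  exact: harmonic_ge0.
have HS n : H n.+1 = H n + n.+1%:R^-1 by rewrite /H seriesSr.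
have wH n : (N <= n)%N -> w n * (1 + beta * (H n - H N)) <= w N.
  elim: n => [|n IH]; first by rewrite leqn0 => /eqP ->; rewrite subrr mulr0 addr0 mulr1.
  rewrite leq_eqVlt => /orP[/eqP <-|]; first by rewrite subrr mulr0 addr0 mulr1.
  rewrite ltnS => Nn; apply: le_trans (IH Nn); have := wS n Nn; have := Hmono n Nn.
  rewrite HS; set d := H n - H N; have -> : H n + n.+1%:R^-1 - H N = d + n.+1%:R^-1.
    by rewrite /d; ring.
  have r0 : 0 <= beta / n.+1%:R by rewrite divr_ge0 ?ltW.
  rewrite [beta * (d + _)]mulrDr; set s := beta / n.+1%:R in r0 *; move=> d0 ws.
  have bd : 0 <= beta * d by rewrite mulr_ge0 // ltW.
  apply: le_trans (ler_wpM2r _ ws) _; first by rewrite addr_ge0 // addr_ge0.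
  have := w0 n; set e := beta * d in bd *; move=> wn.
  have := mulr_ge0 wn (mulr_ge0 r0 bd).
  have := mulr_ge0 wn (mulr_ge0 r0 r0).
  have -> : (1 - s) * w n * (1 + (e + s)) = w n * (1 + e) - w n * (s * e) - w n * (s * s) by ring.
  lra.
have := harmonic_sum_unbounded (H N + w N / (beta * eta)).
have := nbhs_infty_ge N; apply: filterS2 => n Nn hH.
rewrite -lerBlDl; apply: le_trans (_ : w n <= _); first by rewrite le_max lexx.
have := wH n Nn; have := Hmono n Nn => Hn wn.
have h1 : w N / eta <= beta * (H n - H N).
  have : w N / (beta * eta) <= H n - H N by rewrite lerBrDl.
  by rewrite !ler_pdivrMr ?mulr_gt0 // mulrCA mulrA.
have h2 : w n + w N / eta * w n <= w N.
  apply: le_trans wn; rewrite mulrDr mulr1 lerD2l mulrC.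
  exact: ler_wpM2l.
rewrite leNgt; apply/negP => ew.
have : w N <= w N / eta * w n.
  by rewrite -mulrA ler_peMr // mulrC ler_pdivlMr // mul1r ltW.
lra.
Qed.

Lemma inv_pow_le p (m : R) : (p == 1)%N || (p == 2)%N -> 0 < m ->
  m ^+ p / (m + 1) ^+ p <= 1 - p%:R / m + 3 / m ^+ 2.
Proof.
move=> hp m0; rewrite ler_pdivrMr ?exprn_gt0 ?addr_gt0 //.
case/orP: hp => /eqP ->.
  rewrite -subr_ge0; have -> : (1 - 1 / m + 3 / m ^+ 2) * (m + 1) ^+ 1 - m ^+ 1 =
    (2 * m + 3) / m ^+ 2 by field; rewrite gt_eqF.
  by rewrite divr_ge0 ?exprn_ge0 ?addr_ge0 ?mulr_ge0 // ltW.
rewrite -subr_ge0; have -> : (1 - 2 / m + 3 / m ^+ 2) * (m + 1) ^+ 2 - m ^+ 2 =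
    (4 * m + 3) / m ^+ 2 by field; rewrite gt_eqF.
by rewrite divr_ge0 ?exprn_ge0 ?addr_ge0 ?mulr_ge0 // ltW.
Qed.

(** The quotient of x by (n+1)^p decays at rate p - a; half of the rate is given up to absorb the
    terms of order 1/n^2, whence the factor 2. The case p = 1 serves covariances, p = 2 fourth
    moments. *)
Lemma growth x p a b c eta : (p == 1)%N || (p == 2)%N -> 0 <= a < p%:R -> 0 <= b -> 0 <= c ->
  0 < eta -> (forall n, 0 <= x n) ->
  (\forall n \near \oo, x n.+1 <= (1 + a / n.+1%:R + b / n.+1%:R ^+ 2) * x n
                                   + c * n.+1%:R ^+ p.-1) ->
  \forall n \near \oo, x n <= (2 * c / (p%:R - a) + eta) * n.+1%:R ^+ p.
Proof.
move=> hp /andP[a0 ap] b0 c0 eta0 x0 hx.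
pose beta := (p%:R - a) / 2; have be0 : 0 < beta by rewrite divr_gt0 // subr_gt0.
pose y n := x n / n.+1%:R ^+ p.
suff : \forall n \near \oo, y n <= c / beta + eta.
  apply: filterS => n; rewrite /y ler_pdivrMr ?exprn_gt0 ?ltr0n //.
  by rewrite (_ : c / beta = 2 * c / (p%:R - a)) // /beta; field; rewrite gt_eqF ?subr_gt0.
apply: decay_limsup => //.
have := nbhs_infty_ger ((4 * b + 3 + 3 * a) / beta).
apply: filterS2 hx => n hx hn.
have m0 : 0 < (n.+1%:R : R) by rewrite ltr0n.
have m1 : 1 <= (n.+1%:R : R) by rewrite ler1n.
have hm : (4 * b + 3 + 3 * a) / beta <= n.+1%:R :> R.
  by apply: le_trans hn _; rewrite ler_nat.
rewrite /y -[n.+2%:R](natr1 n.+1); set m : R := n.+1%:R in m0 m1 hm hx *.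
have q0 : 0 < (m + 1) ^+ p by rewrite exprn_gt0 // addr_gt0.
apply: le_trans (_ : ((1 + a / m + b / m ^+ 2) * x n + c * m ^+ p.-1) / (m + 1) ^+ p <= _).
  by rewrite ler_pM2r ?invr_gt0.
have mp0 : 0 < m ^+ p by rewrite exprn_gt0.
have pE : m ^+ p = m * m ^+ p.-1 by case/orP: hp => /eqP ->; rewrite -exprS.
rewrite mulrDl; apply: lerD; last first.
  rewrite -mulrA ler_wpM2l // ler_pdivrMr // ler_pdivlMl // -pE.
  by rewrite lerXn2r ?nnegrE ?ltW ?addr_gt0 // ltrDl.
have -> : (1 + a / m + b / m ^+ 2) * x n / (m + 1) ^+ p =
   (1 + a / m + b / m ^+ 2) * (m ^+ p / (m + 1) ^+ p) * (x n / m ^+ p).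
  by field; rewrite !gt_eqF.
rewrite ler_wpM2r ?divr_ge0 ?(ltW mp0) //.
have i0 : 0 < m^-1 by rewrite invr_gt0.
have i1 : m^-1 <= 1 by rewrite invf_le1.
apply: le_trans (ler_wpM2l _ (inv_pow_le hp m0)) _.
  by rewrite !addr_ge0 ?divr_ge0 ?exprn_ge0 // ltW.
have : (4 * b + 3 + 3 * a) * m^-1 <= beta.
  by rewrite ler_pdivrMr // [beta * m]mulrC -ler_pdivrMr.
rewrite -exprVn -!/(_ / _); set i := m^-1 in i0 i1 *; move=> hi.
have -> : (1 + a * i + b * i ^+ 2) * (1 - p%:R * i + 3 * i ^+ 2) =
  1 + (a - p%:R) * i + i * (i * (b + 3 - a * p%:R + (3 * a - b * p%:R) * i + 3 * b * i ^+ 2)) by ring.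
have -> : a - p%:R = - beta - beta by rewrite /beta; field.
have h1 : i * (b + 3 - a * p%:R + (3 * a - b * p%:R) * i + 3 * b * i ^+ 2) <= beta.
  apply: le_trans hi; rewrite mulrC ler_wpM2r ?(ltW i0) //.
  have ap0 : 0 <= a * p%:R by rewrite mulr_ge0.
  have bp0 : 0 <= b * p%:R * i by rewrite !mulr_ge0 // ltW.
  have ai : a * i <= a by rewrite ler_piMr.
  have bi : b * i ^+ 2 <= b by rewrite ler_piMr // exprn_ile1 // ltW.
  rewrite (_ : _ + _ = b + 3 - a * p%:R + 3 * (a * i) - b * p%:R * i + 3 * (b * i ^+ 2)); last ring.
  lra.
have := ler_wpM2l (ltW i0) h1; lra.
Qed.

End Growth.

Lemma sqr_addr_le (R : realType) (a b : R) : (a + b) ^+ 2 <= 2 * a ^+ 2 + 2 * b ^+ 2.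
Proof. by have := sqr_ge0 (a - b); rewrite sqrrB sqrrD; lra. Qed.

Lemma pow4_subr_le (R : realType) (a b : R) : (a - b) ^+ 4 <= 8 * (a ^+ 4 + b ^+ 4).
Proof.
have h1 : (a - b) ^+ 2 <= 2 * a ^+ 2 + 2 * b ^+ 2 by rewrite -(sqrrN b) sqr_addr_le.
have h2 : ((a - b) ^+ 2) ^+ 2 <= (2 * a ^+ 2 + 2 * b ^+ 2) ^+ 2.
  rewrite lerXn2r ?nnegrE ?sqr_ge0 //.
  by have := sqr_ge0 a; have := sqr_ge0 b; lra.
rewrite -exprM in h2; apply: (le_trans h2).
have := sqr_ge0 (a ^+ 2 - b ^+ 2).
have -> : (a ^+ 2 - b ^+ 2) ^+ 2 = a ^+ 4 + b ^+ 4 - 2 * (a ^+ 2 * b ^+ 2) by ring.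
have -> : (2 * a ^+ 2 + 2 * b ^+ 2) ^+ 2 = 4 * (a ^+ 4 + b ^+ 4) + 8 * (a ^+ 2 * b ^+ 2) by ring.
lra.
Qed.

(** * Jensen inequalities for the averages *)

Section AvgMoments.
Local Open Scope classical_set_scope.
Variables (R : realType) (alpha : R).
Hypothesis alpha01 : 0 <= alpha <= 1.
Implicit Types (m : nat) (f : nat -> R) (c : nat * nat) (l : R).
Let AP := @avgP R.
Let A2P := avg2P alpha01.

Lemma avg_ge0 m f : (forall i, (i < m.+1)%N -> 0 <= f i) -> 0 <= avg m.+1 f.
Proof. by move=> f0; rewrite -(exp_cst AP m 0); apply: (exp_le AP). Qed.

Lemma avg_sqr m f : avg m.+1 f ^+ 2 <= avg m.+1 (fun i => f i ^+ 2).
Proof.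
rewrite -subr_ge0 expr2 -avg_var.
by apply: avg_ge0 => i _; rewrite -expr2 sqr_ge0.
Qed.

Lemma avg2_sqr m (g : nat * nat -> R) : avg2 alpha m.+1 g ^+ 2 <= avg2 alpha m.+1 (fun c => g c ^+ 2).
Proof.
set a := avg2 _ _ g; rewrite -subr_ge0.
have -> : avg2 alpha m.+1 (fun c => g c ^+ 2) - a ^+ 2 = avg2 alpha m.+1 (fun c => (g c - a) ^+ 2).
  have -> : (fun c => (g c - a) ^+ 2) = (fun c => g c ^+ 2 - (2 * a * g c - a ^+ 2)).
    by apply/funext => c; ring.
  by rewrite !(expB A2P) (exp_cst A2P) (expZ A2P) -/a; ring.
by rewrite -(exp_cst A2P m 0); apply: (exp_le A2P) => c _; exact: sqr_ge0.
Qed.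

Lemma avg_pow4 m f : avg m.+1 f ^+ 4 <= avg m.+1 (fun i => f i ^+ 4).
Proof.
have h : (avg m.+1 f ^+ 2) ^+ 2 <= (avg m.+1 (fun i => f i ^+ 2)) ^+ 2.
  rewrite lerXn2r ?nnegrE ?sqr_ge0 ?avg_sqr //.
  by apply: avg_ge0 => i _; exact: sqr_ge0.
rewrite -exprM in h; apply: (le_trans h); apply: le_trans (avg_sqr _ _) _.
by apply: (exp_le AP) => i _; rewrite -exprM.
Qed.

(** The factor l^4 <= 1/16 compensates the 8 of [pow4_subr_le] and the doubling by Jensen, so the
    constant is 1. *)
Lemma avg_centered_pow4 m f l : 0 <= l <= 2^-1 ->
  avg m.+1 (fun i => (l * (f i - avg m.+1 f)) ^+ 4) <= avg m.+1 (fun i => f i ^+ 4).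
Proof.
move=> /andP[l0 l1].
apply: le_trans (_ : avg m.+1 (fun i => 2^-1 * (f i ^+ 4 + avg m.+1 f ^+ 4)) <= _).
  apply: (exp_le AP) => i _; rewrite exprMn.
  have l4 : l ^+ 4 <= 2^-1 ^+ 4 by rewrite lerXn2r ?nnegrE.
  have s0 : 0 <= f i ^+ 4 + avg m.+1 f ^+ 4 by rewrite addr_ge0 // exprn_even_ge0.
  apply: le_trans (ler_wpM2l _ (pow4_subr_le _ _)) _; first by rewrite exprn_ge0.
  apply: le_trans (ler_wpM2r _ l4) _; first by rewrite mulr_ge0.
  by rewrite le_eqVlt; apply/orP; left; apply/eqP; field.
rewrite (expZ AP) (expD AP) (exp_cst AP).
have := avg_pow4 m f; lra.
Qed.

End AvgMoments.

(** * The martingale increments and the moments of X *)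

Section PairProcess.
Local Open Scope classical_set_scope.
Variables (R : realType) (alpha : R).
Hypothesis alpha01 : 0 <= alpha <= 1.
Implicit Types (n m : nat) (h : seq (nat * nat)) (c : nat * nat) (x y z w : bool * R) (a l : R).
Let AP := @avgP R.
Let A2P := avg2P alpha01.
Notation EE := (expect (avg2 alpha)).

(** The index [x] consists of a tree and an exponent, so that mixed moments within one tree and
    across both are treated alike. Below, [xi] is the increment and [Gam] the conditional covariance
    of two increments. *)
Definition X x h : R := W x.2 (map (pick x.1) h) - mean x.2 (size h).
Definition xi x h c : R := x.2 *
  (A x.2 (map (pick x.1) h) (pick x.1 c) - avg (size h).+1 (A x.2 (map (pick x.1) h))).
Definition Gam x y h : R := avg2 alpha (size h).+1 (fun c => xi x h c * xi y h c).
Definition admissible x : Prop := 0 <= x.2 < 2^-1.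

Lemma XS x c h : X x (c :: h) = (1 + x.2 / (size h).+1%:R) * X x h + xi x h c.
Proof.
rewrite /X /xi /= WS meanS.
have := @avg_A R x.2 (map (pick x.1) h); rewrite size_map => ->; ring.
Qed.

Lemma avg2_xi x h : avg2 alpha (size h).+1 (xi x h) = 0.
Proof.
rewrite /xi (avg2_pick alpha x.1 _ (fun i => x.2 * (A x.2 (map (pick x.1) h) i - _))).
by rewrite (expZ AP) (expB AP) (exp_cst AP) subrr mulr0.
Qed.

Lemma admissible_half x : admissible x -> 0 <= x.2 <= 2^-1.
Proof. by move=> /andP[-> /ltW]. Qed.

(** The value t = 1/4 satisfies t <= (1 - l)/2 for all l <= 1/2, so the bound is uniform up to the
    critical exponent. *)
Definition K0 : R := Kmom (4^-1).

Lemma K0_ge0 : 0 <= K0.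
Proof. by rewrite /K0 /Kmom mulr_ge0 // ?divr_ge0 // exprn_even_ge0. Qed.

Lemma avg2_xi4 x n h : admissible x -> size h = n ->
  avg2 alpha n.+1 (fun c => xi x h c ^+ 4) <= avg n.+1 (fun u => A x.2 (map (pick x.1) h) u ^+ 4).
Proof.
move=> xP hn; rewrite /xi hn.
rewrite (avg2_pick alpha x.1 _ (fun i => (x.2 * (A x.2 (map (pick x.1) h) i - _)) ^+ 4)).
exact: avg_centered_pow4 (admissible_half xP).
Qed.

Lemma expect_xi4 x n : admissible x ->
  EE n (fun h => avg2 alpha n.+1 (fun c => xi x h c ^+ 4)) <= K0.
Proof.
move=> xP; apply: le_trans (_ : EE n (fun h =>
    avg n.+1 (fun u => A x.2 (map (pick x.1) h) u ^+ 4)) <= _).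
  by apply: (expect_le A2P) => h hn _; exact: avg2_xi4.
rewrite (expect_tree alpha x.1 n (fun p => avg n.+1 (fun u => A x.2 p u ^+ 4))).
have /andP[l0 l1] := xP.
by apply: expect_moment4 => //; lra.
Qed.

Lemma EES n (f : seq (nat * nat) -> R) :
  EE n.+1 f = EE n (fun h => avg2 alpha n.+1 (fun c => f (c :: h))).
Proof. by []. Qed.

(** In (u + v)^4 with u = (1 + l/m) X and v the increment, the term u^3 v has conditional mean zero,
    and the other mixed terms are absorbed by Young's inequality into (d/m) u^4, with d = 1 - 2l,
    and a multiple of m v^4. *)
Lemma X4_growth x : admissible x ->
  exists2 C, 0 <= C & \forall n \near \oo, EE n (fun h => X x h ^+ 4) <= C * n.+1%:R ^+ 2.
Proof.
move=> xP; have /andP[l0 l1] := xP; set l : R := x.2 in l0 l1.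
pose d := 1 - 2 * l; have d0 : 0 < d by rewrite /d; lra.
have d1 : d <= 1 by rewrite /d; lra.
pose c := (3 + 16 / d) * K0.
have c0 : 0 <= c by rewrite mulr_ge0 ?K0_ge0 // addr_ge0 // divr_ge0 // ltW.
exists (2 * c / (2%:R - (1 + 2 * l)) + 1).
  by rewrite addr_ge0 // divr_ge0 //; [exact: mulr_ge0|lra].
(* The rate is 4 l + d = 1 + 2 l < 2, and 26 = 11 + 4 + 11 bounds the coefficient of 1/m^2. *)
apply: (@growth R (fun n => EE n (fun h => X x h ^+ 4)) 2 (1 + 2 * l) 26 c 1) => //.
- by apply/andP; split; lra.
- by move=> n; apply: (expect_ge0 A2P) => h _ _; rewrite exprn_even_ge0.
apply: nearW => n; rewrite EES expr1.
have m0 : 0 < (n.+1%:R : R) by rewrite ltr0n.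
have m1 : 1 <= (n.+1%:R : R) by rewrite ler1n.
set m : R := n.+1%:R in m0 m1 *.
pose r := 1 + l / m.
have r0 : 0 <= r by rewrite addr_ge0 // divr_ge0 // ltW.
apply: le_trans (_ : EE n (fun h => (1 + d / m) * r ^+ 4 * X x h ^+ 4 +
    (3 + 16 * m / d) * avg2 alpha n.+1 (fun c => xi x h c ^+ 4)) <= _).
  apply: (expect_le A2P) => h hn _.
  have xi0 : avg2 alpha n.+1 (xi x h) = 0 by rewrite -hn avg2_xi.
  rewrite -[leRHS]addr0 -(mulr0 (4 * (r * X x h) ^+ 3)) -xi0 -!(expZ A2P).
  rewrite -[X in _ <= X + _ + _](exp_cst A2P n) -!(expD A2P).
  apply: (exp_le A2P) => k _; rewrite XS hn -/l -/m -/r.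
  set u := r * X x h; set v := xi x h k.
  have -> : (1 + d / m) * r ^+ 4 * X x h ^+ 4 = (1 + d / m) * u ^+ 4 by rewrite /u; ring.
  (* First 6 u^2 v^2 + 4 u v^3 <= 8 u^2 v^2 + 2 v^4, then 8 u^2 v^2 <= (d/m) u^4 + (16 m/d) v^4. *)
  have := sqr_ge0 (u * v - v ^+ 2); have := sqr_ge0 (d / m * u ^+ 2 - 4 * v ^+ 2).
  have dm : 0 < m / d by rewrite divr_gt0.
  move/(mulr_ge0 (ltW dm)).
  have -> : m / d * (d / m * u ^+ 2 - 4 * v ^+ 2) ^+ 2 =
    d / m * u ^+ 4 - 8 * (u ^+ 2 * v ^+ 2) + 16 * m / d * v ^+ 4 by field; rewrite !gt_eqF.
  have -> : (u * v - v ^+ 2) ^+ 2 = u ^+ 2 * v ^+ 2 - 2 * (u * v ^+ 3) + v ^+ 4 by ring.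
  have -> : (u + v) ^+ 4 = u ^+ 4 + 4 * u ^+ 3 * v + 6 * (u ^+ 2 * v ^+ 2) + 4 * (u * v ^+ 3) + v ^+ 4.
    by ring.
  set e := d / m; set e' := 16 * m / d; lra.
rewrite (expectD A2P) !(expectZ A2P); apply: lerD.
  rewrite ler_wpM2r //; first by apply: (expect_ge0 A2P) => h _ _; rewrite exprn_even_ge0.
  rewrite /r; have i0 : 0 < m^-1 by rewrite invr_gt0.
  have i1 : m^-1 <= 1 by rewrite invf_le1.
  rewrite -exprVn; set i := m^-1 in i0 i1 *.
  have p1 : 0 <= i ^+ 2 by rewrite sqr_ge0.
  have h1 : (1 + l * i) ^+ 4 <= 1 + 4 * l * i + 11 * i ^+ 2.
    have li0 : 0 <= l * i by rewrite mulr_ge0 // ltW.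
    have li : l * i <= i by rewrite ler_piMl ?ltW //; lra.
    have li2 : (l * i) ^+ 2 <= i ^+ 2 by rewrite lerXn2r ?nnegrE // ltW.
    have li3 : (l * i) ^+ 3 <= i ^+ 2.
      by rewrite exprSr -[leRHS]mulr1 ler_pM ?sqr_ge0 //; lra.
    have li4 : (l * i) ^+ 4 <= i ^+ 2.
      by rewrite exprSr -[leRHS]mulr1 ler_pM ?exprn_ge0 //; lra.
    have -> : (1 + l * i) ^+ 4 = 1 + 4 * l * i + 6 * (l * i) ^+ 2 + 4 * (l * i) ^+ 3 + (l * i) ^+ 4.
      by ring.
    lra.
  have di : 0 <= 1 + d * i by rewrite addr_ge0 // mulr_ge0 // ltW.
  apply: le_trans (ler_wpM2l di h1) _.
  have -> : (1 + d * i) * (1 + 4 * l * i + 11 * i ^+ 2) =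
     1 + (4 * l + d) * i + (11 + 4 * (l * d) + 11 * (d * i)) * i ^+ 2 by ring.
  have -> : 4 * l + d = 1 + 2 * l by rewrite /d; ring.
  rewrite lerD2l ler_wpM2r //.
  have ld : l * d <= 1 by rewrite mulr_ile1 ?(ltW d0) //; lra.
  have didi : d * i <= 1 by rewrite mulr_ile1 ?(ltW d0) ?(ltW i0).
  lra.
apply: le_trans (ler_wpM2l _ (expect_xi4 n xP)) _.
  by rewrite addr_ge0 // divr_ge0 ?mulr_ge0 // ltW.
rewrite /c [leRHS]mulrAC ler_wpM2r ?K0_ge0 //.
have -> : (3 + 16 / d) * m = 3 * m + 16 * m / d by field; rewrite gt_eqF.
by rewrite lerD2r; lra.
Qed.

Lemma avg2_XX x y n h : size h = n ->
  avg2 alpha n.+1 (fun c => X x (c :: h) * X y (c :: h)) =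
  (1 + x.2 / n.+1%:R) * (1 + y.2 / n.+1%:R) * (X x h * X y h) + Gam x y h.
Proof.
move=> hn; rewrite /Gam hn; set r := 1 + _; set s := 1 + _.
have -> : (fun c => X x (c :: h) * X y (c :: h)) = (fun c => r * X x h * xi y h c +
   s * X y h * xi x h c + (r * s * (X x h * X y h) + xi x h c * xi y h c)).
  by apply/funext => c; rewrite !XS hn -/r -/s; ring.
have h0 z : avg2 alpha n.+1 (fun c => xi z h c) = 0 by rewrite -hn avg2_xi.
by rewrite !(expD A2P) (expZ A2P _ (r * X x h)) (expZ A2P _ (s * X y h)) !h0 !mulr0 !add0r (exp_cst A2P).
Qed.

Lemma Gam_sqr x y n : admissible x -> admissible y -> EE n (fun h => Gam x y h ^+ 2) <= K0.
Proof.
move=> xP yP.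
have -> : K0 = 2^-1 * K0 + 2^-1 * K0 by field.
apply: le_trans (lerD (ler_wpM2l _ (expect_xi4 n xP)) (ler_wpM2l _ (expect_xi4 n yP))); rewrite ?invr_ge0 //.
rewrite -!(expectZ A2P) -(expectD A2P); apply: (expect_le A2P) => h hn _.
rewrite /Gam hn; apply: le_trans (avg2_sqr alpha01 _ _) _.
rewrite -!(expZ A2P) -(expD A2P); apply: (exp_le A2P) => c _.
have := sqr_ge0 (xi x h c ^+ 2 - xi y h c ^+ 2).
set u := xi x h c; set v := xi y h c.
have -> : (u ^+ 2 - v ^+ 2) ^+ 2 = u ^+ 4 + v ^+ 4 - 2 * (u * v) ^+ 2 by ring.
lra.
Qed.

Lemma Gam_mean x y n : admissible x -> admissible y -> `|EE n (Gam x y)| <= 1 + K0.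
Proof.
move=> xP yP; apply: le_trans (expect_norm A2P _ _) _.
rewrite -(expect_cst A2P n 1).
apply: le_trans (lerD (lexx _) (Gam_sqr n xP yP)); rewrite -(expectD A2P).
apply: (expect_le A2P) => h _ _; set g := Gam x y h.
have := sqr_ge0 (`|g| - 1); have := normr_ge0 g.
rewrite sqrrB1 real_normK ?num_real //; lra.
Qed.

(** The denominator is what makes distinct exponents nearly uncorrelated: at [lam i] and [lam j] it
    is half of [eps i + eps j]. The 3 is the 2 of [growth] plus slack. *)
Lemma XX_growth x y : admissible x -> admissible y ->
  \forall n \near \oo, `|EE n (fun h => X x h * X y h)| <=
     3 * (1 + K0) / (1 - x.2 - y.2) * n.+1%:R.
Proof.
move=> xP yP; have /andP[l0 l1] := xP; have /andP[k0 k1] := yP.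
have e0 : 0 < 1 - x.2 - y.2 by lra.
have C0 : 0 < 1 + K0 by rewrite ltr_pwDl // K0_ge0.
have -> : 3 * (1 + K0) / (1 - x.2 - y.2) =
  2 * (1 + K0) / (1%:R - (x.2 + y.2)) + (1 + K0) / (1 - x.2 - y.2).
  by rewrite opprD addrA; field; rewrite gt_eqF.
suff : \forall n \near \oo, `|EE n (fun h => X x h * X y h)| <=
   (2 * (1 + K0) / (1%:R - (x.2 + y.2)) + (1 + K0) / (1 - x.2 - y.2)) * n.+1%:R ^+ 1.
  by apply: filterS => n; rewrite expr1.
apply: (@growth R (fun n => `|EE n (fun h => X x h * X y h)|) 1 (x.2 + y.2) 1 (1 + K0)) => //.
- by apply/andP; split; lra.
- exact: ltW.
- by rewrite divr_gt0.
apply: nearW => n; rewrite EES expr0 mulr1.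
rewrite (_ : EE n _ = EE n (fun h => (1 + x.2 / n.+1%:R) * (1 + y.2 / n.+1%:R) * (X x h * X y h)
   + Gam x y h)); last by apply: (expect_eq A2P) => h hn _; exact: avg2_XX.
rewrite (expectD A2P) (expectZ A2P).
apply: le_trans (ler_normD _ _) _; apply: lerD (Gam_mean n xP yP).
rewrite normrM ler_wpM2r // ger0_norm.
  have i0 : 0 <= n.+1%:R^-1 :> R by [].
  rewrite -exprVn; set i := n.+1%:R^-1 in i0 *.
  have -> : (1 + x.2 * i) * (1 + y.2 * i) = 1 + (x.2 + y.2) * i + x.2 * y.2 * i ^+ 2 by ring.
  rewrite lerD2l ler_wpM2r ?sqr_ge0 // mulr_ile1 //; lra.
by rewrite mulr_ge0 // addr_ge0 // divr_ge0.
Qed.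

End PairProcess.

(** * Comparison of two exponents *)

Section Ratio.
Local Open Scope classical_set_scope.
Variable R : realType.
Implicit Types (l k eta : R) (s L n : nat).

(** Of order s^(l-k): the gain when the exponent [l] is replaced by a larger [k] on subtrees of size
    at least [s]. *)
Definition gratio l k s : R := grate l s / grate k s.

Lemma gratio_gt0 l k s : 0 <= l -> 0 <= k -> (0 < s)%N -> 0 < gratio l k s.
Proof. by move=> l0 k0 s0; rewrite divr_gt0 // (lt_le_trans ltr01) // grate_ge1. Qed.

Lemma gratioS l k s : 0 <= k -> gratio l k s.+2 = gratio l k s.+1 * (1 - (k - l) / (s.+1%:R + k)).
Proof.
move=> k0; rewrite /gratio !(grateS _ (ltn0Sn s)).
have g0 : grate k s.+1 != 0 by rewrite gt_eqF // (lt_le_trans ltr01) // grate_ge1.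
have m0 : 0 < (s.+1%:R : R) by rewrite ltr0n.
set m : R := s.+1%:R in m0 *; field; do ?[apply/andP; split]; rewrite ?g0 // gt_eqF //; lra.
Qed.

Lemma gratio_decr l k s s' : 0 <= l -> l <= k -> (0 < s <= s')%N -> gratio l k s' <= gratio l k s.
Proof.
move=> l0 lk; have k0 := le_trans l0 lk.
elim: s' => [|s' IH]; first by case: s.
move=> /andP[s0]; rewrite leq_eqVlt => /orP[/eqP -> //|]; rewrite ltnS => ss'.
apply: le_trans (IH _); last by rewrite s0.
case: s' ss' {IH} => [|s' _]; first by case: s s0.
rewrite gratioS // ler_piMr //; first by rewrite ltW // gratio_gt0.
by rewrite gerBl divr_ge0 ?subr_ge0 // addr_ge0.
Qed.

Lemma phi_gratio l k L s : 0 <= l -> l <= k -> (0 < L <= s)%N -> phi l s <= gratio l k L * phi k s.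
Proof.
move=> l0 lk Ls; have k0 := le_trans l0 lk; have /andP[L0 LS] := Ls.
have s0 : (0 < s)%N by exact: leq_trans LS.
rewrite /phi mulrA ler_pM2r ?invr_gt0 ?ltr0n //.
have g0 : 0 < grate k s by rewrite (lt_le_trans ltr01) // grate_ge1.
by rewrite -ler_pdivrMr //; exact: gratio_decr.
Qed.

Lemma gratio_cvg0 l k eta : 0 <= l -> l < k -> k <= 1 -> 0 < eta ->
  \forall n \near \oo, gratio l k n.+1 <= eta.
Proof.
move=> l0 lk k1 eta0; have k0 : 0 <= k by rewrite ltW // (le_lt_trans l0).
suff : \forall n \near \oo, gratio l k n.+1 <= 0 / ((k - l) / 2) + eta.
  by rewrite mul0r add0r.
apply: (@decay_limsup R (fun n => gratio l k n.+1)) => //.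
  by rewrite divr_gt0 // subr_gt0.
apply: nearW => n; rewrite gratioS // mul0r addr0 mulrC ler_wpM2r //; first by rewrite ltW // gratio_gt0.
have m1 : 1 <= (n.+1%:R : R) by rewrite ler1n.
rewrite lerD2l lerN2 -mulrA ler_wpM2l ?subr_ge0 ?(ltW lk) // -invfM lef_pV2 ?posrE; lra.
Qed.

(** The quantity is of order s^(1 - 2(k - l)), hence the condition k - l > 1/2. *)
Lemma gratio_sqr_cvg0 l k eta : 0 <= l -> l + 2^-1 < k -> k <= 1 -> 0 < eta ->
  \forall n \near \oo, n.+1%:R * gratio l k n.+1 ^+ 2 <= eta.
Proof.
move=> l0 lk k1 eta0; have k0 : 0 <= k by lra.
pose d := k - l; pose b := d - 2^-1; have b0 : 0 < b by rewrite /b /d; lra.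
suff : \forall n \near \oo, n.+1%:R * gratio l k n.+1 ^+ 2 <= 0 / b + eta.
  by rewrite mul0r add0r.
apply: (@decay_limsup R (fun n => n.+1%:R * gratio l k n.+1 ^+ 2)) => //.
have := nbhs_infty_ger ((1 + b) / b); apply: filterS => n hn.
have hm : (1 + b) / b <= n.+1%:R :> R by apply: le_trans hn _; rewrite ler_nat.
have m1 : 1 <= (n.+1%:R : R) by rewrite ler1n.
rewrite gratioS // mul0r addr0 exprMn -[n.+2%:R]natr1; set m : R := n.+1%:R in hm m1 *.
set g := gratio _ _ _; rewrite -/d.
have -> : (m + 1) * (g ^+ 2 * (1 - d / (m + k)) ^+ 2) =
  ((m + 1) * (1 - d / (m + k)) ^+ 2 / m) * (m * g ^+ 2) by field; rewrite !gt_eqF //; lra.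
have m0 : 0 < m by lra.
have mg : 0 <= m * g ^+ 2 by rewrite mulr_ge0 ?sqr_ge0 // ltW.
rewrite ler_wpM2r {mg}//. rewrite ler_pdivrMr //.
have -> : (1 - b / m) * m = m - b by field; rewrite gt_eqF.
apply: le_trans (_ : (m + 1) * (1 - d / (m + 1)) ^+ 2 <= _).
  have h : d / (m + 1) <= d / (m + k) by rewrite ler_wpM2l ?lef_pV2 ?posrE // /d; lra.
  have h2 : d / (m + k) <= 1 by rewrite ler_pdivrMr ?mul1r /d; lra.
  rewrite ler_wpM2l ?lerXn2r ?nnegrE //; set e := d / (m + 1) in h *; set e' := d / (m + k) in h h2 *; lra.
have -> : (m + 1) * (1 - d / (m + 1)) ^+ 2 = (m + 1 - d) ^+ 2 / (m + 1) by field; rewrite gt_eqF; lra.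
rewrite ler_pdivrMr; last by lra.
have hm' : 1 + b <= m * b by rewrite -ler_pdivrMr.
have d1 : d <= 1 by rewrite /d; lra.
have dE : d = b + 2^-1 by rewrite /b; ring.
rewrite dE in d1 *.
have b1 : b <= 1 by lra.
have : b * b <= b by rewrite ler_piMr // ltW.
have -> : (m + 1 - (b + 2^-1)) ^+ 2 = m * m + m - 2 * (m * b) + b * b - b + 4^-1 by field.
have -> : (m - b) * (m + 1) = m * m + m - m * b - b by ring.
lra.
Qed.

End Ratio.

(** * Concentration of the conditional covariances *)

Section Concentration.
Local Open Scope classical_set_scope.
Variables (R : realType) (alpha : R).
Hypothesis alpha01 : 0 <= alpha <= 1.
Implicit Types (n m L : nat) (h q r : seq (nat * nat)) (c : nat * nat) (x y z w : bool * R) (l : R).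
Let AP := @avgP R.
Let A2P := avg2P alpha01.
Notation EE := (expect (avg2 alpha)).

Definition phi_small L l s : R := if (s <= L)%N then phi l s else 0.
Definition phi_large L l s : R := if (s <= L)%N then 0 else phi l s.
Definition xi_small L x h c : R := x.2 *
  (asum (phi_small L x.2) (map (pick x.1) h) (pick x.1 c) -
   avg (size h).+1 (asum (phi_small L x.2) (map (pick x.1) h))).
Definition Gam_small L x y h : R :=
  avg2 alpha (size h).+1 (fun c => xi_small L x h c * xi_small L y h c).

Lemma phi_small01 L l s : 0 <= l <= 1 -> (0 < s)%N -> 0 <= phi_small L l s <= 1.
Proof.
move=> l01 s0; have /andP[l0 _] := l01; rewrite /phi_small; case: ifP => _; last by rewrite lexx ler01.
by rewrite phi_le1 // ltW // phi_gt0.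
Qed.

Lemma asum_small_bound L l p u : 0 <= l <= 1 -> valid below p -> (u <= size p)%N ->
  0 <= asum (phi_small L l) p u <= L%:R.
Proof.
move=> l01 vp up; apply/andP; split.
  by apply: asum_ge0 => s s0; have /andP[] := phi_small01 L l01 s0.
apply: le_trans (_ : (\sum_(v < (size p).+1) (anc p u v && (sz p v <= L)))%N%:R <= _); last first.
  by rewrite ler_nat; exact: count_small_anc.
rewrite natr_sum; apply: ler_sum => v _.
case: anc; rewrite ?mul0r ?mul1r //=.
have sv : (0 < sz p v)%N by rewrite sz_gt0 // -ltnS.
rewrite /phi_small; case: ifP => _ //=; exact: phi_le1.
Qed.

Lemma xi_small_bound L x n h c : admissible x -> size h = n -> valid below2 h -> below2 n.+1 c ->
  `|xi_small L x h c| <= L%:R.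
Proof.
move=> /andP[l0 l1] hn hv [c1 c2].
have l01 : 0 <= x.2 <= 1 by rewrite l0; lra.
rewrite /xi_small; set p := map _ h.
have vp : valid below p by exact: valid_tree.
have pn : size p = n by rewrite size_map.
have b u : (u < n.+1)%N -> 0 <= asum (phi_small L x.2) p u <= L%:R.
  by rewrite ltnS -pn => up; exact: asum_small_bound.
have /andP[b1 b2] : 0 <= asum (phi_small L x.2) p (pick x.1 c) <= L%:R.
  by apply: b; rewrite /pick; case: x.1.
have a1 : 0 <= avg n.+1 (asum (phi_small L x.2) p).
  by apply: avg_ge0 => i /b /andP[].
have a2 : avg n.+1 (asum (phi_small L x.2) p) <= L%:R.
  by rewrite -(exp_cst AP n L%:R); apply: (exp_le AP) => i /b /andP[].
rewrite hn normrM (ger0_norm l0) -[leRHS]mul1r ler_pM //; first by lra.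
rewrite ler_norml; lra.
Qed.

Lemma xi_small_diff L x n q r c c' : admissible x -> size (q ++ c :: r) = n ->
  valid below2 (q ++ c :: r) -> valid below2 (q ++ c' :: r) ->
  avg2 alpha n.+1 (fun k => `|xi_small L x (q ++ c :: r) k - xi_small L x (q ++ c' :: r) k|) <=
  8 * L%:R ^+ 2 / n.+1%:R.
Proof.
move=> /andP[l0 l1] hn hv hv'; have l01 : 0 <= x.2 <= 1 by rewrite l0; lra.
have hn' : size (q ++ c' :: r) = n by rewrite -hn !size_cat.
rewrite /xi_small hn hn'; set f := phi_small L x.2.
have vp := valid_tree x.1 hv; have vp' := valid_tree x.1 hv'.
rewrite !map_cat /= in vp vp' *.
set p := map _ q ++ pick x.1 c :: _ in vp *; set p' := map _ q ++ pick x.1 c' :: _ in vp' *.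
have pn : size p = n by rewrite -hn !size_cat /= !size_map.
rewrite (avg2_pick alpha x.1 _ (fun i => `|x.2 * (asum f p i - avg n.+1 (asum f p)) -
   x.2 * (asum f p' i - avg n.+1 (asum f p'))|)).
have D : avg n.+1 (fun u => `|asum f p u - asum f p' u|) <= 4 * L%:R ^+ 2 / n.+1%:R.
  rewrite /avg ler_pM2r ?invr_gt0 ?ltr0n //.
  have fL s : (L < s)%N -> f s = 0 by rewrite /f /phi_small ltnNge => /negbTE ->.
  have := asum_bounded_diff (fun s => @phi_small01 L x.2 s l01) fL vp vp'.
  by rewrite -/p -/p' pn.
have -> : 8 * L%:R ^+ 2 / n.+1%:R = 4 * L%:R ^+ 2 / n.+1%:R + 4 * L%:R ^+ 2 / n.+1%:R :> R.
  by rewrite -mulrDl -mulrDl; congr (_ * _ / _); ring.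
have D2 : `|avg n.+1 (fun u => asum f p u - asum f p' u)| <= 4 * L%:R ^+ 2 / n.+1%:R.
  by apply: le_trans D; exact: (exp_norm AP).
apply: le_trans (lerD D D2).
rewrite -[X in _ + X](exp_cst AP n) -(expD AP); apply: (exp_le AP) => i _.
rewrite (expB AP) -mulrBr normrM (ger0_norm l0).
have -> : asum f p i - avg n.+1 (asum f p) - (asum f p' i - avg n.+1 (asum f p')) =
  (asum f p i - asum f p' i) - (avg n.+1 (asum f p) - avg n.+1 (asum f p')) by ring.
apply: le_trans (ler_normB _ _); rewrite ler_piMl //; lra.
Qed.

Lemma Gam_small_diff L x y n q r c c' : admissible x -> admissible y -> size (q ++ c :: r) = n ->
  valid below2 (q ++ c :: r) -> valid below2 (q ++ c' :: r) ->
  `|Gam_small L x y (q ++ c :: r) - Gam_small L x y (q ++ c' :: r)| <= 16 * L%:R ^+ 3 / n.+1%:R.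
Proof.
move=> xP yP hn hv hv'; have hn' : size (q ++ c' :: r) = n by rewrite -hn !size_cat.
rewrite /Gam_small hn hn' -(expB A2P); apply: le_trans (exp_norm A2P _ _) _.
set h := q ++ c :: r in hn hv *; set h' := q ++ c' :: r in hn' hv' *.
have -> : 16 * L%:R ^+ 3 / n.+1%:R =
   L%:R * (8 * L%:R ^+ 2 / n.+1%:R) + L%:R * (8 * L%:R ^+ 2 / n.+1%:R) :> R.
  by field; rewrite addrC natr1 pnatr_eq0.
apply: le_trans (lerD (ler_wpM2l _ (xi_small_diff L xP hn hv hv'))
                      (ler_wpM2l _ (xi_small_diff L yP hn hv hv'))) => //.
rewrite -!(expZ A2P) -(expD A2P); apply: (exp_le A2P) => k kP.
have bx := xi_small_bound L xP hn' hv' kP; have b_y := xi_small_bound L yP hn hv kP.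
set u := xi_small L x h k; set v := xi_small L y h k in b_y *.
set u' := xi_small L x h' k in bx *; set v' := xi_small L y h' k.
have -> : u * v - u' * v' = (u - u') * v + u' * (v - v') by ring.
apply: le_trans (ler_normD _ _) _; rewrite (normrM (u - u')) (normrM u'); apply: lerD.
  by rewrite mulrC ler_wpM2r.
by rewrite ler_wpM2r.
Qed.

Lemma Gam_small_var L x y n : admissible x -> admissible y ->
  EE n (fun h => (Gam_small L x y h - EE n (Gam_small L x y)) ^+ 2) <=
  n%:R * (16 * L%:R ^+ 3 / n.+1%:R) ^+ 2.
Proof.
move=> xP yP; apply: (expect_var_bounded_diff A2P) => q r c c' hn hv hv'.
exact: Gam_small_diff.
Qed.

Lemma asum_split L l p u : A l p u = asum (phi_small L l) p u + asum (phi_large L l) p u.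
Proof.
rewrite -asumD /A; congr (asum _ p u); apply/funext => s.
by rewrite /phi_small /phi_large; case: ifP; rewrite ?addr0 ?add0r.
Qed.

Lemma gratio1 l k : gratio l k 1 = 1.
Proof. by rewrite /gratio !grate1 divr1. Qed.

(** The detour through [l'] frees the factor from [l]: with l' = 1/2 and k = 3/4 one factor serves
    all admissible exponents. *)
Lemma asum_large_le L l l' k p u : 0 <= l -> l <= l' -> l' <= k ->
  asum (phi_large L l) p u <= gratio l' k L.+1 * A k p u.
Proof.
move=> l0 ll' l'k; have l'0 := le_trans l0 ll'; have k0 := le_trans l'0 l'k.
rewrite /A -asumZ; apply: asum_le => s s0; rewrite /phi_large; case: leqP => Ls.
  by rewrite mulr_ge0 ?ltW ?phi_gt0 ?gratio_gt0.
apply: le_trans (phi_gratio l'0 l'k _); last by rewrite Ls.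
apply: le_trans (phi_gratio l0 ll' (_ : 0 < 1 <= s)%N) _; first by rewrite s0.
by rewrite gratio1 mul1r.
Qed.

(** The moment constant for the exponent 3/4, where (1 - 3/4)/2 = 1/8. *)
Definition K1 : R := Kmom (8^-1).

Lemma K1_ge0 : 0 <= K1.
Proof. by rewrite /K1 /Kmom mulr_ge0 // ?divr_ge0 // exprn_even_ge0. Qed.

Lemma expect_large4 L x n : admissible x ->
  EE n (fun h => avg2 alpha n.+1 (fun c => (xi x h c - xi_small L x h c) ^+ 4)) <=
  gratio 2^-1 (3 / 4) L.+1 ^+ 4 * K1.
Proof.
move=> xP; have /andP[l0 l1] := xP; set rho := gratio _ _ _.
have rho0 : 0 <= rho by rewrite ltW // gratio_gt0 //; lra.
have AK : expect (@avg R) n (fun p => avg n.+1 (fun u => A (3 / 4) p u ^+ 4)) <= K1.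
  by apply: expect_moment4; lra.
apply: le_trans (ler_wpM2l _ AK); last by rewrite exprn_ge0.
rewrite -(expect_tree alpha x.1 n) -(expectZ A2P); apply: (expect_le A2P) => h hn _.
rewrite /xi /xi_small hn; set p := map _ h.
pose B := asum (phi_large L x.2) p.
have -> : (fun c => (x.2 * (A x.2 p (pick x.1 c) - avg n.+1 (A x.2 p)) - x.2 *
  (asum (phi_small L x.2) p (pick x.1 c) - avg n.+1 (asum (phi_small L x.2) p))) ^+ 4) =
  (fun c => (x.2 * (B (pick x.1 c) - avg n.+1 B)) ^+ 4).
  apply/funext => c /=; congr (_ ^+ 4).
  have -> : avg n.+1 (A x.2 p) = avg n.+1 (asum (phi_small L x.2) p) + avg n.+1 B.
    by rewrite -(expD AP); congr (avg _ _); apply/funext => i; rewrite -asum_split.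
  by rewrite (asum_split L) -/B; ring.
rewrite (avg2_pick alpha x.1 n (fun i => (x.2 * (B i - avg n.+1 B)) ^+ 4)).
apply: le_trans (avg_centered_pow4 _ _ (admissible_half xP)) _.
rewrite -(expZ AP); apply: (exp_le AP) => i _; rewrite -exprMn.
have B1 : B i <= rho * A (3 / 4) p i by apply: asum_large_le; lra.
have B0 : 0 <= B i.
  by apply: asum_ge0 => s s0; rewrite /phi_large; case: ifP => // _; rewrite ltW // phi_gt0.
by rewrite lerXn2r ?nnegrE // (le_trans B0).
Qed.

Lemma expect_small4 L x n : admissible x ->
  EE n (fun h => avg2 alpha n.+1 (fun c => xi_small L x h c ^+ 4)) <= K0 R.
Proof.
move=> xP; have /andP[l0 l1] := xP; have l01 : 0 <= x.2 <= 1 by rewrite l0; lra.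
have AK : expect (@avg R) n (fun p => avg n.+1 (fun u => A x.2 p u ^+ 4)) <= K0 R.
  by apply: expect_moment4 => //; lra.
apply: le_trans AK; rewrite -(expect_tree alpha x.1 n); apply: (expect_le A2P) => h hn _.
rewrite /xi_small hn; set p := map _ h.
rewrite (avg2_pick alpha x.1 _ (fun i => (x.2 * (asum (phi_small L x.2) p i - _)) ^+ 4)).
apply: le_trans (avg_centered_pow4 _ _ (admissible_half xP)) _.
have f0 s : (0 < s)%N -> 0 <= phi_small L x.2 s by move=> s0; have /andP[] := phi_small01 L l01 s0.
apply: (exp_le AP) => i _; rewrite lerXn2r ?nnegrE ?A_ge0 ?asum_ge0 //.
apply: asum_le => s s0; rewrite /phi_small; case: ifP => // _; by rewrite ltW // phi_gt0.
Qed.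

(** In u v - u' v' = (u - u') v + u' (v - v') the differences have fourth moments of order rho^4,
    the other factors of order 1; Young's inequality with weights rho^-2 and rho^2 balances them. *)
Lemma Gam_trunc L x y n : admissible x -> admissible y ->
  EE n (fun h => (Gam alpha x y h - Gam_small L x y h) ^+ 2) <=
  2 * gratio 2^-1 (3 / 4) L.+1 ^+ 2 * (K1 + K0 R).
Proof.
move=> xP yP; set rho := gratio _ _ _.
have rho0 : 0 < rho by rewrite gratio_gt0 //; lra.
have -> : 2 * rho ^+ 2 * (K1 + K0 R) = (rho ^- 2 * (rho ^+ 4 * K1) + rho ^+ 2 * K0 R) +
    (rho ^- 2 * (rho ^+ 4 * K1) + rho ^+ 2 * K0 R) by field; rewrite gt_eqF.
have r2 : 0 <= rho ^- 2 by rewrite invr_ge0 exprn_ge0 // ltW.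
have r2' : 0 <= rho ^+ 2 by rewrite exprn_ge0 // ltW.
apply: le_trans (lerD (lerD (ler_wpM2l r2 (expect_large4 L n xP)) (ler_wpM2l r2' (expect_xi4 alpha01 n yP)))
                  (lerD (ler_wpM2l r2 (expect_large4 L n yP)) (ler_wpM2l r2' (expect_small4 L n xP)))).
rewrite -!(expectZ A2P) -!(expectD A2P); apply: (expect_le A2P) => h hn _.
rewrite /Gam /Gam_small hn -(expB A2P); apply: le_trans (avg2_sqr alpha01 _ _) _.
rewrite -!(expZ A2P) -!(expD A2P); apply: (exp_le A2P) => c _.
set u := xi x h c; set v := xi y h c; set u' := xi_small L x h c; set v' := xi_small L y h c.
pose b := u - u'; pose b' := v - v'; rewrite -/b -/b'.
have -> : u * v - u' * v' = b * v + u' * b' by rewrite /b /b'; ring.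
have ag s t : 2 * (s ^+ 2 * t ^+ 2) <= rho ^- 2 * s ^+ 4 + rho ^+ 2 * t ^+ 4.
  rewrite -subr_ge0.
  have -> : rho ^- 2 * s ^+ 4 + rho ^+ 2 * t ^+ 4 - 2 * (s ^+ 2 * t ^+ 2) =
    (rho^-1 * s ^+ 2 - rho * t ^+ 2) ^+ 2 by field; rewrite gt_eqF.
  exact: sqr_ge0.
have := ag b v; have := ag b' u'; have := sqr_ge0 (b * v - u' * b').
set e := rho ^- 2; set e' := rho ^+ 2.
have -> : (b * v - u' * b') ^+ 2 = b ^+ 2 * v ^+ 2 + b' ^+ 2 * u' ^+ 2 - 2 * (b * v * (u' * b')) by ring.
have -> : (b * v + u' * b') ^+ 2 = b ^+ 2 * v ^+ 2 + b' ^+ 2 * u' ^+ 2 + 2 * (b * v * (u' * b')) by ring.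
lra.
Qed.

Lemma expect_var_le (f : seq (nat * nat) -> R) n a :
  EE n (fun h => (f h - EE n f) ^+ 2) <= EE n (fun h => (f h - a) ^+ 2).
Proof.
set e := EE n f.
have -> : EE n (fun h => (f h - a) ^+ 2) = EE n (fun h => (f h - e) ^+ 2 +
    (2 * (e - a) * f h + ((e - a) ^+ 2 - 2 * (e - a) * e))).
  by apply: (expect_eq A2P) => h _ _; ring.
rewrite (expectD A2P) (expectD A2P) (expectZ A2P) (expect_cst A2P) -/e subrKC lerDl.
exact: sqr_ge0.
Qed.

(** The level [L] is fixed first, to make the truncation error small uniformly in [n]; the
    bounded-difference variance, of order L^6/n, then vanishes as [n] grows. *)
Lemma Gam_concentration x y eta : admissible x -> admissible y -> 0 < eta ->
  \forall n \near \oo, EE n (fun h => (Gam alpha x y h - EE n (Gam alpha x y)) ^+ 2) <= eta.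
Proof.
move=> xP yP eta0.
pose K := K1 + K0 R; have KK : 0 <= K by rewrite addr_ge0 ?K1_ge0 ?K0_ge0.
pose d := eta / (8 * (K + 1)).
have d0 : 0 < d by rewrite divr_gt0 // mulr_gt0 // ltr_wpDl.
have [L hL] : exists L, 2 * gratio (R := R) 2^-1 (3 / 4) L.+1 ^+ 2 * K <= eta / 4.
  have e0 : 0 < Num.min d 1 by rewrite lt_min d0 ltr01.
  have := @gratio_cvg0 R 2^-1 (3 / 4) _ _ _ _ e0.
  case=> [||| L _ /(_ L (leqnn L)) /= hL]; try lra.
  exists L; move: hL; rewrite le_min => /andP[h1 h2].
  have g0 : 0 <= gratio (R := R) 2^-1 (3 / 4) L.+1 by rewrite ltW // gratio_gt0 //; lra.
  set g := gratio _ _ _ in g0 h1 h2 *.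
  have g2 : g ^+ 2 <= d by rewrite expr2 -[leRHS]mulr1 ler_pM.
  have : g ^+ 2 * (K + 1) <= eta / 8.
    rewrite -ler_pdivlMr ?ltr_wpDl //; apply: (le_trans g2).
    by rewrite /d invfM mulrA.
  have := sqr_ge0 g; nra.
pose B : R := 16 * L%:R ^+ 3; have B0 : 0 <= B by rewrite mulr_ge0 // exprn_ge0.
have := nbhs_infty_ger (4 * B ^+ 2 / eta); apply: filterS => n hn.
apply: le_trans (expect_var_le _ _ (EE n (Gam_small L x y))) _.
apply: le_trans (_ : EE n (fun h => 2 * (Gam alpha x y h - Gam_small L x y h) ^+ 2 +
   2 * (Gam_small L x y h - EE n (Gam_small L x y)) ^+ 2) <= _).
  apply: (expect_le A2P) => h _ _; apply: le_trans (sqr_addr_le _ _).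
  by rewrite addrA subrK.
rewrite (expectD A2P) !(expectZ A2P).
have h1 := Gam_trunc L n xP yP; have h2 := Gam_small_var L n xP yP.
have h3 : n%:R * (B / n.+1%:R) ^+ 2 <= eta / 4.
  have m0 : 0 < (n.+1%:R : R) by rewrite ltr0n.
  have hm : 4 * B ^+ 2 / eta <= n.+1%:R :> R by apply: le_trans hn _; rewrite ler_nat.
  apply: le_trans (_ : n.+1%:R * (B / n.+1%:R) ^+ 2 <= _).
    by rewrite ler_wpM2r ?sqr_ge0 // ler_nat.
  have -> : n.+1%:R * (B / n.+1%:R) ^+ 2 = B ^+ 2 / n.+1%:R :> R by field; rewrite addrC natr1 gt_eqF.
  have : 4 * B ^+ 2 <= n.+1%:R * eta by rewrite -ler_pdivrMr.
  rewrite ler_pdivrMr //; lra.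
have := le_trans h1 hL; have := le_trans h2 h3; lra.
Qed.

End Concentration.

(** * Asymptotic Isserlis formula for fourth moments *)

Section Isserlis.
Local Open Scope classical_set_scope.
Variables (R : realType) (alpha : R).
Hypothesis alpha01 : 0 <= alpha <= 1.
Implicit Types (n m : nat) (h : seq (nat * nat)) (c : nat * nat) (x y z w : bool * R).
Let A2P := avg2P alpha01.
Notation EE := (expect (avg2 alpha)).
Notation av n := (avg2 alpha n.+1).

Definition cov x y n : R := EE n (fun h => X x h * X y h).
Definition gam x y n : R := EE n (Gam alpha x y).
(** Error terms of the fourth moment recursion: [pair_dev] measures how far [Gam] is from being
    deterministic, [triple_mean] comes from the conditional third moments of the increments. *)
Definition pair_dev x y z w n : R :=
  EE n (fun h => X x h * X y h * Gam alpha z w h) - cov x y n * gam z w n.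
Definition triple_mean x y z w n : R :=
  EE n (fun h => X x h * av n (fun s => xi y h s * xi z h s * xi w h s)).

Lemma covS x y n :
  cov x y n.+1 = (1 + x.2 / n.+1%:R) * (1 + y.2 / n.+1%:R) * cov x y n + gam x y n.
Proof.
rewrite /cov EES // -(expectZ A2P) -(expectD A2P); apply: (expect_eq A2P) => h hn _.
exact: avg2_XX.
Qed.

Lemma avg2_quad n (a b c d : R) (f g h k : nat * nat -> R) :
  av n f = 0 -> av n g = 0 -> av n h = 0 -> av n k = 0 ->
  av n (fun s => (a + f s) * (b + g s) * ((c + h s) * (d + k s))) =
  a * b * c * d +
  (a * b * av n (fun s => h s * k s) + a * c * av n (fun s => g s * k s) +
   a * d * av n (fun s => g s * h s) + b * c * av n (fun s => f s * k s) +
   b * d * av n (fun s => f s * h s) + c * d * av n (fun s => f s * g s)) +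
  (a * av n (fun s => g s * h s * k s) + b * av n (fun s => f s * h s * k s) +
   c * av n (fun s => f s * g s * k s) + d * av n (fun s => f s * g s * h s)) +
  av n (fun s => f s * g s * (h s * k s)).
Proof.
move=> f0 g0 h0 k0.
rewrite -[LHS]addr0 -[X in _ + X](mulr0 (- (b * c * d))) -f0.
rewrite -[LHS]addr0 -[X in _ + X](mulr0 (- (a * c * d))) -g0.
rewrite -[LHS]addr0 -[X in _ + X](mulr0 (- (a * b * d))) -h0.
rewrite -[LHS]addr0 -[X in _ + X](mulr0 (- (a * b * c))) -k0.
rewrite -[in RHS](exp_cst A2P n (a * b * c * d)) -!(expZ A2P) -!(expD A2P).
by apply: (exp_eq A2P) => s _; ring.
Qed.

Lemma avg2_norm n (f : nat * nat -> R) : `|av n f| <= av n (fun c => `|f c|).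
Proof. exact: (exp_norm A2P). Qed.

Lemma sqr_mul_le (a b : R) : a ^+ 2 * b ^+ 2 <= a ^+ 4 + b ^+ 4.
Proof.
have := sqr_ge0 (a ^+ 2 - b ^+ 2); have := sqr_ge0 (a ^+ 2 + b ^+ 2).
by rewrite sqrrB sqrrD -!exprM; lra.
Qed.

Lemma mul4_le (a b c d : R) : `|a * b * (c * d)| <= 4^-1 * (a ^+ 4 + b ^+ 4 + (c ^+ 4 + d ^+ 4)).
Proof.
have h1 (s t : R) : s * t <= 2^-1 * (s ^+ 2 + t ^+ 2).
  by have := sqr_ge0 (s - t); rewrite sqrrB; lra.
have := h1 `|a * b| `|c * d|; rewrite -normrM !real_normK ?num_real // !exprMn.
have := h1 (a ^+ 2) (b ^+ 2); have := h1 (c ^+ 2) (d ^+ 2); rewrite -!exprM; lra.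
Qed.

Lemma expect_quad x y z w n : admissible x -> admissible y -> admissible z -> admissible w ->
  `|EE n (fun h => av n (fun s => xi x h s * xi y h s * (xi z h s * xi w h s)))| <= K0 R.
Proof.
move=> xP yP zP wP; apply: le_trans (expect_norm A2P _ _) _.
have -> : K0 R = 4^-1 * (K0 R + K0 R + (K0 R + K0 R)) by field.
apply: le_trans (ler_wpM2l _ (lerD
  (lerD (expect_xi4 alpha01 n xP) (expect_xi4 alpha01 n yP))
  (lerD (expect_xi4 alpha01 n zP) (expect_xi4 alpha01 n wP)))) => //.
rewrite -!(expectD A2P) -(expectZ A2P); apply: (expect_le A2P) => h hn _.
apply: le_trans (avg2_norm _ _) _; rewrite -!(expD A2P) -(expZ A2P).
by apply: (exp_le A2P) => c _; exact: mul4_le.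
Qed.

(** [X] is of order sqrt m and the increments have bounded fourth moments, so the true order is sqrt
    m. Young's inequality with weights [t] and [m] replaces Hoelder's. *)
Lemma expect_triple x y z w eta : admissible x -> admissible y -> admissible z -> admissible w ->
  0 < eta -> \forall n \near \oo,
  `|triple_mean x y z w n| <= eta * n.+1%:R.
Proof.
rewrite /triple_mean.
move=> xP yP zP wP eta0; have [C C0 hC] := X4_growth alpha01 xP.
pose K := K0 R; have KK : 0 <= K := K0_ge0 R.
pose t := 2 * eta / (C + K + 1).
have t0 : 0 < t by rewrite divr_gt0 ?mulr_gt0 // ltr_wpDl // addr_ge0.
have := nbhs_infty_ger (K / t / eta); apply: filterS2 hC => n hC hn.
have m0 : 0 < (n.+1%:R : R) by rewrite ltr0n.
have hm : K / t / eta <= n.+1%:R :> R by apply: le_trans hn _; rewrite ler_nat.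
set m : R := n.+1%:R in m0 hm hC *.
apply: le_trans (expect_norm A2P _ _) _.
apply: le_trans (_ : EE n (fun h => t / 4 * (m^-1 * X x h ^+ 4 +
   m * av n (fun s => xi y h s ^+ 4)) + (4 * t)^-1 * (av n (fun s => xi z h s ^+ 4) +
   av n (fun s => xi w h s ^+ 4))) <= _).
  apply: (expect_le A2P) => h _ _; set a := X x h.
  rewrite -(expZ A2P); apply: le_trans (avg2_norm _ _) _.
  rewrite -[m^-1 * _](exp_cst A2P n) -!(expZ A2P) -!(expD A2P) -!(expZ A2P) -!(expD A2P).
  apply: (exp_le A2P) => s _; set b := xi y h s; set c := xi z h s; set d := xi w h s.
  have h1 : 2 * `|a * b * (c * d)| <= t * (a ^+ 2 * b ^+ 2) + t^-1 * (c ^+ 2 * d ^+ 2).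
    rewrite -subr_ge0.
    have -> : t * (a ^+ 2 * b ^+ 2) + t^-1 * (c ^+ 2 * d ^+ 2) - 2 * `|a * b * (c * d)| =
       t^-1 * (t * `|a * b| - `|c * d|) ^+ 2.
      rewrite normrM -!exprMn -[(a * b) ^+ 2]real_normK ?num_real //.
      by rewrite -[(c * d) ^+ 2]real_normK ?num_real //; field; rewrite gt_eqF.
    by rewrite mulr_ge0 ?sqr_ge0 // invr_ge0 ltW.
  have h2 : 2 * (a ^+ 2 * b ^+ 2) <= m^-1 * a ^+ 4 + m * b ^+ 4.
    rewrite -subr_ge0.
    have -> : m^-1 * a ^+ 4 + m * b ^+ 4 - 2 * (a ^+ 2 * b ^+ 2) =
       m^-1 * (a ^+ 2 - m * b ^+ 2) ^+ 2 by field; rewrite gt_eqF.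
    by rewrite mulr_ge0 ?sqr_ge0 // invr_ge0 ltW.
  have h3 : 2 * (c ^+ 2 * d ^+ 2) <= c ^+ 4 + d ^+ 4.
    by have := sqr_ge0 (c ^+ 2 - d ^+ 2); rewrite sqrrB -!exprM; lra.
  have -> : a * (b * c * d) = a * b * (c * d) by ring.
  have := ler_wpM2l (ltW t0) h2; have ti : 0 <= t^-1 by rewrite invr_ge0 ltW.
  have := ler_wpM2l ti h3; have -> : (4 * t)^-1 = 4^-1 * t^-1 by rewrite invfM.
  set u := t^-1 in ti h1 *; set e1 := m^-1 * a ^+ 4 + m * b ^+ 4; set e2 := c ^+ 4 + d ^+ 4.
  lra.
rewrite (expectD A2P) (expectZ A2P n (t / 4)) (expectZ A2P n (4 * t)^-1).
have hx : m^-1 * EE n (fun h => X x h ^+ 4) <= C * m.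
  by rewrite ler_pdivrMl //; apply: le_trans hC _; rewrite expr2 mulrCA.
have hy := ler_wpM2l (ltW m0) (expect_xi4 alpha01 n yP).
have hxy : EE n (fun h => m^-1 * X x h ^+ 4 + m * av n (fun s => xi y h s ^+ 4)) <= C * m + m * K.
  by rewrite (expectD A2P) (expectZ A2P n m^-1) (expectZ A2P n m); exact: lerD.
have hz : EE n (fun h => av n (fun s => xi z h s ^+ 4) + av n (fun s => xi w h s ^+ 4)) <= K + K.
  by rewrite (expectD A2P); exact: lerD (expect_xi4 alpha01 n zP) (expect_xi4 alpha01 n wP).
have t4 : 0 <= t / 4 by rewrite divr_ge0 // ltW.
have t4' : 0 <= (4 * t)^-1 by rewrite invr_ge0 mulr_ge0 // ltW.
apply: le_trans (lerD (ler_wpM2l t4 hxy) (ler_wpM2l t4' hz)) _.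
have e1 : t / 4 * (C * m + m * K) <= eta / 2 * m.
  have -> : t / 4 * (C * m + m * K) = t * (C + K) / 4 * m by field.
  rewrite ler_wpM2r ?(ltW m0) // ler_pdivrMr //.
  apply: le_trans (_ : t * (C + K + 1) <= _); first by rewrite ler_wpM2l ?(ltW t0) // lerDl.
  by rewrite /t divfK; [lra|rewrite gt_eqF // ltr_wpDl // addr_ge0].
have e2 : (4 * t)^-1 * (K + K) <= eta / 2 * m.
  have -> : (4 * t)^-1 * (K + K) = (K / t / eta) * (eta / 2) by field; rewrite !gt_eqF.
  by rewrite mulrC ler_wpM2l // divr_ge0 // ltW.
lra.
Qed.

(** Cauchy--Schwarz: the product of the two X has second moment O(m^2), and the variance of [Gam]
    tends to 0. *)
Lemma expect_pair x y z w eta : admissible x -> admissible y -> admissible z -> admissible w ->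
  0 < eta -> \forall n \near \oo,
  `|pair_dev x y z w n| <= eta * n.+1%:R.
Proof.
rewrite /pair_dev.
move=> xP yP zP wP eta0.
have [C C0 hC] := X4_growth alpha01 xP; have [D D0 hD] := X4_growth alpha01 yP.
pose t := eta ^+ 2 / (C + D + 1).
have CD : 0 < C + D + 1 by rewrite ltr_wpDl // addr_ge0.
have t0 : 0 < t by rewrite divr_gt0 ?exprn_gt0.
have hG := Gam_concentration alpha01 zP wP t0.
near=> n.
have hx : EE n (fun h => X x h ^+ 4) <= C * n.+1%:R ^+ 2 by near: n.
have hy : EE n (fun h => X y h ^+ 4) <= D * n.+1%:R ^+ 2 by near: n.
have hg : EE n (fun h => (Gam alpha z w h - gam z w n) ^+ 2) <= t by near: n.
have m0 : 0 < (n.+1%:R : R) by rewrite ltr0n.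
set m : R := n.+1%:R in m0 hx hy *.
have -> : EE n (fun h => X x h * X y h * Gam alpha z w h) - cov x y n * gam z w n =
  EE n (fun h => X x h * X y h * (Gam alpha z w h - gam z w n)).
  rewrite /cov -(expectZr A2P) -(expectB A2P); apply: (expect_eq A2P) => h _ _; ring.
rewrite -(@ler_pXn2r _ 2) ?nnegrE ?mulr_ge0 ?(ltW m0) ?(ltW eta0) //.
rewrite real_normK ?num_real //; apply: le_trans (expect_CS A2P _ _ _) _.
have hxy : EE n (fun h => (X x h * X y h) ^+ 2) <= (C + D) * m ^+ 2.
  rewrite mulrDl; apply: le_trans (lerD hx hy); rewrite -(expectD A2P).
  apply: (expect_le A2P) => h _ _; rewrite exprMn.
  exact: sqr_mul_le.
have p0 : 0 <= EE n (fun h => (X x h * X y h) ^+ 2).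
  by apply: (expect_ge0 A2P) => h _ _; exact: sqr_ge0.
have q0 : 0 <= EE n (fun h => (Gam alpha z w h - gam z w n) ^+ 2).
  by apply: (expect_ge0 A2P) => h _ _; exact: sqr_ge0.
apply: le_trans (ler_pM p0 q0 hxy hg) _.
rewrite exprMn mulrAC ler_wpM2r ?sqr_ge0 // /t mulrCA mulrC.
by rewrite ler_piMl ?sqr_ge0 // ler_pdivrMr // mul1r lerDl.
Unshelve. all: by end_near. Qed.

Lemma prod4_le (i s1 s2 s3 s4 : R) : 0 <= i -> i <= 1 ->
  0 <= s1 <= 2^-1 * i -> 0 <= s2 <= 2^-1 * i -> 0 <= s3 <= 2^-1 * i -> 0 <= s4 <= 2^-1 * i ->
  (1 + s1) * (1 + s2) * ((1 + s3) * (1 + s4)) <= 1 + (s1 + s2 + s3 + s4) + 3 * i ^+ 2.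
Proof.
move=> i0 i1 b1 b2 b3 b4.
have two a b : 0 <= a <= 2^-1 * i -> 0 <= b <= 2^-1 * i ->
    (1 + a) * (1 + b) <= 1 + (a + b) + 4^-1 * i ^+ 2.
  move=> /andP[a0 a1] /andP[c0 c1].
  have : a * b <= (2^-1 * i) * (2^-1 * i) by rewrite ler_pM.
  have -> : 2^-1 * i * (2^-1 * i) = 4^-1 * i ^+ 2 by field.
  lra.
apply: le_trans (ler_pM _ _ (two _ _ b1 b2) (two _ _ b3 b4)) _; [nra|nra|].
have i2 : 0 <= i ^+ 2 by rewrite sqr_ge0.
have i21 : i ^+ 2 <= 1 by rewrite exprn_ile1.
have u0 : 0 <= s1 + s2 <= i by lra.
have v0 : 0 <= s3 + s4 <= i by lra.
rewrite -[s1 + s2 + s3 + s4]addrA.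
move: (s1 + s2) (s3 + s4) u0 v0 => u v /andP[u0 u1] /andP[v0 v1].
have uv : u * v <= i ^+ 2 by rewrite expr2 ler_pM.
move: (i ^+ 2) i2 i21 uv => q i2 i21 uv.
have uq : u * q <= q by rewrite ler_piMl // (le_trans u1).
have vq : v * q <= q by rewrite ler_piMl // (le_trans v1).
have qq : q * q <= q by rewrite ler_piMl.
lra.
Qed.

Definition cumulant x y z w n : R := EE n (fun h => X x h * X y h * (X z h * X w h)) -
  (cov x y n * cov z w n + cov x z n * cov y w n + cov x w n * cov y z n).

(** In the recursion of the cumulant the products of a covariance with a [gam] cancel against those
    from [covS]. What remains is the rate [a], the sum of the exponents, which is below 2, and a
    source term o(m); [growth] then gives o(m^2). *)
Lemma isserlis x y z w eta : admissible x -> admissible y -> admissible z -> admissible w ->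
  0 < eta -> \forall n \near \oo, `|cumulant x y z w n| <= eta * n.+1%:R ^+ 2.
Proof.
move=> xP yP zP wP eta0.
have /andP[lx0 lx1] := xP; have /andP[ly0 ly1] := yP.
have /andP[lz0 lz1] := zP; have /andP[lw0 lw1] := wP.
pose a := x.2 + y.2 + z.2 + w.2.
have a2 : 0 < 2%:R - a by rewrite /a; lra.
pose c := eta * (2%:R - a) / 4; have c0 : 0 < c by rewrite divr_gt0 ?mulr_gt0.
suff : \forall n \near \oo, `|cumulant x y z w n| <=
   (2 * c / (2%:R - a) + eta / 2) * n.+1%:R ^+ 2.
  apply: filterS => n; have -> // : 2 * c / (2%:R - a) + eta / 2 = eta.
  by rewrite /c; field; rewrite gt_eqF.
apply: (@growth R (fun n => `|cumulant x y z w n|) 2 a 3 c) => //.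
- by rewrite /a; apply/andP; split; lra.
- exact: ltW.
- by rewrite divr_gt0.
(* Six pair terms with factor at most 4, four triple terms with factor at most 2 and the bounded
   rest use 24 + 8 + 1 of the 40 portions. *)
pose e := c / 40; have e0 : 0 < e by rewrite divr_gt0.
have N1 := nbhs_infty_ger ((K0 R + 3 * (1 + K0 R) ^+ 2) / e).
near=> n.
have P1 : `|pair_dev x y z w n| <= e * n.+1%:R by near: n; exact: expect_pair.
have P2 : `|pair_dev x z y w n| <= e * n.+1%:R by near: n; exact: expect_pair.
have P3 : `|pair_dev x w y z n| <= e * n.+1%:R by near: n; exact: expect_pair.
have P4 : `|pair_dev y z x w n| <= e * n.+1%:R by near: n; exact: expect_pair.
have P5 : `|pair_dev y w x z n| <= e * n.+1%:R by near: n; exact: expect_pair.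
have P6 : `|pair_dev z w x y n| <= e * n.+1%:R by near: n; exact: expect_pair.
have T1 : `|triple_mean x y z w n| <= e * n.+1%:R by near: n; exact: expect_triple.
have T2 : `|triple_mean y x z w n| <= e * n.+1%:R by near: n; exact: expect_triple.
have T3 : `|triple_mean z x y w n| <= e * n.+1%:R by near: n; exact: expect_triple.
have T4 : `|triple_mean w x y z n| <= e * n.+1%:R by near: n; exact: expect_triple.
have hn : (K0 R + 3 * (1 + K0 R) ^+ 2) / e <= n%:R by near: n.
have m0 : 0 < (n.+1%:R : R) by rewrite ltr0n.
have m1 : 1 <= (n.+1%:R : R) by rewrite ler1n.
rewrite expr1; set m : R := n.+1%:R in m0 m1 *.
have hm : (K0 R + 3 * (1 + K0 R) ^+ 2) / e <= m.
  by apply: le_trans hn _; rewrite ler_nat.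
pose r (v : bool * R) := 1 + v.2 / m.
have r0 v : admissible v -> 0 <= r v <= 2.
  move=> /andP[v0 v1]; rewrite /r; have : 0 <= v.2 / m <= 1.
    by rewrite divr_ge0 ?(ltW m0) //= ler_pdivrMr // mul1r; lra.
  by set u := v.2 / m; lra.
pose P x y z w := pair_dev x y z w n; pose T x y z w := triple_mean x y z w n.
pose F := EE n (fun h => av n (fun s => xi x h s * xi y h s * (xi z h s * xi w h s))).
have key : cumulant x y z w n.+1 = r x * r y * (r z * r w) * cumulant x y z w n +
  (r x * r y * P x y z w + r x * r z * P x z y w + r x * r w * P x w y z +
   r y * r z * P y z x w + r y * r w * P y w x z + r z * r w * P z w x y) +
  (r x * T x y z w + r y * T y x z w + r z * T z x y w + r w * T w x y z) +
  (F - (gam x y n * gam z w n + gam x z n * gam y w n + gam x w n * gam y z n)).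
  rewrite /cumulant !covS -/(r x) -/(r y) -/(r z) -/(r w) EES //.
  have -> : EE n (fun h => av n (fun s => X x (s :: h) * X y (s :: h) * (X z (s :: h) * X w (s :: h)))) =
    r x * r y * (r z * r w) * EE n (fun h => X x h * X y h * (X z h * X w h)) +
   (r x * r y * EE n (fun h => X x h * X y h * Gam alpha z w h) +
    r x * r z * EE n (fun h => X x h * X z h * Gam alpha y w h) +
    r x * r w * EE n (fun h => X x h * X w h * Gam alpha y z h) +
    r y * r z * EE n (fun h => X y h * X z h * Gam alpha x w h) +
    r y * r w * EE n (fun h => X y h * X w h * Gam alpha x z h) +
    r z * r w * EE n (fun h => X z h * X w h * Gam alpha x y h)) +
   (r x * T x y z w + r y * T y x z w + r z * T z x y w + r w * T w x y z) + F.
    rewrite /T /triple_mean /F -!(expectZ A2P) -!(expectD A2P); apply: (expect_eq A2P) => h sh _.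
    have h0 v : av n (fun s => xi v h s) = 0 by rewrite -sh avg2_xi.
    have := @avg2_quad n (r x * X x h) (r y * X y h) (r z * X z h) (r w * X w h)
       _ _ _ _ (h0 x) (h0 y) (h0 z) (h0 w).
    have XE v s : X v (s :: h) = r v * X v h + xi v h s by rewrite XS sh.
    rewrite (_ : (fun s => _) = (fun s => X x (s :: h) * X y (s :: h) * (X z (s :: h) * X w (s :: h)))).
      by move=> ->; rewrite /Gam sh; ring.
    by apply/funext => s; rewrite !XE.
  by rewrite /P /pair_dev; ring.
have hP p q s t : admissible p -> admissible q -> admissible s -> admissible t ->
    `|P p q s t| <= e * m -> `|r p * r q * P p q s t| <= 4 * (e * m).
  move=> /r0/andP[p0 p1] /r0/andP[q0 q1] _ _ hb.
  rewrite normrM ger0_norm ?mulr_ge0 // ler_pM ?mulr_ge0 //.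
  have -> : 4 = 2 * 2 :> R by ring.
  by rewrite ler_pM.
have hT p q s t : admissible p -> `|T p q s t| <= e * m -> `|r p * T p q s t| <= 2 * (e * m).
  by move=> /r0/andP[p0 p1] hb; rewrite normrM ger0_norm // ler_pM.
move/hP: P1 => /(_ xP yP zP wP) P1.
move/hP: P2 => /(_ xP zP yP wP) P2.
move/hP: P3 => /(_ xP wP yP zP) P3.
move/hP: P4 => /(_ yP zP xP wP) P4.
move/hP: P5 => /(_ yP wP xP zP) P5.
move/hP: P6 => /(_ zP wP xP yP) P6.
move/hT: T1 => /(_ xP) T1.
move/hT: T2 => /(_ yP) T2.
move/hT: T3 => /(_ zP) T3.
move/hT: T4 => /(_ wP) T4.
have hF : `|F| <= K0 R by exact: expect_quad.
have hg p q s t : admissible p -> admissible q -> admissible s -> admissible t ->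
    `|gam p q n * gam s t n| <= (1 + K0 R) ^+ 2.
  by move=> pP qP sP tP; rewrite normrM expr2 ler_pM // Gam_mean.
have G1 := hg x y z w xP yP zP wP; have G2 := hg x z y w xP zP yP wP.
have G3 := hg x w y z xP wP yP zP.
have hK : K0 R + 3 * (1 + K0 R) ^+ 2 <= m * e by rewrite -ler_pdivrMr.
have ecm : 40 * (e * m) = c * m by rewrite /e; field.
have hr : r x * r y * (r z * r w) <= 1 + a / m + 3 / m ^+ 2.
  have i0 : 0 <= m^-1 by rewrite invr_ge0 ltW.
  have i1 : m^-1 <= 1 by rewrite invf_le1.
  have hb v : admissible v -> 0 <= v.2 / m <= 2^-1 / m.
    by move=> /andP[v0 /ltW v1]; rewrite mulr_ge0 //= ler_wpM2r.
  have -> : a / m = x.2 / m + y.2 / m + z.2 / m + w.2 / m by rewrite /a !mulrDl.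
  by rewrite -exprVn; apply: prod4_le => //; exact: hb.
rewrite key.
have rr : 0 <= r x * r y * (r z * r w).
  by rewrite !mulr_ge0 //; [have /andP[] := r0 x xP|have /andP[] := r0 y yP|have /andP[] := r0 z zP|have /andP[] := r0 w wP].
have main : `|r x * r y * (r z * r w) * cumulant x y z w n| <=
    (1 + a / m + 3 / m ^+ 2) * `|cumulant x y z w n|.
  by rewrite normrM ger0_norm // ler_wpM2r.
apply: le_trans (_ : `|r x * r y * (r z * r w) * cumulant x y z w n| + c * m <= _); last first.
  by rewrite lerD2r.
rewrite -ecm; move: P1 P2 P3 P4 P5 P6 T1 T2 T3 T4 hF G1 G2 G3; rewrite !ler_norml.
move=> /andP[? ?] /andP[? ?] /andP[? ?] /andP[? ?] /andP[? ?] /andP[? ?].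
move=> /andP[? ?] /andP[? ?] /andP[? ?] /andP[? ?] /andP[? ?] /andP[? ?] /andP[? ?] /andP[? ?].
set M := _ * cumulant x y z w n.
have := ler_norm M; have := ler_norm (- M); rewrite normrN.
lra.
Unshelve. all: by end_near. Qed.

End Isserlis.

(** * Growth of the cross covariance in alpha *)

Section Gap.
Local Open Scope classical_set_scope.
Variable R : realType.
Implicit Types (n m i k : nat) (h : seq (nat * nat)) (alpha beta l eta : R).
Let AP := @avgP R.

Lemma grate_sublinear l eta : 0 <= l < 1 -> 0 < eta ->
  \forall n \near \oo, grate l n.+1 <= eta * n.+1%:R.
Proof.
move=> /andP[l0 l1] eta0.
suff : \forall n \near \oo, grate l n.+1 <= (2 * 0 / (1%:R - l) + eta) * n.+1%:R ^+ 1.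
  by apply: filterS => n; rewrite mulr0 mul0r add0r expr1.
apply: (@growth R (fun n => grate l n.+1) 1 l 0 0) => //.
- by rewrite l0.
- by move=> n; rewrite (le_trans ler01) // grate_ge1.
- by apply: nearW => n; rewrite (grateS l (ltn0Sn n)) !mul0r !addr0 mulrC.
Qed.

Definition meanA l n i : R := expect (@avg R) n (fun p => A l p i).

(** A step costs at most the factor n/(n+1), and the product telescopes. *)
Lemma meanA_ge l n i : 0 <= l <= 1 -> (i <= n)%N -> i%:R / n%:R * meanA l i i <= meanA l n i.
Proof.
move=> l01; elim: n => [|n IH].
  rewrite leqn0 => /eqP ->; rewrite mul0r mul0r; apply: (expect_ge0 AP) => p _ _.
  by apply: A_ge0; case/andP: l01.
rewrite leq_eqVlt => /orP[/eqP ->|]; first by rewrite divff ?mul1r // pnatr_eq0.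
rewrite ltnS => iN; apply: le_trans (expect_A_old l01 iN); rewrite -/(meanA l n i).
have [n0|n0] := eqVneq n 0%N.
  by move: iN; rewrite n0 leqn0 => /eqP ->; rewrite !mul0r.
have nR : (n%:R : R) != 0 by rewrite pnatr_eq0.
have -> : i%:R / n.+1%:R * meanA l i i = n%:R / n.+1%:R * (i%:R / n%:R * meanA l i i).
  by field; rewrite nR addrC natr1 pnatr_eq0.
by rewrite ler_wpM2l ?divr_ge0 // IH.
Qed.

Lemma mean_le l n : 0 <= l < 1 -> mean l n / n.+1%:R <= (1 - l)^-1.
Proof.
move=> /andP[l0 l1]; rewrite meanE ?lt_eqF // ler_pdivrMr ?ltr0n // mulrC.
rewrite ler_wpM2l ?invr_ge0 ?subr_ge0 ?(ltW l1) //.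
by rewrite gerBl mulr_ge0 // (le_trans ler01) // grate_ge1.
Qed.

Lemma mean_near l eta : 0 <= l <= 2^-1 -> 0 < eta ->
  \forall n \near \oo, (1 - l)^-1 - eta <= mean l n / n.+1%:R.
Proof.
move=> /andP[l0 l1] eta0; have l01 : 0 <= l < 1 by rewrite l0; lra.
have := grate_sublinear l01 eta0; apply: filterS => n hn.
have m0 : 0 < (n.+1%:R : R) by rewrite ltr0n.
have e0 : 0 < 1 - l by lra.
rewrite meanE; last by rewrite lt_eqF //; lra.
have -> : (n.+1%:R - l * grate l n.+1) / (1 - l) / n.+1%:R =
  (1 - l)^-1 - l / (1 - l) * (grate l n.+1 / n.+1%:R).
  by field; rewrite addrC natr1 !gt_eqF.
rewrite lerD2l lerN2; set g := grate l n.+1 in hn *.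
have g0 : 0 <= g / n.+1%:R by rewrite divr_ge0 // (le_trans ler01) // grate_ge1.
have gn : g / n.+1%:R <= eta by rewrite ler_pdivrMr.
have lq : l / (1 - l) <= 1 by rewrite ler_pdivrMr // mul1r; lra.
by rewrite -[leRHS]mul1r ler_pM // divr_ge0 // ltW.
Qed.

Lemma avg_meanA l n : avg n.+1 (meanA l n) = mean l n / n.+1%:R.
Proof.
rewrite -(expect_avg AP) /mean -(expectZr AP); apply: (expect_eq AP) => p pn _.
by have := avg_A l p; rewrite pn => <-.
Qed.

(* A node of label [i] close to [n] has few descendants, so that its expected [A] exceeds
   the average [1 / (1 - l)] by a constant. *)
Lemma meanA_var l : 0 <= l <= 2^-1 -> \forall n \near \oo,
  2 * 10^-1 ^+ 3 <= avg n.+1 (fun i => meanA l n i ^+ 2) - (mean l n / n.+1%:R) ^+ 2.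
Proof.
move=> /andP[l0 l1]; have l01 : 0 <= l <= 1 by rewrite l0; lra.
have l01' : 0 <= l < 1 by rewrite l0; lra.
have e0 : 0 < 1 - l by lra.
pose b := (1 - l)^-1; have bE : b * (1 - l) = 1 by rewrite mulVf // gt_eqF.
have b2 : b <= 2.
  by rewrite -(ler_pM2r e0) bE; lra.
have l02 : 0 <= l <= 2^-1 by rewrite l0.
have e40 : 0 < 40^-1 :> R by rewrite invr_gt0.
have [N _ hN] := mean_near l02 e40.
have newA k : (N < k)%N -> b + 9 / 20 <= meanA l k k.
  case: k => // k; rewrite ltnS => /(hN k) /= hk.
  apply: le_trans (expect_A_new k l01).
  have c0 : 0 <= (1 + l) / 2 by lra.
  have := ler_wpM2l c0 hk.
  set q := mean l k / _; rewrite -/b; nra.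
near=> n.
have n0 : (0 < n)%N by near: n; exact: nbhs_infty_gt.
have nN : (10 * N.+1 <= n)%N by near: n; exact: nbhs_infty_ge.
have -> : avg n.+1 (fun i => meanA l n i ^+ 2) - (mean l n / n.+1%:R) ^+ 2 =
  avg n.+1 (fun i => (meanA l n i - mean l n / n.+1%:R) ^+ 2).
  by rewrite -avg_meanA [in LHS]expr2 -avg_var.
(* On the last tenth of the labels the deviation is at least 9/10 (b + 9/20) - b >= 1/5, as b <= 2.
   These labels are at least a twentieth of all, and 1/25 * 1/20 = 2 * 10^-3. *)
pose k := ((9 * n) %/ 10).+1.
have kn : (k <= n.+1)%N by rewrite /k; lia.
rewrite /avg ler_pdivlMr ?ltr0n //.
rewrite -(big_mkord xpredT (fun i => (meanA l n i - mean l n / n.+1%:R) ^+ 2)).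
rewrite (big_cat_nat (leq0n k) kn) //= -[leLHS]add0r; apply: lerD.
  by apply: sumr_ge0 => i _; exact: sqr_ge0.
apply: le_trans (_ : \sum_(k <= i < n.+1) 25^-1 <= _); last first.
  apply: ler_sum_nat => i /andP[ki iN].
  have i9 : (9 * n <= 10 * i)%N by move: ki; rewrite /k; lia.
  have Ni : (N < i)%N by lia.
  have := meanA_ge l01 (iN : (i <= n)%N); have := newA i Ni; have := mean_le n l01'.
  set q := mean l n / _; set a := meanA l i i; set a' := meanA l n i; rewrite -/b => qb ba aa.
  have r9 : 9 / 10 <= i%:R / n%:R :> R.
    by rewrite ler_pdivlMr ?ltr0n // mulrAC ler_pdivrMr // -!natrM ler_nat [(i * _)%N]mulnC.
  have b0 : 0 < b by rewrite invr_gt0.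
  have h1 : 9 / 10 * (b + 9 / 20) <= i%:R / n%:R * a by rewrite ler_pM //; lra.
  have h2 : 5^-1 <= a' - q by lra.
  have -> : 25^-1 = 5^-1 ^+ 2 :> R by field.
  by rewrite lerXn2r ?nnegrE //; lra.
rewrite sumr_const_nat -[25^-1 *+ _]mulr_natr.
have : (n <= 10 * (n.+1 - k))%N by rewrite /k; lia.
rewrite -(ler_nat R) natrM => h1.
have : (n.+1 <= 2 * n)%N by lia.
rewrite -(ler_nat R) natrM => h2.
have -> : 2 * 10^-1 ^+ 3 = 25^-1 * 20^-1 :> R by field.
lra.
Unshelve. all: by end_near. Qed.

Definition Xt l (p : seq nat) : R := W l p - mean l (size p).

Lemma cov_noise alpha l n : cov alpha (false, l) (true, l) n = noise alpha n (Xt l).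
Proof. by congr (expect _ n _); apply/funext => h; rewrite /X /Xt /= !size_map. Qed.

Lemma expect_Xt l n : expect (@avg R) n (Xt l) = 0.
Proof.
rewrite (_ : expect _ n _ = expect (@avg R) n (fun p => W l p - mean l n)); last first.
  by apply: (expect_eq AP) => p pn _; rewrite /Xt pn.
by rewrite (expectB AP) (expect_cst AP) subrr.
Qed.

Lemma noise_W alpha l n : 0 <= alpha <= 1 ->
  noise alpha n (fun p => avg n.+1 (A l p)) =
  (noise alpha n (Xt l) + mean l n ^+ 2) / n.+1%:R ^+ 2.
Proof.
move=> a01; have KP := avg2P a01.
pose a := expect (avg2 alpha) n (fun h => Xt l (map (pick false) h)).
pose b := expect (avg2 alpha) n (fun h => Xt l (map (pick true) h)).
have a0 : a = 0 by rewrite /a (expect_tree alpha false n (Xt l)) expect_Xt.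
have b0 : b = 0 by rewrite /b (expect_tree alpha true n (Xt l)) expect_Xt.
have -> : noise alpha n (Xt l) + mean l n ^+ 2 =
  noise alpha n (Xt l) + (mean l n * a + (mean l n * b + mean l n ^+ 2)).
  by rewrite a0 b0 !mulr0 !add0r.
rewrite /noise /a /b -[mean l n ^+ 2](expect_cst KP n).
rewrite -(expectZ KP n (mean l n) (fun h => Xt l (map (pick false) h))).
rewrite -(expectZ KP n (mean l n) (fun h => Xt l (map (pick true) h))).
rewrite -!(expectD KP) -(expectZr KP); apply: (expect_eq KP) => h hn _.
have e c : avg n.+1 (A l (map (pick c) h)) = (Xt l (map (pick c) h) + mean l n) / n.+1%:R.
  by have := avg_A l (map (pick c) h); rewrite /Xt size_map hn subrK => <-.
by rewrite !e; field; rewrite addrC natr1 pnatr_eq0.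
Qed.

(** An independent choice contributes nothing, since the increments are centered in each tree; only
    the aligned choice remains, with weight [alpha]. *)
Lemma gam_noise alpha l n : 0 <= alpha <= 1 ->
  gam alpha (false, l) (true, l) n = alpha * l ^+ 2 *
   (avg n.+1 (fun i => noise alpha n (fun p => A l p i)) -
    (noise alpha n (Xt l) + mean l n ^+ 2) / n.+1%:R ^+ 2).
Proof.
move=> a01; have KP := avg2P a01; rewrite -noise_W // /noise -(expect_avg KP).
rewrite -(expectB KP) -(expectZ KP); apply: (expect_eq KP) => h hn _.
rewrite /Gam /xi hn /=; set p := map _ h; set q := map _ h.
rewrite (avg_prod alpha n.+1 (fun i => l * (A l p i - avg n.+1 (A l p)))
   (fun i => l * (A l q i - avg n.+1 (A l q)))).
rewrite (expZ AP n.+1 l (fun i => A l p i - avg n.+1 (A l p))) (expB AP) (exp_cst AP) subrr mulr0 mul0r mulr0 addr0.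
rewrite -[RHS]mulrA; congr (_ * _); rewrite -avg_var -(expZ AP).
by apply: (exp_eq AP) => i _; ring.
Qed.

(** Half of the constant in [meanA_var], times l^2/4 at the smallest exponent l = 1/4. *)
Definition gap_cst : R := 10^-1 ^+ 3 * 8^-1 ^+ 2.

Lemma gap_cst_gt0 : 0 < gap_cst.
Proof. by rewrite /gap_cst mulr_gt0 // exprn_gt0 // invr_gt0. Qed.

(** The difference [d] of the covariances has growth rate 2l and a source of at least l^2 (beta -
    alpha) times a variance: [noise_ge] bounds the averaged form at [beta] below by the squared
    [meanA], and [meanA_var] leaves a constant after subtraction of the squared mean and of
    cov/m^2. *)
Lemma cov_gap alpha beta l : 0 <= alpha -> alpha < beta -> beta <= 1 -> 4^-1 <= l < 2^-1 ->
  \forall n \near \oo, gap_cst * (beta - alpha) / (1 - 2 * l) * n.+1%:R <=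
    cov beta (false, l) (true, l) n - cov alpha (false, l) (true, l) n.
Proof.
move=> a0 ab b1 /andP[l4 l2].
have a01 : 0 <= alpha <= 1 by rewrite a0; lra.
have b01 : 0 <= beta <= 1 by rewrite b1; lra.
have l0 : 0 <= l by lra.
pose c := cov beta (false, l) (true, l).
pose d n := c n - cov alpha (false, l) (true, l) n.
have d0 n : 0 <= d n by rewrite /d /c subr_ge0 !cov_noise noise_mono // ltW.
pose e := 1 - 2 * l; have e0 : 0 < e by rewrite /e; lra.
have [t tE] : exists t : R, t = 10^-1 ^+ 3 by exists (10^-1 ^+ 3).
have t0 : 0 < t by rewrite tE exprn_gt0 // invr_gt0.
pose s := l ^+ 2 * (beta - alpha) * t.
have s0 : 0 < s.
  rewrite /s; apply: mulr_gt0 => //; rewrite mulr_gt0 ?subr_gt0 // exprn_gt0 //; lra.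
have step : \forall n \near \oo, (1 + 2 * l / n.+1%:R) * d n + s <= d n.+1.
  have l02 : 0 <= l <= 2^-1 by rewrite l0 ltW.
  have h1 := meanA_var l02.
  have adm a : admissible (a, l) by rewrite /admissible /= l0.
  have h2 := XX_growth b01 (adm false) (adm true).
  pose C := 3 * (1 + K0 R) / (1 - l - l).
  have h3 := nbhs_infty_ger (C / t).
  near=> n.
  have hv : 2 * 10^-1 ^+ 3 <= avg n.+1 (fun i => meanA l n i ^+ 2) - (mean l n / n.+1%:R) ^+ 2.
    by near: n.
  have hc : `|cov beta (false, l) (true, l) n| <= C * n.+1%:R by near: n.
  have hn : C / t <= n%:R by near: n.
  have m0 : 0 < (n.+1%:R : R) by rewrite ltr0n.
  have hm : C <= n.+1%:R * t.
    by rewrite -ler_pdivrMr //; apply: le_trans hn _; rewrite ler_nat.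
  rewrite -tE in hv.
  set m : R := n.+1%:R in m0 hc hm hv *.
  rewrite /d /c !covS // !gam_noise // -/m -!cov_noise -/(c n).
  set Na := avg n.+1 (fun i => noise alpha n (fun p => A l p i)); set Nb := avg n.+1 (fun i => noise beta n (fun p => A l p i)).
  have NaNb : Na <= Nb by apply: (exp_le AP) => i _; apply: noise_mono => //; exact: ltW.
  have Nbv : avg n.+1 (fun i => meanA l n i ^+ 2) <= Nb.
    by apply: (exp_le AP) => i _; exact: noise_ge.
  have cm : c n / m ^+ 2 <= t.
    rewrite ler_pdivrMr ?exprn_gt0 //; apply: le_trans (ler_norm _) _; apply: le_trans hc _.
    by rewrite expr2 mulrA ler_wpM2r ?(ltW m0) // mulrC.
  rewrite /= -!/(c n).
  have := d0 n; rewrite {1}/d; set ca := cov alpha _ _ n; set mu := mean l n in hv *.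
  have -> : (ca + mu ^+ 2) / m ^+ 2 = ca / m ^+ 2 + (mu / m) ^+ 2 by rewrite mulrDl expr_div_n.
  have -> : (c n + mu ^+ 2) / m ^+ 2 = c n / m ^+ 2 + (mu / m) ^+ 2 by rewrite mulrDl expr_div_n.
  have -> : c n / m ^+ 2 = (c n) * m^-1 ^+ 2 by rewrite exprVn.
  have -> : ca / m ^+ 2 = ca * m^-1 ^+ 2 by rewrite exprVn.
  rewrite -exprVn in cm; move: cm.
  set i := m^-1; set v := (mu / m) ^+ 2 in hv *; set V := avg n.+1 _ in hv Nbv.
  move: (c n) i v V hv Nbv => cb i v V hv Nbv cm dn.
  rewrite -subr_ge0.
  have -> : (1 + l * i) * (1 + l * i) * cb + beta * l ^+ 2 * (Nb - (cb * i ^+ 2 + v)) -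
     ((1 + l * i) * (1 + l * i) * ca + alpha * l ^+ 2 * (Na - (ca * i ^+ 2 + v))) -
     ((1 + 2 * l * i) * (cb - ca) + s) =
    (1 - alpha) * (l ^+ 2 * i ^+ 2 * (cb - ca)) + alpha * (l ^+ 2 * (Nb - Na)) +
    l ^+ 2 * (beta - alpha) * (Nb - v - cb * i ^+ 2 - t) by rewrite /s; ring.
  have l20 : 0 <= l ^+ 2 by rewrite exprn_ge0.
  apply: addr_ge0; first apply: addr_ge0.
  - by apply: mulr_ge0; [lra|exact: mulr_ge0 (mulr_ge0 l20 (sqr_ge0 i)) dn].
  - by apply: mulr_ge0 => //; apply: mulr_ge0 => //; rewrite subr_ge0.
  - by apply: mulr_ge0; [apply: mulr_ge0 => //; lra|lra].
(* The sign turns the upper bound of [decay_limsup] into a lower one; replacing s by s/2 pays for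
   the passage from m to m + 1. *)
pose y n := - (d n / n.+1%:R).
have : \forall n \near \oo, y n <= (- (s / 2)) / e + s / (4 * e).
  apply: decay_limsup => //; first by rewrite divr_gt0 // mulr_gt0.
  apply: filterS step => n hn; rewrite /y.
  have m0 : 0 < (n.+1%:R : R) by rewrite ltr0n.
  have m1 : 1 <= (n.+1%:R : R) by rewrite ler1n.
  rewrite -[n.+2%:R](natr1 n.+1); set m : R := n.+1%:R in m0 m1 hn *.
  rewrite mulrN [- (s / 2) / _]mulNr -opprD lerN2.
  rewrite ler_pdivlMr; last by lra.
  apply: le_trans hn.
  have := d0 n; set D := d n => D0.
  have i0 : 0 < m^-1 by rewrite invr_gt0.
  have i1 : m^-1 <= 1 by rewrite invf_le1.
  have -> : ((1 - e / m) * (D / m) + s / 2 / m) * (m + 1) =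
    (1 + (1 - e) / m) * D - e * D * m^-1 ^+ 2 + s / 2 * (1 + m^-1) by field; rewrite gt_eqF.
  have -> : 1 - e = 2 * l by rewrite /e; ring.
  move: (m^-1) i0 i1 => i i0 i1.
  have := mulr_ge0 (mulr_ge0 (ltW e0) D0) (sqr_ge0 i).
  have : s * i <= s by rewrite ler_piMr // ltW.
  by move: (s) => s'; lra.
apply: filterS => n hn.
have m0 : 0 < (n.+1%:R : R) by rewrite ltr0n.
rewrite -ler_pdivlMr // -/(c n) -/(d n).
have : s / (4 * e) <= d n / n.+1%:R.
  have -> : s / (4 * e) = s / 2 / e - s / (4 * e) by field; rewrite gt_eqF.
  by move: hn; rewrite /y mulNr addrC -opprB lerN2.
apply: le_trans; rewrite -/e.
have -> : s / (4 * e) = l ^+ 2 * 16 * (gap_cst * (beta - alpha) / e).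
  by rewrite /s /gap_cst -tE; field; rewrite gt_eqF.
rewrite ler_peMl //.
  by apply: divr_ge0 (mulr_ge0 (ltW gap_cst_gt0) _) (ltW e0); rewrite subr_ge0 ltW.
have : 4^-1 ^+ 2 <= l ^+ 2 by rewrite lerXn2r ?nnegrE.
lra.
Unshelve. all: by end_near. Qed.

End Gap.

(** * Forgetting the root *)

Section Unrooted.
Local Open Scope classical_set_scope.
Variable R : realType.
Implicit Types (p : seq nat) (l k eta : R) (n s u v : nat).
Let AP := @avgP R.

(* Deleting the edge above [v <> 0] leaves components of [sz p v] and
   [(size p).+1 - sz p v] nodes; the components with at most half of the nodes are counted. *)
Definition W_unrooted l p : R := \sum_(1 <= v < (size p).+1)
  ((if (2 * sz p v <= (size p).+1)%N then grate l (sz p v) else 0) +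
   (if (2 * ((size p).+1 - sz p v) <= (size p).+1)%N then grate l ((size p).+1 - sz p v) else 0)).

Lemma anc_root p u : valid below p -> (u <= size p)%N -> anc p u 0.
Proof.
elim: p u => [|i p IH] u /=; first by rewrite leqn0.
rewrite /below ltnS => -[ip vp] up; rewrite /anc -/anc; case: eqP => [->|un].
  by rewrite IH.
by apply: IH => //; move: up; rewrite leq_eqVlt => /orP[/eqP//|]; rewrite ltnS.
Qed.

Lemma sz_root p : valid below p -> sz p 0 = (size p).+1.
Proof.
move=> vp; rewrite /sz (eq_bigr (fun=> 1%N)) ?sum1_card ?card_ord // => u _.
by rewrite anc_root // -ltnS.
Qed.

Lemma grate_mono l s s' : 0 <= l -> (s <= s')%N -> grate l s <= grate l s'.
Proof.
move=> l0; elim: s' => [|s' IH]; first by rewrite leqn0 => /eqP ->.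
rewrite leq_eqVlt => /orP[/eqP -> //|]; rewrite ltnS => ss'; apply: le_trans (IH ss') _.
case: s' {IH ss'} => [|s']; first by rewrite /grate !big_geq.
rewrite (grateS l (ltn0Sn s')) ler_peMr //; first by rewrite (le_trans ler01) // grate_ge1.
by rewrite lerDl divr_ge0.
Qed.

(** A subtree with fewer than half of the nodes is counted in the same way on both sides; the root
    and the subtrees with at least half of them cost at most 2 g_l(s_v) each, which [sum_asum] turns
    into a sum of truncated ancestor sums. *)
Lemma W_unrooted_dist l p : 0 <= l -> valid below p ->
  `|W l p - W_unrooted l p| <= 2 * \sum_(u < (size p).+1) asum (phi_large (size p)./2 l) p u.
Proof.
move=> l0 vp; rewrite sum_asum; set N := (size p).+1.
pose H v := (sz p v)%:R * phi_large (size p)./2 l (sz p v).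
have HE v : (v <= size p)%N -> H v = if (N <= 2 * sz p v)%N then grate l (sz p v) else 0.
  move=> vsp; rewrite /H /phi_large; have sv := sz_gt0 vsp.
  have -> : (sz p v <= (size p)./2)%N = ~~ (N <= 2 * sz p v)%N.
    by rewrite -ltnNge /N; have := odd_double_half (size p); lia.
  by case: (N <= _)%N; rewrite /= ?mulr0 // -grate_phi.
rewrite /W /W_unrooted -(big_mkord xpredT (fun v => grate l (sz p v))) -(big_mkord xpredT H) -/N.
rewrite !(big_ltn (ltn0Sn _)) -addrA -sumrB.
have H0 : H 0%N = grate l (sz p 0) by rewrite HE // sz_root // -/N leq_pmull.
have g0 s : 0 <= grate l s.
  by apply: le_trans (grate_mono l0 (leq0n s)); rewrite /grate big_geq.
apply: le_trans (ler_normD _ _) _; rewrite mulrDr; apply: lerD.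
  by rewrite H0 ger0_norm // ler_peMl // ler1n.
apply: le_trans (ler_norm_sum _ _ _) _; rewrite mulr_sumr; apply: ler_sum_nat => v /andP[v1 vN].
rewrite HE //; have sN := sz_le p v; rewrite -/N in sN.
set s := sz p v in sN *.
have -> : (2 * (N - s) <= N)%N = (N <= 2 * s)%N by lia.
case: (leqP (2 * s) N) => h1; case: (leqP N (2 * s)) => h2.
(* An edge that halves the tree is counted from both sides. *)
- have e : (N - s)%N = s by lia.
  by rewrite e opprD addrA subrr add0r normrN ger0_norm // ler_peMl // ler1n.
- by rewrite addr0 subrr normr0 mulr0.
- rewrite add0r; have gle : grate l (N - s) <= grate l s by apply: grate_mono => //; lia.
  rewrite ger0_norm ?subr_ge0 //; have := g0 (N - s)%N; have := g0 s; lra.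
- by exfalso; lia.
Qed.

(** The exponent [k] is the midpoint of l + 1/2 and 1: below 1 it has bounded fourth moments, and
    above l + 1/2 the factor m^2 g^2 coming from subtrees of size at least m/2 is o(m). *)
Lemma expect_W_unrooted l eta : 0 <= l < 2^-1 -> 0 < eta ->
  \forall n \near \oo, expect (@avg R) n (fun p => (W l p - W_unrooted l p) ^+ 2) <= eta * n.+1%:R.
Proof.
move=> /andP[l0 l1] eta0.
pose k := l / 2 + 3 / 4; have k0 : 0 <= k by rewrite /k; lra.
have k1 : k < 1 by rewrite /k; lra.
pose t := (1 - k) / 2; have t01 : 0 < t <= 1 by rewrite /t; lra.
pose K := 1 + Kmom t.
have Kt : 0 <= Kmom t.
  rewrite /Kmom mulr_ge0 ?exprn_even_ge0 // divr_ge0 //; lra.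
have K0 : 0 < K by rewrite ltr_wpDr.
pose e := eta / (8 * K); have e0 : 0 < e by rewrite divr_gt0 ?mulr_gt0.
have lk : l + 2^-1 < k by rewrite /k; lra.
have [N _ hN] := gratio_sqr_cvg0 l0 lk (ltW k1) e0.
have := nbhs_infty_ge (2 * N)%N; apply: filterS => n hn.
set m : R := n.+1%:R; have m0 : 0 < m by rewrite ltr0n.
pose g : R := gratio l k n./2.+1.
have g0 : 0 <= g by rewrite ltW // gratio_gt0.
have gm : m * g ^+ 2 <= 2 * e.
  have hg : n./2.+1%:R * g ^+ 2 <= e by apply: hN; rewrite /= -divn2 leq_divRL // mulnC.
  apply: le_trans (_ : 2 * (n./2.+1%:R * g ^+ 2) <= _); last by rewrite ler_wpM2l.
  rewrite mulrA ler_wpM2r ?sqr_ge0 // -natrM ler_nat mul2n doubleS !ltnS.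
  by rewrite -[leqLHS]odd_double_half -add1n leq_add2r leq_b1.
apply: le_trans (_ : expect (@avg R) n (fun p => (4 * m ^+ 2 * g ^+ 2) *
   (1 + avg n.+1 (fun u => A k p u ^+ 4))) <= _).
  apply: (expect_le AP) => p pn vp.
  have h1 := W_unrooted_dist l0 vp.
  have h2 : \sum_(u < (size p).+1) asum (phi_large (size p)./2 l) p u <=
      m * (g * avg n.+1 (A k p)).
    rewrite pn /avg mulrCA [m * _]mulrC divfK ?gt_eqF // mulr_sumr.
    by apply: ler_sum => u _; apply: asum_large_le => //; lra.
  have h3 : `|W l p - W_unrooted l p| <= 2 * (m * (g * avg n.+1 (A k p))).
    by apply: le_trans h1 _; rewrite ler_wpM2l.
  have a0 : 0 <= avg n.+1 (A k p) by apply: avg_ge0 => i _; exact: A_ge0.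
  rewrite -[leLHS]real_normK ?num_real //.
  apply: le_trans (_ : (2 * (m * (g * avg n.+1 (A k p)))) ^+ 2 <= _).
    by rewrite lerXn2r ?nnegrE // (le_trans _ h3).
  have -> : (2 * (m * (g * avg n.+1 (A k p)))) ^+ 2 = 4 * m ^+ 2 * g ^+ 2 * avg n.+1 (A k p) ^+ 2.
    by ring.
  have c0 : 0 <= 4 * m ^+ 2 * g ^+ 2 by rewrite -mulrA -exprMn; apply: mulr_ge0 => //; exact: sqr_ge0.
  rewrite ler_wpM2l //.
  apply: le_trans (lerD (lexx 1) (avg_pow4 n (A k p))).
  set x := avg _ _; have := sqr_ge0 (x ^+ 2 - 1); rewrite sqrrB1 -exprM; have := sqr_ge0 x; lra.
rewrite (expectZ AP) (expectD AP) (expect_cst AP).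
have hk : expect (@avg R) n (fun p => avg n.+1 (fun u => A k p u ^+ 4)) <= Kmom t.
  by apply: expect_moment4.
have c0 : 0 <= 4 * m ^+ 2 * g ^+ 2 by rewrite -mulrA -exprMn; apply: mulr_ge0 => //; exact: sqr_ge0.
apply: le_trans (_ : 4 * m ^+ 2 * g ^+ 2 * K <= _); first by rewrite ler_wpM2l // lerD2l.
have -> : 4 * m ^+ 2 * g ^+ 2 * K = 4 * K * (m * g ^+ 2) * m by ring.
rewrite ler_wpM2r ?(ltW m0) //.
have -> : eta = 4 * K * (2 * e) by rewrite /e; field; rewrite gt_eqF.
by rewrite ler_wpM2l ?mulr_ge0 // ltW.
Qed.

End Unrooted.

(** * Sums over finite histories as iterated expectations *)

Section HistorySum.
Variable R : realType.

Lemma expect_congr (T : Type) (K K' : nat -> (T -> R) -> R) n (f : seq T -> R) :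
  (forall m g, (m < n)%N -> K m.+1 g = K' m.+1 g) -> expect K n f = expect K' n f.
Proof.
elim: n f => [//|n IH] f KK' /=; rewrite IH => [|m g mn]; last by apply: KK'; rewrite ltnW.
by congr expect; apply/funext => h; exact: KK'.
Qed.

Lemma sum_ffun_recr (T : finType) n (F : {ffun 'I_n.+1 -> T} -> R) :
  \sum_h F h = \sum_(h : {ffun 'I_n -> T}) \sum_(t : T)
    F [ffun k => if unlift ord_max k is Some j then h j else t].
Proof.
rewrite pair_bigA /=.
pose ext (p : {ffun 'I_n -> T} * T) : {ffun 'I_n.+1 -> T} :=
  [ffun k => if unlift ord_max k is Some j then p.1 j else p.2].
pose res (h : {ffun 'I_n.+1 -> T}) : {ffun 'I_n -> T} * T :=
  ([ffun j => h (lift ord_max j)], h ord_max).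
rewrite (reindex ext) //; exists res => [[h t] _|h _]; rewrite /res /ext /=.
  rewrite ffunE unlift_none; congr pair; apply/ffunP => j.
  by rewrite !ffunE liftK.
by apply/ffunP => k; rewrite ffunE; case: unliftP => [j ->|-> //]; rewrite ffunE.
Qed.

(** Reversed, because codes and histories list the newest choice first. *)
Definition ffun_seq (T : Type) (U : Type) (val : T -> U) n (h : 'I_n -> T) : seq U :=
  rev [seq val (h k) | k <- enum 'I_n].

Lemma sum_ffun_expect (T : finType) (U : Type) (val : T -> U) (w : nat -> T -> R) n
    (f : seq U -> R) :
  \sum_(h : {ffun 'I_n -> T}) (\prod_(k < n) w k (h k)) * f (ffun_seq val h) =
  expect (fun m g => \sum_t w m.-1 t * g (val t)) n f.
Proof.
elim: n f => [|n IH] f /=.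
  rewrite /ffun_seq; have E0 : enum 'I_0 = [::] by apply: size0nil; rewrite size_enum_ord.
  have c1 : #|{: {ffun 'I_0 -> T}}| = 1%N by rewrite card_ffun card_ord expn0.
  rewrite (eq_bigr (fun=> f [::])); last by move=> h _; rewrite big_ord0 mul1r E0.
  by rewrite sumr_const c1.
rewrite -IH sum_ffun_recr; apply: eq_bigr => h _.
rewrite mulr_sumr; apply: eq_bigr => t _.
have lE (j : 'I_n) : widen_ord (leqnSn n) j = lift ord_max j.
  by apply: ord_inj; rewrite lift_max.
rewrite big_ord_recr /= ffunE unlift_none -mulrA; congr (_ * (_ * f _)).
  by apply: eq_bigr => j _; rewrite lE ffunE liftK.
rewrite /ffun_seq enum_ordSr map_rcons rev_rcons ffunE unlift_none; congr (_ :: rev _).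
by rewrite -map_comp; apply: eq_map => j /=; rewrite lE ffunE liftK.
Qed.

Lemma sum_uniform_avg n k (g : nat -> R) : (k < n)%N ->
  \sum_(i < n) (if (i <= k)%N then k.+1%:R^-1 else 0) * g i = avg k.+1 g.
Proof.
move=> kn; rewrite /avg (big_ord_widen n g kn) mulr_suml [RHS]big_mkcond /=.
by apply: eq_bigr => i _; rewrite ltnS; case: ifP; rewrite ?mul0r // mulrC.
Qed.

Definition hist_seq n (h : history n) : seq (nat * nat) :=
  ffun_seq (fun c : 'I_n * 'I_n => (val c.1, val c.2)) h.

Lemma sum_history (alpha : R) n (f : seq (nat * nat) -> R) :
  \sum_(h : history n) history_law alpha h * f (hist_seq h) = expect (avg2 alpha) n f.
Proof.
pose u k i : R := if (i <= k)%N then k.+1%:R^-1 else 0.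
pose w k (c : 'I_n * 'I_n) : R :=
  alpha * (if c.1 == c.2 then u k c.1 else 0) + (1 - alpha) * (u k c.1 * u k c.2).
rewrite (sum_ffun_expect (fun c : 'I_n * 'I_n => (val c.1, val c.2)) w).
apply: expect_congr => k g kn; rewrite /avg2 /=.
rewrite (eq_bigr (fun c : 'I_n * 'I_n => alpha * ((if c.1 == c.2 then u k c.1 else 0) * g (val c.1, val c.2))
  + (1 - alpha) * (u k c.1 * (u k c.2 * g (val c.1, val c.2))))); last first.
  by move=> c _; rewrite /w; ring.
rewrite big_split /= -!mulr_sumr; congr (_ * _ + _ * _).
  rewrite -(sum_uniform_avg _ kn) -(pair_bigA _ (fun i j : 'I_n =>
    (if i == j then u k i else 0) * g (val i, val j))) /=.
  apply: eq_bigr => i _; rewrite (bigD1 i) //= eqxx big1 ?addr0 // => j ji.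
  by rewrite eq_sym (negbTE ji) mul0r.
rewrite -(sum_uniform_avg _ kn) -(pair_bigA _ (fun i j : 'I_n =>
    u k i * (u k j * g (val i, val j)))) /=.
apply: eq_bigr => i _; rewrite -mulr_sumr; congr (_ * _).
by rewrite -(sum_uniform_avg _ kn).
Qed.

Lemma history_law_support (alpha : R) n (h : history n) : history_law alpha h != 0 ->
  forall k : 'I_n, ((h k).1 <= k)%N && ((h k).2 <= k)%N.
Proof.
move=> h0 k; apply: contraNT h0; rewrite negb_and => hk.
rewrite /history_law (bigD1 k) //= /step /uniform.
case: (eqVneq (h k).1 (h k).2) => [e|_].
  by move: hk; rewrite -e orbb => /negbTE ->; rewrite !(mul0r, mulr0) addr0 mul0r.
by case/orP: hk => /negbTE ->; rewrite !(mul0r, mulr0) addr0 mul0r.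
Qed.

End HistorySum.

(** * An isomorphism invariant of the graph *)

Section GraphStatistic.
Variable R : realType.

Definition cut n (E : graph n) (S : {set 'I_n.+1}) : {set {set 'I_n.+1}} :=
  [set e in E | #|e :&: S| == 1%N].

(* In a tree, the sets of nodes cut by a single edge are the components left by the
   removal of an edge.  The statistic only depends on the isomorphism class. *)
Definition cut_stat (l : R) n (E : graph n) : R :=
  \sum_(S : {set 'I_n.+1} | (#|cut E S| == 1%N) && (2 * #|S| <= n.+1)%N) grate l #|S|.

Lemma cut_stat_relabel l n (s : {perm 'I_n.+1}) (E : graph n) :
  cut_stat l (relabel s E) = cut_stat l E.
Proof.
have sI := @perm_inj _ s; have sI2 := imset_inj sI.
have cutE (S : {set 'I_n.+1}) : cut (relabel s E) (s @: S) =
    [set s @: (e : {set 'I_n.+1}) | e in cut E S].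
  apply/setP => e; apply/setIdP/imsetP.
    case=> /imsetP[e' e'E ->]; rewrite -imsetI; last by move=> ? ? _ _; exact: sI.
    by rewrite card_imset // => ce; exists e' => //; rewrite inE e'E.
  case=> e'; rewrite inE => /andP[e'E ce] ->; split; first exact: imset_f.
  by rewrite -imsetI ?card_imset // => ? ? _ _; exact: sI.
rewrite /cut_stat (reindex (fun S : {set 'I_n.+1} => s @: S)) /=.
  by apply: eq_big => [S|S _]; rewrite ?cutE !card_imset.
exists (fun S : {set 'I_n.+1} => (s^-1)%g @: S) => S _;
  rewrite -imset_comp -[RHS]imset_id; apply: eq_imset => x /=; by rewrite ?permK ?permKV.
Qed.

Definition unlabeled_stat l n (t : unlabeled n) : R := cut_stat l (generic_quotient.repr t).

Lemma unlabeled_statE l n (E : graph n) :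
  unlabeled_stat l (\pi_(unlabeled n) E)%qT = cut_stat l E.
Proof.
rewrite /unlabeled_stat.
have : isomorphic E (generic_quotient.repr (\pi_(unlabeled n) E)%qT).
  by have /eqquotP := esym (reprK (\pi_(unlabeled n) E)%qT).
by case/existsP => s /eqP ->; rewrite cut_stat_relabel.
Qed.

End GraphStatistic.

(** * Cuts of a grown tree and the unrooted sum *)

Section GrownTrees.
Variable R : realType.

Lemma nth_valid p j : valid below p -> (j < size p)%N -> (nth 0%N p j < size p - j)%N.
Proof.
elim: p j => [//|i p IH] [|j] /= [ip vp] jp; first by rewrite subn0.
by rewrite subSS; exact: IH.
Qed.

(** The recursion of [anc], stated there for the newest node only, holds at every node; since the
    newest parent comes first, the parent of [u] has index [size p - u]. *)
Lemma anc_parent p u v : valid below p -> (0 < u <= size p)%N ->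
  anc p u v = (v == u) || anc p (nth 0%N p (size p - u)) v.
Proof.
elim: p u => [|i p IH] u; first by move=> _ /andP[/leq_trans h /h].
move=> /= [ip vp] /andP[u0]; rewrite leq_eqVlt => /orP[/eqP ->|].
  rewrite subnn [nth _ _ _]/= (anc_old _ _ (ip : i <= size p)%N) anc_top; case: eqP => // _ /=.
  have [av|//] := boolP (anc p i v); last by rewrite andbF.
  by rewrite (leq_ltn_trans (anc_le av) ip).
rewrite ltnS => up; rewrite anc_old // subSn //= IH ?u0 // anc_old //.
have hj : (size p - u < size p)%N by lia.
have := nth_valid vp hj; rewrite subKn // => h; apply: leq_trans up.
exact: ltnW.
Qed.

Variables (n : nat) (f : 'I_n -> 'I_n).
Hypothesis f_le : forall k, (f k <= k)%N.
Let p : seq nat := ffun_seq val f.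

Lemma size_parents : size p = n.
Proof. by rewrite /p /ffun_seq size_rev size_map size_enum_ord. Qed.

Lemma nth_parents (k : 'I_n) : nth 0%N p (n - k.+1) = f k.
Proof.
rewrite /p /ffun_seq nth_rev size_map size_enum_ord; last by have := ltn_ord k; lia.
have -> : (n - (n - k.+1).+1 = k)%N by have := ltn_ord k; lia.
by rewrite (nth_map k) ?size_enum_ord // nth_ord_enum.
Qed.

Lemma valid_nth (q : seq nat) : (forall j, (j < size q)%N -> (nth 0%N q j < size q - j)%N) ->
  valid below q.
Proof.
elim: q => [//|i q IH] h; split; first by have := h 0%N; rewrite /= subn0; apply.
by apply: IH => j jq; have := h j.+1; rewrite /= subSS; apply.
Qed.

Lemma valid_parents : valid below p.
Proof.
apply: valid_nth => j; rewrite size_parents => jn.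
have kn : (n - j.+1 < n)%N by lia.
have := nth_parents (Ordinal kn); rewrite /= (_ : n - (n - j.+1).+1 = j)%N; last by lia.
by move=> ->; have := f_le (Ordinal kn); rewrite /=; lia.
Qed.

Lemma anc_grow (k : 'I_n) v : anc p k.+1 v = (v == k.+1) || anc p (f k) v.
Proof.
have kP : (0 < k.+1 <= size p)%N by rewrite size_parents ltn_ord.
by rewrite (anc_parent v valid_parents kP) size_parents nth_parents.
Qed.

Let node (k : 'I_n) : 'I_n.+1 := lift ord0 k.
Let parent (k : 'I_n) : 'I_n.+1 := widen_ord (leqnSn n) (f k).
Let edge (k : 'I_n) : {set 'I_n.+1} := [set node k; parent k].

Lemma parent_neq k : parent k != node k.
Proof. by rewrite -(inj_eq val_inj) /= /bump /= add1n ltn_eqF // ltnS f_le. Qed.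

Lemma edge_inj : injective edge.
Proof.
have half (k j : 'I_n) : edge k = edge j -> (j <= k)%N.
  move=> e; have : node j \in edge k by rewrite e set21.
  rewrite !inE -!(inj_eq val_inj) /= /bump /= !add1n => /orP[/eqP[->] //|/eqP h].
  by have := f_le k; rewrite -h; exact: ltnW.
by move=> k j e; apply/val_inj/eqP; rewrite eqn_leq !half.
Qed.

Lemma card_edgeI k (S : {set 'I_n.+1}) :
  (#|edge k :&: S| == 1%N) = (node k \in S) (+) (parent k \in S).
Proof.
rewrite /edge finset.setIUl cardsU.
have -> : [set node k] :&: S :&: ([set parent k] :&: S) = finset.set0.
  apply/setP => x; rewrite !inE; apply/negbTE/negP => /andP[/andP[/eqP -> _] /andP[/eqP e _]].
  by have := parent_neq k; rewrite -e eqxx.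
have c1 (x : 'I_n.+1) : #|[set x] :&: S| = (x \in S).
  have [xS|xS] := boolP (x \in S).
    by rewrite (finset.setIidPl _) ?cards1 // finset.sub1set.
  by apply/eqP; rewrite cards_eq0; apply/eqP/setP => y; rewrite !inE; apply/negbTE/negP => /andP[/eqP ->]; rewrite (negbTE xS).
by rewrite cards0 subn0 !c1; case: (_ \in S); case: (_ \in S).
Qed.

Let crossing (S : {set 'I_n.+1}) : {set 'I_n} :=
  [set k | (node k \in S) (+) (parent k \in S)].

Lemma cut_grow S : #|cut (grow f) S| = #|crossing S|.
Proof.
rewrite -(card_imset _ edge_inj); apply: eq_card => e; rewrite inE.
apply/andP/imsetP => [[/imsetP[k _ ->]]|[k]].
  by rewrite -/(edge k) card_edgeI => h; exists k; rewrite ?inE.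
by rewrite inE -card_edgeI => h ->; split => //; exact: imset_f.
Qed.

Let desc (k : 'I_n) : {set 'I_n.+1} := [set u : 'I_n.+1 | anc p u k.+1].

Lemma mem_desc_node (k j : 'I_n) : (node j \in desc k) = (j == k) || (parent j \in desc k).
Proof. by rewrite !inE /= anc_grow eqSS eq_sym. Qed.

Lemma node_cases (u : 'I_n.+1) : u = ord0 \/ exists k, u = node k.
Proof. by case: (unliftP ord0 u) => [k ->|->]; [right; exists k|left]. Qed.

Lemma ord0_desc k : ord0 \notin desc k.
Proof. by rewrite inE anc_gt. Qed.

Lemma parent_desc k : parent k \notin desc k.
Proof. by rewrite inE anc_gt //= ltnS f_le. Qed.

Lemma crossing_desc k : crossing (desc k) = [set k].
Proof.
apply/setP => j; rewrite inE mem_desc_node finset.in_set1; have [->|_] := eqVneq j k; first by rewrite (negbTE (parent_desc k)).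
by rewrite addbb.
Qed.

Lemma crossing_setC S : crossing (~: S) = crossing S.
Proof. by apply/setP => j; rewrite !inE; case: (_ \in S); case: (_ \in S). Qed.

(** Going down from the root, membership in [S] changes across the edge [k] only; whether [S]
    contains the root decides between the two sides. *)
Lemma crossing1 S k : crossing S = [set k] -> S = desc k \/ S = ~: desc k.
Proof.
move=> ck.
have mem u : (u \in S) = (ord0 \in S) (+) (u \in desc k).
  have [m] := ubnP (val u); elim: m u => // m IH u um.
  case: (node_cases u) => [->|[j e]]; first by rewrite (negbTE (ord0_desc k)) addbF.
  have jm : (val (parent j) < m)%N.
    by move: um; rewrite e ltnS; exact: leq_ltn_trans (f_le j).
  have := IH _ jm; rewrite e mem_desc_node => hp.
  have : (j \in crossing S) = (j == k) by rewrite ck inE.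
  rewrite inE hp; case: (eqVneq j k) => [->|_].
    by rewrite (negbTE (parent_desc k)); case: (node k \in S); case: (ord0 \in S).
  by case: (node j \in S); case: (ord0 \in S); case: (parent j \in desc k).
case: (boolP (ord0 \in S)) => h0; [right|left]; apply/setP => u; rewrite mem ?h0 ?(negbTE h0) //.
by rewrite finset.in_setC.
Qed.

Lemma card_desc k : #|desc k| = sz p k.+1.
Proof.
by rewrite /sz size_parents -sum1dep_card big_mkcond; apply: eq_bigr => u _; case: anc.
Qed.

Lemma cut_stat_grow (l : R) : cut_stat l (grow f) = W_unrooted l p.
Proof.
pose Q (S : {set 'I_n.+1}) := (2 * #|S| <= n.+1)%N.
pose G (S : {set 'I_n.+1}) : R := if Q S then grate l #|S| else 0.
(* A set cut by a single edge is charged to that edge; after the exchange of sums each edge has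
   exactly its two sides. *)
have -> : cut_stat l (grow f) = \sum_S \sum_k (if crossing S == [set k] then G S else 0).
  rewrite /cut_stat big_mkcond; apply: eq_bigr => S _; rewrite cut_grow -/(Q S).
  case: (boolP (#|crossing S| == 1%N)) => [/cards1P[k ->]|c1] /=.
    rewrite (bigD1 k) //= eqxx big1 ?addr0 // => j jk; case: eqP => // e.
    by move: jk; rewrite -(inj_eq (@finset.set1_inj _)) e eqxx.
  rewrite big1 // => k _; case: eqP => // e; by move: c1; rewrite e cards1.
rewrite exchange_big /= /W_unrooted big_add1 /= size_parents big_mkord; apply: eq_bigr => k _.
have dC : ~: desc k != desc k.
  by apply/eqP => /setP/(_ ord0); rewrite inE (negbTE (ord0_desc k)).
rewrite (bigD1 (desc k)) //= crossing_desc eqxx; congr (_ + _).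
  by rewrite /G /Q card_desc.
have cardC : #|~: desc k| = (n.+1 - sz p k.+1)%N.
  by rewrite cardsCs finset.setCK card_ord card_desc.
rewrite (bigD1 (~: desc k)) //= crossing_setC crossing_desc eqxx big1 => [|S /andP[S1 S2]].
  by rewrite addr0 /G /Q cardC.
by case: eqP => // /crossing1[] e; [move: S1|move: S2]; rewrite e eqxx.
Qed.

End GrownTrees.

(** * The test statistic and its mean and variance *)

Section Separation.
Local Open Scope classical_set_scope.
Variable R : realType.
Implicit Types (n m J i j : nat) (h : seq (nat * nat)) (alpha beta : R).

(** The distance to criticality, [1 - 2 * lam j]. Starting at 1/2 gives [lam j >= 1/4], as [cov_gap]
    requires. *)
Definition eps j : R := 2^-1 ^+ j.+1.
Definition lam j : R := (1 - eps j) / 2.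

Lemma eps_gt0 j : 0 < eps j.
Proof. by rewrite exprn_gt0 // invr_gt0. Qed.

Lemma eps_le j : eps j <= 2^-1.
Proof. by rewrite /eps exprS ler_piMr // exprn_ile1 //; lra. Qed.

Lemma lam_bounds j : 4^-1 <= lam j < 2^-1.
Proof. have := eps_gt0 j; have := eps_le j; rewrite /lam; lra. Qed.

Lemma lam_admissible (a : bool) j : admissible (a, lam j).
Proof. by have := lam_bounds j; rewrite /admissible /=; lra. Qed.

(** With y = [eps j], each term is at most twice the decrease of x/(x + y) when x is halved from
    [eps i] to [eps i.+1]; the sum telescopes. *)
Lemma sum_eps_le J j : \sum_(i < J) eps j * eps i / (eps j + eps i) ^+ 2 <= 2.
Proof.
pose f i := - (eps i / (eps i + eps j)).
apply: le_trans (_ : \sum_(0 <= i < J) 2 * (f i.+1 - f i) <= _).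
  rewrite big_mkord; apply: ler_sum => i _; rewrite /f.
  have xi : 0 < eps i by exact: eps_gt0.
  have -> : eps i.+1 = eps i / 2 by rewrite /eps exprSr mulrC.
  move: (eps i) (eps j) xi (eps_gt0 j) => x y x0 y0.
  have -> : 2 * (- (x / 2 / (x / 2 + y)) - - (x / (x + y))) = y * x / ((x + y) * (x / 2 + y)).
    by field; rewrite !gt_eqF // ?addr_gt0 ?divr_gt0 //; lra.
  rewrite ler_wpM2l ?mulr_ge0 ?(ltW x0) ?(ltW y0) // lef_pV2 ?posrE ?exprn_gt0 ?mulr_gt0 //; nra.
rewrite -mulr_sumr telescope_sumr // /f.
have h1 : 0 <= eps J / (eps J + eps j) by rewrite divr_ge0 ?addr_ge0 // ltW // eps_gt0.
have h2 : eps 0 / (eps 0 + eps j) <= 1.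
  by rewrite ler_pdivrMr ?mul1r ?lerDl ?addr_gt0 ?eps_gt0 // ltW // eps_gt0.
lra.
Qed.

(** Abstract in [F], in order to serve both the martingale-based [X] and the observable
    [X_unrooted]. *)
Definition stat (F : bool * R -> seq (nat * nat) -> R) J h : R :=
  (\sum_(j < J) eps j * (F (false, lam j) h * F (true, lam j) h)) / (size h).+1%:R.

Definition X_unrooted (x : bool * R) h : R := W_unrooted x.2 (map (pick x.1) h) - mean x.2 (size h).

Definition stat_mean alpha J n : R :=
  (\sum_(j < J) eps j * cov alpha (false, lam j) (true, lam j) n) / n.+1%:R.

Lemma stat_mean_gap alpha beta J : 0 <= alpha -> alpha < beta -> beta <= 1 ->
  \forall n \near \oo, J%:R * (gap_cst R * (beta - alpha)) <= stat_mean beta J n - stat_mean alpha J n.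
Proof.
move=> a0 ab b1.
have H : \forall n \near \oo, forall j : 'I_J,
    gap_cst R * (beta - alpha) / (1 - 2 * lam j) * n.+1%:R <=
    cov beta (false, lam j) (true, lam j) n - cov alpha (false, lam j) (true, lam j) n.
  by apply: filter_forall => j; apply: cov_gap => //; exact: lam_bounds.
apply: filterS H => n H; rewrite /stat_mean -mulrBl ler_pdivlMr ?ltr0n // -sumrB.
have -> : J%:R * (gap_cst R * (beta - alpha)) * n.+1%:R =
  \sum_(j < J) (gap_cst R * (beta - alpha) * n.+1%:R).
  by rewrite sumr_const card_ord -[_ *+ J]mulr_natl; ring.
apply: ler_sum => j _; rewrite -mulrBr.
apply: le_trans (ler_wpM2l (ltW (eps_gt0 j)) (H j)).
have -> : 1 - 2 * lam j = eps j by rewrite /lam; field.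
by rewrite le_eqVlt; apply/orP; left; apply/eqP; field; rewrite gt_eqF // eps_gt0.
Qed.

(** The 1 pays for the cumulants; 72 = 2 * 6^2 comes from two products of covariances bounded with
    the factor 6, and the outer 2 is that of [sum_eps_le]. *)
Definition var_cst : R := 1 + 2 * (72 * (1 + K0 R) ^+ 2).

(** By [isserlis] the covariance of two summands is a sum of two products of covariances, up to an
    error; their bounds are summable in each index, so the total is linear in [J]. *)
Lemma stat_var alpha J : 0 <= alpha <= 1 -> \forall n \near \oo,
  expect (avg2 alpha) n (fun h => (stat (@X R) J h - stat_mean alpha J n) ^+ 2) <= var_cst * J%:R.
Proof.
move=> a01; have KP := avg2P a01; pose C := 1 + K0 R.
have C0 : 0 <= C by rewrite addr_ge0 // K0_ge0.
(* Small enough for the J^2 cumulant errors to add up to at most J. *)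
pose eta : R := J.+1%:R^-1; have eta0 : 0 < eta by rewrite invr_gt0 ltr0n.
have H1 : \forall n \near \oo, forall (j l : 'I_J) (a b : bool),
    `|cov alpha (a, lam j) (b, lam l) n| <= 6 * C / (eps j + eps l) * n.+1%:R.
  apply: filter_forall => j; apply: filter_forall => l.
  apply: filter_forall => a; apply: filter_forall => b.
  have := XX_growth a01 (lam_admissible a j) (lam_admissible b l).
  apply: filterS => n; rewrite /= -/C (_ : 3 * C / (1 - lam j - lam l) = 6 * C / (eps j + eps l)) //.
  have e0 := addr_gt0 (eps_gt0 j) (eps_gt0 l).
  have -> : 1 - lam j - lam l = (eps j + eps l) / 2 by rewrite /lam; field.
  by field; rewrite gt_eqF.
have H2 : \forall n \near \oo, forall j l : 'I_J,
    `|cumulant alpha (false, lam j) (true, lam j) (false, lam l) (true, lam l) n| <= eta * n.+1%:R ^+ 2.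
  apply: filter_forall => j; apply: filter_forall => l.
  by apply: isserlis => //; exact: lam_admissible.
apply: filterS2 H1 H2 => n H1 H2.
have m0 : 0 < (n.+1%:R : R) by rewrite ltr0n.
set m : R := n.+1%:R in m0 H1 H2.
pose P j h := X (false, lam j) h * X (true, lam j) h.
pose c j := cov alpha (false, lam j) (true, lam j) n.
have -> : expect (avg2 alpha) n (fun h => (stat (@X R) J h - stat_mean alpha J n) ^+ 2) =
  (\sum_(j < J) \sum_(l < J) eps j * eps l *
    (expect (avg2 alpha) n (fun h => P j h * P l h) - c j * c l)) / m ^+ 2.
  have -> : \sum_(j < J) \sum_(l < J) eps j * eps l *
      (expect (avg2 alpha) n (fun h => P j h * P l h) - c j * c l) =
    expect (avg2 alpha) n (fun h => \sum_(j < J) \sum_(l < J) eps j * eps l *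
      ((P j h - c j) * (P l h - c l))).
    rewrite (expect_sum KP); apply: eq_bigr => j _.
    rewrite (expect_sum KP); apply: eq_bigr => l _; rewrite (expectZ KP); congr (_ * _).
    have -> : expect (avg2 alpha) n (fun h => (P j h - c j) * (P l h - c l)) =
      expect (avg2 alpha) n (fun h => P j h * P l h - (c l * P j h + c j * P l h - c j * c l)).
      by apply: (expect_eq KP) => h _ _; ring.
    rewrite (expectB KP) (expectB KP) (expectD KP).
    rewrite (expectZ KP n (c l) (P j)) (expectZ KP n (c j) (P l)) (expect_cst KP).
    by rewrite -[expect _ n (P j)]/(c j) -[expect _ n (P l)]/(c l); ring.
  rewrite -(expectZr KP); apply: (expect_eq KP) => h hn _.
  rewrite /stat /stat_mean hn -/m -mulrBl -sumrB expr_div_n; congr (_ / _).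
  rewrite expr2 mulr_suml; apply: eq_bigr => j _; rewrite mulr_sumr; apply: eq_bigr => l _.
  by rewrite -/(P j h) -/(P l h) -/(c j) -/(c l); ring.
rewrite ler_pdivrMr ?exprn_gt0 //.
apply: le_trans (_ : \sum_(j < J) \sum_(l < J)
    (eta + 72 * C ^+ 2 * (eps j * eps l / (eps j + eps l) ^+ 2)) * m ^+ 2 <= _).
  apply: ler_sum => j _; apply: ler_sum => l _.
  have ej := eps_gt0 j; have el := eps_gt0 l; have e0 := addr_gt0 ej el.
  have := H2 j l; rewrite /cumulant -/(c j) -/(c l).
  have := H1 j l false false; have := H1 j l true true.
  have := H1 j l false true; have := H1 j l true false.
  rewrite -[expect _ n _]/(expect (avg2 alpha) n (fun h => P j h * P l h)).
  set E := expect _ n _; set d := 6 * C / _ * m.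
  have d0 : 0 <= d by rewrite mulr_ge0 ?divr_ge0 ?mulr_ge0 // ltW.
  set c1 := cov alpha (true, lam j) (false, lam l) n; set c2 := cov alpha (false, lam j) (true, lam l) n.
  set c3 := cov alpha (true, lam j) (true, lam l) n; set c4 := cov alpha (false, lam j) (false, lam l) n.
  move=> h1 h2 h3 h4 h5.
  have p1 : `|c4 * c3| <= d * d by rewrite normrM ler_pM.
  have p2 : `|c2 * c1| <= d * d by rewrite normrM ler_pM.
  have b : E - c j * c l <= eta * m ^+ 2 + 2 * (d * d).
    by move: h5 p1 p2; rewrite !ler_norml => /andP[_ h5] /andP[_ p1] /andP[_ p2]; lra.
  apply: le_trans (ler_wpM2l (mulr_ge0 (ltW ej) (ltW el)) b) _.
  have -> : eps j * eps l * (eta * m ^+ 2 + 2 * (d * d)) =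
     eps j * eps l * (eta * m ^+ 2) + 72 * C ^+ 2 * (eps j * eps l / (eps j + eps l) ^+ 2) * m ^+ 2.
    by rewrite /d; field; rewrite gt_eqF.
  rewrite [leRHS]mulrDl lerD2r ler_piMl ?mulr_ge0 ?(ltW eta0) ?sqr_ge0 //.
  rewrite mulr_ile1 ?(ltW ej) ?(ltW el) //; apply: le_trans (eps_le _) _; lra.
have -> : \sum_(j < J) \sum_(l < J)
    (eta + 72 * C ^+ 2 * (eps j * eps l / (eps j + eps l) ^+ 2)) * m ^+ 2 =
  (\sum_(j < J) \sum_(l < J) (eta + 72 * C ^+ 2 * (eps j * eps l / (eps j + eps l) ^+ 2))) * m ^+ 2.
  by rewrite mulr_suml; apply: eq_bigr => j _; rewrite mulr_suml.
rewrite ler_wpM2r ?sqr_ge0 //.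
have -> : var_cst * J%:R = \sum_(j < J) var_cst.
  by rewrite sumr_const card_ord mulr_natr.
apply: ler_sum => j _; rewrite big_split /= -mulr_sumr sumr_const card_ord /var_cst.
apply: lerD.
  by rewrite -[_ *+ J]mulr_natl /eta ler_pdivrMr ?ltr0n // mul1r ler_nat.
by rewrite mulrC; apply: ler_wpM2r (sum_eps_le J j); rewrite mulr_ge0 // exprn_ge0.
Qed.

(** A difference of products is linear and quadratic in the errors, whose second moments are o(m),
    while the second moments of [X] are O(m); Young's inequality with a small weight [t] combines
    them. *)
Lemma stat_unrooted alpha J eta : 0 <= alpha <= 1 -> 0 < eta -> \forall n \near \oo,
  expect (avg2 alpha) n (fun h => `|stat X_unrooted J h - stat (@X R) J h|) <= eta.
Proof.
move=> a01 eta0; have KP := avg2P a01.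
have [K K0 HK] : exists2 K : R, 0 < K & forall j : 'I_J, 6 * (1 + K0 R) / (eps j + eps j) <= K.
  exists (1 + \sum_(j < J) 6 * (1 + K0 R) / (eps j + eps j)).
    rewrite ltr_pwDl // sumr_ge0 // => j _; rewrite divr_ge0 ?mulr_ge0 ?addr_ge0 ?K0_ge0 //;
    by rewrite ltW // eps_gt0.
  move=> j; rewrite ler_wpDl // (bigD1 j) //= lerDl sumr_ge0 // => i _.
  by rewrite divr_ge0 ?mulr_ge0 ?addr_ge0 ?K0_ge0 // ltW // eps_gt0.
pose N : R := J.+1%:R; have N0 : 0 < N by rewrite ltr0n.
(* Each index may cost eta/N: [t] gives t K = eta/(2N), and the two entries of the minimum [d] make
   d and d/t at most eta/(4N). *)
pose t := eta / (N * (2 * K)); have t0 : 0 < t by rewrite divr_gt0 ?mulr_gt0.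
pose d := Num.min (eta / (4 * N)) (t * eta / (4 * N)).
have N4 : 0 < 4 * N by rewrite mulr_gt0.
have d0 : 0 < d by rewrite lt_min; apply/andP; split; apply: divr_gt0 => //; exact: mulr_gt0.
have H1 : \forall n \near \oo, forall (j : 'I_J) (a : bool),
    expect (avg2 alpha) n (fun h => (X_unrooted (a, lam j) h - X (a, lam j) h) ^+ 2) <= d * n.+1%:R.
  apply: filter_forall => j; apply: filter_forall => a.
  have lb : 0 <= lam j < 2^-1 := lam_admissible a j.
  apply: filterS (expect_W_unrooted lb d0) => n; apply: le_trans.
  rewrite -(expect_tree alpha a) le_eqVlt; apply/orP; left; apply/eqP.
  by apply: (expect_eq KP) => h _ _; rewrite /X_unrooted /X /=; ring.
have H2 : \forall n \near \oo, forall (j : 'I_J) (a : bool),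
    expect (avg2 alpha) n (fun h => X (a, lam j) h ^+ 2) <= K * n.+1%:R.
  apply: filter_forall => j; apply: filter_forall => a.
  apply: filterS (XX_growth a01 (lam_admissible a j) (lam_admissible a j)) => n /(le_trans (ler_norm _)) h.
  apply: le_trans (le_trans h _); first by apply: (expect_le KP) => k _ _; rewrite expr2.
  rewrite ler_wpM2r //; apply: le_trans (HK j); rewrite le_eqVlt; apply/orP; left; apply/eqP.
  have e0 := eps_gt0 j; have -> : 1 - (a, lam j).2 - (a, lam j).2 = eps j by rewrite /lam /=; field.
  by field; rewrite gt_eqF //; lra.
apply: filterS2 H1 H2 => n H1 H2.
have m0 : 0 < (n.+1%:R : R) by rewrite ltr0n.
set m : R := n.+1%:R in m0 H1 H2.
pose D (x : bool * R) h := X_unrooted x h - X x h.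
apply: le_trans (_ : expect (avg2 alpha) n (fun h => \sum_(j < J) m^-1 *
  (t / 2 * (X (false, lam j) h ^+ 2 + X (true, lam j) h ^+ 2) +
   ((2 * t)^-1 + 2^-1) * (D (false, lam j) h ^+ 2 + D (true, lam j) h ^+ 2))) <= _).
  apply: (expect_le KP) => h hn _; rewrite /stat hn -/m -mulrBl -sumrB normrM mulrC.
  rewrite (ger0_norm (_ : 0 <= m^-1)) ?invr_ge0 ?(ltW m0) // -mulr_sumr ler_wpM2l ?invr_ge0 ?(ltW m0) //.
  apply: le_trans (ler_norm_sum _ _ _) _; apply: ler_sum => j _; rewrite -mulrBr normrM.
  have e0 := eps_gt0 j; rewrite (gtr0_norm e0).
  apply: le_trans (ler_piMl (normr_ge0 _) _) _; first by apply: le_trans (eps_le j) _; lra.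
  rewrite /D; move: (X_unrooted (false, lam j) h) (X_unrooted (true, lam j) h) => u v.
  move: (X (false, lam j) h) (X (true, lam j) h) => x y.
  have -> : u * v - x * y = x * (v - y) + y * (u - x) + (u - x) * (v - y) by ring.
  move: (u - x) (v - y) => a b.
  have am (r s : R) : `|r * s| <= t / 2 * r ^+ 2 + (2 * t)^-1 * s ^+ 2.
    have T (z : R) : 0 <= t * z ^+ 2 by rewrite mulr_ge0 ?sqr_ge0 // ltW.
    have := T (r - t^-1 * s); have := T (r + t^-1 * s).
    have -> : t * (r - t^-1 * s) ^+ 2 = t * r ^+ 2 + t^-1 * s ^+ 2 - 2 * (r * s) by field; rewrite gt_eqF.
    have -> : t * (r + t^-1 * s) ^+ 2 = t * r ^+ 2 + t^-1 * s ^+ 2 + 2 * (r * s) by field; rewrite gt_eqF.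
    have -> : (2 * t)^-1 = 2^-1 * t^-1 by rewrite invfM.
    by move: (t^-1) => i h1 h2; rewrite ler_norml; apply/andP; split; lra.
  have ab : `|a * b| <= 2^-1 * (a ^+ 2 + b ^+ 2).
    have := sqr_ge0 (a - b); have := sqr_ge0 (a + b).
    by rewrite sqrrB sqrrD => h1 h2; rewrite ler_norml; apply/andP; split; lra.
  apply: le_trans (ler_normD _ _) _; apply: le_trans (lerD (ler_normD _ _) (lexx _)) _.
  have := am x b; have := am y a; move: ((2 * t)^-1) (t / 2) => i i'; lra.
rewrite (expect_sum KP).
apply: le_trans (_ : \sum_(j < J) eta / N <= _); last first.
  rewrite sumr_const card_ord -[_ *+ J]mulr_natl mulrCA ler_piMr ?(ltW eta0) //.
  by rewrite ler_pdivrMr // mul1r ler_nat.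
apply: ler_sum => j _; rewrite (expectZ KP) ler_pdivrMl // (expectD KP).
rewrite (expectZ KP n (t / 2)) (expectZ KP n ((2 * t)^-1 + 2^-1)).
rewrite (expectD KP n (fun h => X (false, lam j) h ^+ 2)) (expectD KP n (fun h => D (false, lam j) h ^+ 2)).
have x1 := H2 j false; have x2 := H2 j true; have d1 := H1 j false; have d2 := H1 j true.
have t2 : 0 <= t / 2 by rewrite divr_ge0 // ltW.
have t3 : 0 <= (2 * t)^-1 + 2^-1 by rewrite addr_ge0 // invr_ge0 mulr_ge0 // ltW.
apply: le_trans (lerD (ler_wpM2l t2 (lerD x1 x2)) (ler_wpM2l t3 (lerD d1 d2))) _.
have -> : t / 2 * (K * m + K * m) + ((2 * t)^-1 + 2^-1) * (d * m + d * m) =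
  m * (t * K + (t^-1 * d + d)) by field; rewrite gt_eqF.
rewrite ler_wpM2l ?(ltW m0) //.
have e1 : t * K = eta / N / 2 by rewrite /t; field; rewrite !gt_eqF.
have e2 : d <= eta / N / 4.
  by rewrite -mulrA -invfM [N * 4]mulrC /d ge_min lexx.
have e3 : t^-1 * d <= eta / N / 4.
  rewrite ler_pdivrMl // -mulrA -invfM [N * 4]mulrC mulrA /d.
  by rewrite ge_min lexx orbT.
rewrite e1; move: (eta / N) e2 e3 => z; lra.
Qed.

Lemma separation alpha beta delta : 0 <= alpha -> alpha < beta -> beta <= 1 -> 0 < delta ->
  \forall n \near \oo, exists S : {set unlabeled n * unlabeled n},
    1 - delta <= \sum_(t in S) CUA beta t - \sum_(t in S) CUA alpha t.
Proof.
move=> a0 ab b1 d0.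
have a01 : 0 <= alpha <= 1 by rewrite a0; lra.
have b01 : 0 <= beta <= 1 by rewrite b1; lra.
have KA := avg2P a01; have KB := avg2P b01.
pose g := gap_cst R * (beta - alpha); have g0 : 0 < g by rewrite mulr_gt0 ?gap_cst_gt0 ?subr_gt0.
have V0 : 0 < var_cst.
  by rewrite /var_cst ltr_pwDl //; apply: mulr_ge0 => //; apply: mulr_ge0 => //; exact: sqr_ge0.
(* The gap of the means is linear in the number of terms and the variance too, so the Chebyshev term
   16 var/(J g^2), with [J] terms, falls below delta/4. *)
have [J HJ] : exists J : nat, 64 * var_cst / (delta * g ^+ 2) <= J.+1%:R.
  have [N _ HN] := nbhs_infty_ger (64 * var_cst / (delta * g ^+ 2)).
  by exists N; apply: le_trans (HN N (leqnn N)) _; rewrite ler_nat.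
pose q := J.+1%:R * g; have q0 : 0 < q by rewrite mulr_gt0 ?ltr0n.
(* The Markov term (4/q) e then equals delta/4. *)
pose e := delta * q / 16; have e0 : 0 < e by rewrite divr_gt0 // mulr_gt0.
have Hg := stat_mean_gap J.+1 a0 ab b1.
have Ha := stat_var J.+1 a01; have Hb := stat_var J.+1 b01.
have Ua := stat_unrooted J.+1 a01 e0; have Ub := stat_unrooted J.+1 b01 e0.
near=> n.
have hg : q <= stat_mean beta J.+1 n - stat_mean alpha J.+1 n by near: n.
have ha : expect (avg2 alpha) n (fun h => (stat (@X R) J.+1 h - stat_mean alpha J.+1 n) ^+ 2) <=
  var_cst * J.+1%:R by near: n.
have hb : expect (avg2 beta) n (fun h => (stat (@X R) J.+1 h - stat_mean beta J.+1 n) ^+ 2) <=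
  var_cst * J.+1%:R by near: n.
have ua : expect (avg2 alpha) n (fun h => `|stat X_unrooted J.+1 h - stat (@X R) J.+1 h|) <= e by near: n.
have ub : expect (avg2 beta) n (fun h => `|stat X_unrooted J.+1 h - stat (@X R) J.+1 h|) <= e by near: n.
pose thr := stat_mean alpha J.+1 n + q / 2.
pose Z h : R := (thr < stat X_unrooted J.+1 h)%R%:R.
pose U (t : unlabeled n * unlabeled n) : R := (\sum_(j < J.+1) eps j *
   ((unlabeled_stat (lam j) t.1 - mean (lam j) n) * (unlabeled_stat (lam j) t.2 - mean (lam j) n))) / n.+1%:R.
exists [set t | thr < U t]%SET.
(* The test depends on the unlabeled pair only. Histories with an impossible choice have weight
   zero, and on all others [cut_stat_grow] identifies [U] with the statistic of the history. *)
have transfer gamma : 0 <= gamma <= 1 ->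
    \sum_(t in [set t | thr < U t]%SET) CUA gamma t = expect (avg2 gamma) n Z.
  move=> c01; rewrite -sum_history /CUA.
  transitivity (\sum_(t : unlabeled n * unlabeled n) \sum_(h : history n | grow_pair h == t)
     history_law gamma h * (thr < U (grow_pair h))%R%:R).
    rewrite big_mkcond; apply: eq_bigr => t _; rewrite finset.inE.
    rewrite [RHS](eq_bigr (fun h : history n => history_law gamma h * (thr < U t)%R%:R)); last first.
      by move=> h /eqP ->.
    by rewrite -mulr_suml; case: ifP; rewrite ?mulr1 ?mulr0.
  transitivity (\sum_(h : history n) history_law gamma h * (thr < U (grow_pair h))%R%:R).
    by rewrite [RHS](partition_big (@grow_pair n) predT).
  apply: eq_bigr => h _.
  have [->|h0] := eqVneq (history_law gamma h) 0; first by rewrite !mul0r.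
  have hle := history_law_support h0.
  have l1 k : ((h k).1 <= k)%N by have /andP[] := hle k.
  have l2 k : ((h k).2 <= k)%N by have /andP[] := hle k.
  congr (_ * (_ < _)%R%:R).
  have hs : size (hist_seq h) = n by rewrite /hist_seq /ffun_seq size_rev size_map size_enum_ord.
  rewrite /U /stat hs; congr (_ / _); apply: eq_bigr => j _.
  rewrite /X_unrooted hs /= !unlabeled_statE (cut_stat_grow l1) (cut_stat_grow l2).
  by rewrite /hist_seq /ffun_seq !map_rev -!map_comp.
rewrite !transfer //.
pose v := 16 / q ^+ 2; have v0 : 0 <= v by rewrite divr_ge0 // exprn_ge0 // ltW.
pose w := 4 / q; have w0 : 0 <= w by rewrite divr_ge0 // ltW.
have bnd : v * (var_cst * J.+1%:R) + w * e <= delta / 2.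
  have h1 : w * e = delta / 4 by rewrite /w /e; field; rewrite gt_eqF.
  have h2 : v * (var_cst * J.+1%:R) <= delta / 4.
    have J0 : 0 < (J.+1%:R : R) by rewrite ltr0n.
    have -> : v * (var_cst * J.+1%:R) = 64 * var_cst / (delta * g ^+ 2) * (delta / 4) / J.+1%:R.
      rewrite /v /q; set N : R := J.+1%:R in J0 *.
      by field; rewrite !gt_eqF.
    by rewrite mulrAC ler_piMl ?divr_ge0 ?(ltW d0) // ler_pdivrMr // mul1r.
  by rewrite h1; lra.
(* Chebyshev for the rooted statistic and Markov for its distance to the unrooted one. *)
have cheb (s s' mu : R) : q / 2 <= `|s' - mu| -> 1 <= v * (s - mu) ^+ 2 + w * `|s' - s|.
  move=> far; have [h|h] := leP (q / 4) `|s' - s|.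
    have : 1 <= w * `|s' - s|.
      by rewrite /w mulrAC ler_pdivlMr // mul1r; lra.
    by move/le_trans; apply; rewrite lerDr mulr_ge0 ?sqr_ge0.
  have h' : q / 4 <= `|s - mu|.
    have := ler_normD (s' - s) (s - mu); rewrite addrA subrK; lra.
  have : 1 <= v * (s - mu) ^+ 2.
    have q4 : 0 <= q / 4 by rewrite divr_ge0 // ltW.
    rewrite -[(s - mu) ^+ 2]real_normK ?num_real // /v.
    rewrite [leLHS](_ : 1 = 16 / q ^+ 2 * (q / 4) ^+ 2); last by field; rewrite gt_eqF.
    by rewrite ler_wpM2l // lerXn2r ?nnegrE.
  by move/le_trans; apply; rewrite lerDl mulr_ge0.
have za : expect (avg2 alpha) n Z <= delta / 2.
  apply: le_trans (le_trans _ bnd); last exact: lerD (ler_wpM2l v0 ha) (ler_wpM2l w0 ua).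
  rewrite -(expectZ KA n v) -(expectZ KA n w) -(expectD KA); apply: (expect_le KA) => h _ _.
  rewrite /Z; case: ltP => hz /=.
    by apply: cheb; apply: le_trans (ler_norm _); move: hz; rewrite /thr; lra.
  by rewrite addr_ge0 // mulr_ge0 ?sqr_ge0.
have zb : 1 - delta / 2 <= expect (avg2 beta) n Z.
  rewrite lerBlDr -lerBlDl; apply: le_trans (le_trans _ bnd); last exact: lerD (ler_wpM2l v0 hb) (ler_wpM2l w0 ub).
  rewrite -[X in X - _](expect_cst KB n) -(expectB KB) -(expectZ KB n v) -(expectZ KB n w) -(expectD KB).
  apply: (expect_le KB) => h _ _; rewrite /Z; case: ltP => hz /=.
    by rewrite subrr addr_ge0 // mulr_ge0 ?sqr_ge0.
  rewrite subr0; apply: cheb; rewrite distrC; apply: le_trans (ler_norm _).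
  by move: hz hg; rewrite /thr; lra.
lra.
Unshelve. all: by end_near. Qed.

End Separation.

(** * Total variation distance *)

Lemma TV_bounds (R : realType) (alpha beta : R) n (S : {set unlabeled n * unlabeled n}) :
  0 <= alpha <= 1 -> 0 <= beta <= 1 ->
  `|\sum_(t in S) CUA alpha t - \sum_(t in S) CUA beta t| <=
    TV (CUA alpha (n := n)) (CUA beta (n := n)) <= 1.
Proof.
move=> a01 b01.
have bd gamma (A : {set unlabeled n * unlabeled n}) : 0 <= gamma <= 1 ->
    0 <= \sum_(t in A) CUA (R := R) gamma t <= 1.
  move=> c01; rewrite sumr_ge0 => [|t _]; last exact: CUA_ge0.
  rewrite -(sum_CUA gamma n) [leLHS]big_mkcond /=; apply: ler_sum => t _.
  by case: ifP => // _; exact: CUA_ge0.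
have le1 (A : {set unlabeled n * unlabeled n}) :
    `|\sum_(t in A) CUA alpha t - \sum_(t in A) CUA beta t| <= 1.
  by have /andP[? ?] := bd _ A a01; have /andP[? ?] := bd _ A b01; rewrite ler_norml; lra.
apply/andP; split.
  apply: ub_le_sup; last by exists S.
  by exists 1 => _ [A _ <-]; exact: le1.
apply: ge_sup; first by exists `|\sum_(t in S) CUA alpha t - \sum_(t in S) CUA beta t|; exists S.
by move=> _ [A _ <-]; exact: le1.
Qed.

Local Open Scope classical_set_scope.

Theorem corollary1p3 (R : realType) (alpha alpha' : R)
  (halpha : 0 <= alpha <= 1) (halpha' : 0 <= alpha' <= 1)
  (hneq : alpha <> alpha') :
  TV (CUA alpha (n := n)) (CUA alpha' (n := n)) @[n --> \oo] --> (1 : R).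
Proof.
apply/cvgrPdist_le => e e0.
have /andP[a0 a1] := halpha; have /andP[b0 b1] := halpha'.
have sep : \forall n \near \oo, exists S : {set unlabeled n * unlabeled n},
    1 - e <= `|\sum_(t in S) CUA alpha t - \sum_(t in S) CUA alpha' t|.
  have /orP[lt|lt] : (alpha < alpha') || (alpha' < alpha) by rewrite -neq_lt; apply/eqP.
    apply: filterS (separation a0 lt b1 e0) => n [S hS]; exists S.
    by rewrite distrC; apply: le_trans hS (ler_norm _).
  apply: filterS (separation b0 lt a1 e0) => n [S hS]; exists S.
  by apply: le_trans hS (ler_norm _).
apply: filterS sep => n [S hS].
have /andP[h1 h2] := TV_bounds S halpha halpha'.
by rewrite ger0_norm ?subr_ge0 //; have := le_trans hS h1; lra.
Qed.
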